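(* Let $n=2^r$ with $r\in\{0,1,2,\dots\}$, let $f$ be a function on $(0,\infty)$, and put $F(y)=\mathcal{L}_n\{f(x);y^{1/n}\}$. Let $a\in\mathbb{R}$. Suppose that $F$ is an analytic function of $y$ except at finitely many singular points $y_1,\dots,y_m$, each of which lies to the left of the vertical line $\operatorname{Re} y=a$; that $y=0$ is not a branch point of $F$; and that $F(y)\to 0$ as $y\to\infty$ in the left half plane $\operatorname{Re} y\le a$. Then, for $x>0$, $$\mathcal{L}_n^{-1}\{\mathcal{L}_n\{f(x);y\}\}=\frac{1}{2\pi i}\int_{a-i\infty}^{a+i\infty} n\,\mathcal{L}_n\{f(x);y^{1/n}\}\exp(yx^n)\,dy=\sum_{j=1}^{m}\operatorname{Res}\Big[n\,\mathcal{L}_n\{f(x);y^{1/n}\}\exp(yx^n);\ y=y_j\Big].$$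
   Context: For $n=2^r$, the $\mathcal{L}_n$-transform of a function $f$ on $(0,\infty)$ is $$\mathcal{L}_n\{f(x);y\}=\int_0^\infty x^{n-1}\exp(-x^ny^n)f(x)\,dx .$$ It is related to the Laplace transform $\mathcal{L}\{g(x);y\}=\int_0^\infty e^{-xy}g(x)\,dx$ by $\mathcal{L}_n\{f(x);y\}=\frac1n\mathcal{L}\{f(x^{1/n});y^n\}$, so $F(y)=\mathcal{L}_n\{f(x);y^{1/n}\}=\int_0^\infty x^{n-1}\exp(-x^n y)f(x)\,dx$ where the integral converges (a right half plane), and $F$ also denotes the analytic continuation of this function. $\mathcal{L}_n^{-1}$ denotes the inverse of the $\mathcal{L}_n$-transform, i.e. $\mathcal{L}_n^{-1}\{\mathcal{L}_n\{f(x);y\}\}$ is the original function $f(x)$, functions that agree almost everywhere being identified. The integral $\int_{a-i\infty}^{a+i\infty}$ means $\lim_{R\to\infty}\int_{a-iR}^{a+iR}$ along the line $\operatorname{Re}y=a$.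
   Formalization: The first equality (f equals the line integral for almost every x>0) is proved assuming the integral defining the transform converges absolutely on Re y=a; without this it is false, as an entire F tending to 0 in Re y≤a can transform a nonzero f. The residue formula needs no such assumption. *)

(* Defs.v *)
(* MathComp / MathComp-Analysis world. *)
From HB Require Import structures.
From mathcomp Require Import all_boot all_order all_algebra.
From mathcomp Require Import complex.
From mathcomp Require Import all_classical all_reals all_analysis.

Set Implicit Arguments.
Unset Strict Implicit.
Unset Printing Implicit Defensive.

Import Order.TTheory GRing.Theory Num.Theory numFieldNormedType.Exports.
Local Open Scope classical_set_scope.
Local Open Scope ring_scope.
Local Open Scope complex_scope.

(* R[i] as a normed module over itself, with the topology of the modulus, so
   that [derivable F y 1] is complex differentiability of F at y. *)
HB.instance Definition _ (R : rcfType) := NormedModule.copy R[i] R[i]^o.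

Section ComplexIntegrals.
Variable R : realType.

Definition cexp (z : R[i]) : R[i] :=
  (expR (complex.Re z))%:C * (cos (complex.Im z) +i* sin (complex.Im z)).

(* Lebesgue integrability and integral of complex-valued functions of a real
   variable, by real and imaginary parts. *)
Definition cintegrable (D : set R) (g : R -> R[i]) : Prop :=
  (@lebesgue_measure R).-integrable D (EFin \o (fun x => complex.Re (g x))) /\
  (@lebesgue_measure R).-integrable D (EFin \o (fun x => complex.Im (g x))).

Definition cintegral (D : set R) (g : R -> R[i]) : R[i] :=
  (\int[@lebesgue_measure R]_(x in D) complex.Re (g x))%R +i*
  (\int[@lebesgue_measure R]_(x in D) complex.Im (g x))%R.

(* Integral of g from a - iT to a + iT, with dy = 'i dt. *)
Definition segment_integral (a : R) (g : R[i] -> R[i]) (T : R) : R[i] :=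
  'i * cintegral `[- T, T] (fun t => g (a +i* t)).

(* Meaningful only when the limit exists. *)
Definition vline_integral (a : R) (g : R[i] -> R[i]) : R[i] :=
  lim (segment_integral a g T @[T --> +oo]).

(* Integral of g over the circle |y - y0| = rho, traversed once
   counterclockwise. *)
Definition circle_integral (g : R[i] -> R[i]) (y0 : R[i]) (rho : R) : R[i] :=
  cintegral `[0, 2 * pi] (fun t =>
    g (y0 + rho%:C * (cos t +i* sin t)) *
    ('i * rho%:C * (cos t +i* sin t))).

Definition two_pi_i : R[i] := (2 * pi)%:C * 'i.

(* When g is holomorphic on a punctured neighbourhood of y0, the expression
   under the limit does not depend on rho for rho > 0 small enough. *)
Definition residue (g : R[i] -> R[i]) (y0 : R[i]) : R[i] :=
  lim (two_pi_i^-1 * circle_integral g y0 rho @[rho --> 0^'+]).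

(* F being a (single-valued) function, y0 fails to be a branch point exactly
   when F is holomorphic around y0, except possibly at y0. *)
Definition branch_point (F : R[i] -> R[i]) (y0 : R[i]) : Prop :=
  ~ \forall y \near y0^', derivable F y (1 : R[i]).

Definition vanishes_at_infinity_on (D : set R[i]) (F : R[i] -> R[i]) : Prop :=
  forall e : R, 0 < e ->
  exists M : R, forall y, D y -> M%:C < `|y| -> `|F y| < e%:C.

End ComplexIntegrals.

Section LnTransform.
Variable R : realType.

Definition Ln_integrand (n : nat) (f : R -> R[i]) (y : R[i]) (x : R) : R[i] :=
  (x ^+ n.-1)%:C * cexp (- ((x ^+ n)%:C * y ^+ n)) * f x.

Definition Ln_convergent (n : nat) (f : R -> R[i]) (y : R[i]) : Prop :=
  cintegrable `]0, +oo[ (Ln_integrand n f y).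

Definition Ln_transform (n : nat) (f : R -> R[i]) (y : R[i]) : R[i] :=
  cintegral `]0, +oo[ (Ln_integrand n f y).

(* F agrees with y |-> L_n{f(x); y^(1/n)} on some right half plane on which the
   integral converges.  The choice of the n-th root [n.-root y] is immaterial,
   as [Ln_integrand n f z] depends on z only through z ^+ n. *)
Definition Ln_continuation (n : nat) (f : R -> R[i]) (F : R[i] -> R[i]) :
    Prop :=
  exists c : R, forall y, c < complex.Re y ->
    Ln_convergent n f (n.-root y) /\ F y = Ln_transform n f (n.-root y).

(* The line Re y = a lies in the half plane where the integral defining
   L_n{f(x); y^(1/n)} converges.  If F, the continuation of this transform, is
   holomorphic except at y_1, ..., y_m, all satisfying Re y_j < a, and tends to
   0 at infinity in Re y <= a, then f cannot be the sum of the residues of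
   n F(y) exp (y x^n) unless this holds: that sum is
   O(exp (s x^n)) as x tends to +oo for every s > max_j Re y_j.  It does not
   follow from these conditions on F: there are nonzero entire functions that
   are O(|y|^-2) off a half-strip |Re y| <= c, Im y >= 0, and these are Laplace
   transforms on Re y > c, without singularities. *)
Definition Ln_convergent_on_line (n : nat) (f : R -> R[i]) (a : R) : Prop :=
  forall y, complex.Re y = a -> Ln_convergent n f (n.-root y).

(* n L_n{f(x); y^(1/n)} exp(y x^n), L_n{f(x); y^(1/n)} being continued to F. *)
Definition inversion_integrand (n : nat) (F : R[i] -> R[i]) (x : R)
    (y : R[i]) : R[i] :=
  n%:R * F y * cexp (y * (x ^+ n)%:C).

End LnTransform.

(* Main.v *)
Require Import Defs.
From mathcomp Require Import all_boot all_order all_algebra.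
From mathcomp Require Import complex ring lra.
From mathcomp Require Import all_classical all_reals all_analysis.
From mathcomp Require Import measurable_realfun.
Set Implicit Arguments.
Unset Strict Implicit.
Unset Printing Implicit Defensive.
Import Order.TTheory GRing.Theory Num.Theory numFieldNormedType.Exports.
Import Normc.
Local Open Scope classical_set_scope.
Local Open Scope ring_scope.
Local Open Scope complex_scope.
Local Notation Re := complex.Re.
Local Notation Im := complex.Im.

(** Let S(x) be the sum of the residues of n F(y) exp (y x^n), and u = x^n.

    That the integral along Re y = a converges to 2 pi i S(x) is the residue
    theorem on the rectangle with corners -T - iT and a + iT.  Its three other
    sides contribute little: |F| is small there, a horizontal side carries the
    weight exp (u Re y), whose integral is at most exp (u a) / u, and the left
    side of length 2T carries the weight exp (- u T)
    ([segment_integral_close]).  The residue theorem itself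
    ([rect_residue_theorem]) is obtained from Goursat's theorem by cutting the
    rectangle until it is a small square around one singularity p; there a
    primitive in the coordinate log (y - p) shows that the integrals over the
    square and over circles agree ([punctured_disc_integrals]).

    That f = S almost everywhere is shown by comparing Laplace transforms.  The
    hypothesis gives one formula for F on a far half plane only; but when the
    transform of f converges for Re y = a, it is holomorphic on Re y > a, so it
    equals F there by the identity theorem ([identity_halfplane]).  Consequently F is bounded outside a
    disc, and F minus the sum L of its principal parts is a bounded entire function, hence
    constant ([regular_part_constant]).  On the other side, writing S as an
    integral over one fixed rectangle shows that its transform is L
    ([laplace_inverse_transform]).  So the transforms of f and S differ by a
    constant on Re y > a.

    The last step is a uniqueness theorem that tolerates this constant.  For
    real b > a and h(x) = x^(n-1) exp (- b x^n) (f(x) - S(x)), all the moments of h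
    against exp (- k x^n), k = 0, 1, 2 ..., are equal; taking differences, h is
    orthogonal to (1 - exp (- N x^n))^M for all N and all M > 0.  With M
    growing like N exp (N t^n) these functions tend boundedly to the indicator
    function of x > t, so that h has integral zero over every half-line and
    vanishes almost everywhere ([ae_eq0_of_moments]). *)

(** * Modulus and limits in the complex plane *)

Section ComplexBasics.
Variable R : realType.
Local Notation C := R[i].
Implicit Types (x y z w : C).

Lemma normcE z : `|z| = (normc z)%:C. Proof. by []. Qed.

Lemma normc_ge0 z : 0 <= normc z.
Proof. by rewrite -ler0c -normcE normr_ge0. Qed.

Lemma normc_gt0 z : (0 < normc z) = (z != 0).
Proof. by rewrite -ltcR -normcE normr_gt0. Qed.

Lemma normcD z w : normc (z + w) <= normc z + normc w.
Proof. by rewrite -lecR rmorphD -!normcE ler_normD. Qed.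

Lemma normcN z : normc (- z) = normc z.
Proof. by apply: complexI; rewrite -!normcE normrN. Qed.

Lemma normcB z w : normc (z - w) <= normc z + normc w.
Proof. by rewrite -(normcN w) normcD. Qed.

Lemma distc_sym z w : normc (z - w) = normc (w - z).
Proof. by rewrite -normcN opprB. Qed.

Lemma normcR (r : R) : normc r%:C = `|r|.
Proof. by rewrite /= expr0n addr0 sqrtr_sqr. Qed.

Lemma normci : normc ('i : C) = 1.
Proof. by rewrite /= expr0n add0r expr1n sqrtr1. Qed.

Lemma normcX z n : normc (z ^+ n) = normc z ^+ n.
Proof. by elim: n => [|n IH]; rewrite ?expr0 ?normc1// !exprS normcM IH. Qed.

Lemma le_normc_Re z : `|Re z| <= normc z.
Proof. by rewrite -lecR; exact: normc_ge_Re. Qed.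

Lemma le_normc_Im z : `|Im z| <= normc z.
Proof.
by case: z => a b /=; rewrite -sqrtr_sqr ler_wsqrtr// lerDr sqr_ge0.
Qed.

Lemma normc_le_ReIm z : normc z <= `|Re z| + `|Im z|.
Proof.
rewrite [z in normc z]complexE (le_trans (normcD _ _))// normcR normcM normci.
by rewrite mul1r normcR.
Qed.

Lemma ReD z w : Re (z + w) = Re z + Re w. Proof. by case: z; case: w. Qed.

Lemma ImD z w : Im (z + w) = Im z + Im w. Proof. by case: z; case: w. Qed.

Lemma ReN z : Re (- z) = - Re z. Proof. by case: z. Qed.

Lemma ImN z : Im (- z) = - Im z. Proof. by case: z. Qed.

Lemma ReM z w : Re (z * w) = Re z * Re w - Im z * Im w.
Proof. by case: z; case: w. Qed.

Lemma ImM z w : Im (z * w) = Re z * Im w + Im z * Re w.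
Proof. by case: z; case: w. Qed.

Lemma ReMr (r : R) z : Re (r%:C * z) = r * Re z.
Proof. by rewrite ReM /= mul0r subr0. Qed.

Lemma ImMr (r : R) z : Im (r%:C * z) = r * Im z.
Proof. by rewrite ImM /= mul0r addr0. Qed.

Lemma eq_ReIm z w : Re z = Re w -> Im z = Im w -> z = w.
Proof. by case: z; case: w => a b c d /= -> ->. Qed.

Lemma cvgcP (T : Type) (F : set_system T) (FF : Filter F) (f : T -> C) l :
  f @ F --> l <->
  forall e : R, 0 < e -> \forall x \near F, normc (l - f x) < e.
Proof.
split => [/cvgrPdist_lt H e e0|H].
  have e0' : 0 < e%:C by rewrite ltcR.
  by have := H _ e0'; apply: filterS => x; rewrite ltcR.
apply/cvgrPdist_lt => -[e1 e2]; rewrite ltcE/= => /andP[/eqP -> e0].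
by have := H _ e0; apply: filterS => x; rewrite ltcR.
Qed.

Lemma nbhscP z (P : set C) :
  (\forall w \near z, P w) <->
  exists2 e : R, 0 < e & forall w, normc (w - z) < e -> P w.
Proof.
split => [/nbhs_ballP[[e1 e2] /=]|[e e0 H]].
  rewrite ltcE/= => /andP[/eqP -> e0] H; exists e1 => // w wz.
  by apply: H; rewrite -ball_normE /ball_/= distrC normcE ltcR.
apply/nbhs_ballP; exists e%:C; first by rewrite /= ltcR.
by move=> w; rewrite -ball_normE /ball_/= distrC normcE ltcR; exact: H.
Qed.

Lemma continuous_Re : continuous (@complex.Re R).
Proof.
move=> z; apply/(@cvgrPdist_lt _ _ _ (nbhs z) (nbhs_filter z)) => e e0; apply/nbhscP; exists e => // w wz.
apply: le_lt_trans wz; rewrite distrC -ReN -ReD; exact: le_normc_Re.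
Qed.

Lemma continuous_Im : continuous (@complex.Im R).
Proof.
move=> z; apply/(@cvgrPdist_lt _ _ _ (nbhs z) (nbhs_filter z)) => e e0; apply/nbhscP; exists e => // w wz.
apply: le_lt_trans wz; rewrite distrC -ImN -ImD; exact: le_normc_Im.
Qed.

Lemma continuous_RtoC : continuous (fun r : R => r%:C : C).
Proof.
move=> r; apply/(cvgcP (nbhs_filter r)) => e e0; near=> s.
rewrite -rmorphB normcR; near: s.
by move: e e0; apply/cvgrPdist_lt; exact: cvg_id.
Unshelve. all: by end_near. Qed.

Lemma cvg_ReIm (T : Type) (F : set_system T) (FF : Filter F) (f : T -> C) l :
  f @ F --> l <->
  (Re (f x) @[x --> F] --> Re l) /\ (Im (f x) @[x --> F] --> Im l).
Proof.
split=> [fl|[fr fi]].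
  split; first exact: (continuous_cvg _ (@continuous_Re l) fl).
  exact: (continuous_cvg _ (@continuous_Im l) fl).
apply/cvgcP => e e0.
have e2 : 0 < e / 2 by rewrite divr_gt0.
move: fr fi => /cvgrPdist_lt/(_ _ e2) fr /cvgrPdist_lt/(_ _ e2) fi.
near=> x; apply: (le_lt_trans (normc_le_ReIm _)).
rewrite ReD ImD ReN ImN (splitr e) ltrD//; by near: x.
Unshelve. all: by end_near. Qed.

End ComplexBasics.

(** Differentiability as affine approximation; it covers real and complex
    derivatives at once. *)
Lemma is_derive_approx (K : numFieldType) (W : normedModType K) (f : K -> W)
    (z : K) (d : W) :
  is_derive z 1 f d <->
  forall e : K, 0 < e -> \forall h \near (0 : K),
    `|f (z + h) - f z - h *: d| <= e * `|h|.
Proof.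
split=> [[df dE] e e0|H].
  have : (fun h => h^-1 *: ((f \o shift z) (h *: 1) - f z)) @ 0^' --> d.
    by rewrite -dE; exact: df.
  move=> /cvgrPdist_le/(_ _ e0).
  rewrite near_withinE /=; apply: filterS => h Hh.
  have [->|h0] := eqVneq h 0; first by rewrite addr0 subrr scale0r subr0 !normr0 mulr0.
  move: (Hh h0) => /=; rewrite [h *: 1]mulr1 [h + z]addrC -(ler_pM2r (_ : 0 < `|h|)) ?normr_gt0//.
  apply: le_trans; rewrite mulrC -normrZ scalerBr scalerA divff// scale1r.
  by rewrite distrC.
have cv : (fun h => h^-1 *: ((f \o shift z) (h *: 1) - f z)) @ 0^' --> d.
  apply/cvgrPdist_le => e e0; rewrite near_withinE.
  have := H _ e0; apply: filterS => h /= Hh h0.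
  rewrite [h *: 1]mulr1 [h + z]addrC -(ler_pM2r (_ : 0 < `|h|)) ?normr_gt0//.
  apply: le_trans Hh; rewrite mulrC -normrZ scalerBr scalerA divff// scale1r.
  by rewrite distrC.
split; first by apply/cvg_ex; exists d.
exact/cvg_lim.
Qed.

(** * Integrals of complex-valued functions of a real variable *)

Section ComplexIntegral.
Variable R : realType.
Local Notation C := R[i].
Local Notation mu := (@lebesgue_measure R).
Implicit Types (D : set (measurableTypeR R)) (f g : R -> C).

Lemma eq_cintegral D f g : {in D, f =1 g} -> cintegral D f = cintegral D g.
Proof.
by move=> fg; congr Complex; apply: eq_Rintegral => x xD; rewrite fg.
Qed.

Lemma eq_cintegrable D f g : measurable D -> {in D, f =1 g} ->
  cintegrable D f -> cintegrable D g.
Proof.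
move=> mD fg [fr fi]; split.
- by apply: eq_integrable fr => // x xD /=; rewrite fg.
- by apply: eq_integrable fi => // x xD /=; rewrite fg.
Qed.

Lemma cintegrableD D f g : measurable D -> cintegrable D f ->
  cintegrable D g -> cintegrable D (fun x => f x + g x).
Proof.
move=> mD [fr fi] [gr gi]; split.
- have := (integrableD mD fr gr).
  by apply: eq_integrable => // x _ /=; rewrite ReD EFinD.
- have := (integrableD mD fi gi).
  by apply: eq_integrable => // x _ /=; rewrite ImD EFinD.
Qed.

Lemma cintegrableZ D f (c : C) : measurable D -> cintegrable D f ->
  cintegrable D (fun x => c * f x).
Proof.
move=> mD [fr fi]; split.
- have := (integrableB mD (integrableZl mD (Re c) fr)
    (integrableZl mD (Im c) fi)).
  by apply: eq_integrable => // x _ /=; rewrite ReM EFinB !EFinM.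
- have := (integrableD mD (integrableZl mD (Re c) fi)
    (integrableZl mD (Im c) fr)).
  by apply: eq_integrable => // x _ /=; rewrite ImM EFinD !EFinM.
Qed.

Lemma cintegrableB D f g : measurable D -> cintegrable D f ->
  cintegrable D g -> cintegrable D (fun x => f x - g x).
Proof.
move=> mD fi gi; have := cintegrableD mD fi (cintegrableZ (-1) mD gi).
by apply: eq_cintegrable => // x _; rewrite mulN1r.
Qed.

Lemma cintegralD D f g : measurable D -> cintegrable D f -> cintegrable D g ->
  cintegral D (fun x => f x + g x) = cintegral D f + cintegral D g.
Proof.
move=> mD [fr fi] [gr gi]; apply: eq_ReIm => /=.
  by rewrite -RintegralD//; apply: eq_Rintegral => x _; rewrite ReD.
by rewrite -RintegralD//; apply: eq_Rintegral => x _; rewrite ImD.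
Qed.

Lemma cintegralZ D f (c : C) : measurable D -> cintegrable D f ->
  cintegral D (fun x => c * f x) = c * cintegral D f.
Proof.
move=> mD [fr fi]; have ir r := integrableZl mD r fr.
have ii r := integrableZl mD r fi.
apply: eq_ReIm; rewrite ?ReM ?ImM /=.
  rewrite -!RintegralZl// -RintegralB//; [|exact: ir|exact: ii].
  by apply: eq_Rintegral => x _; rewrite ReM.
rewrite -!RintegralZl// -RintegralD//; [|exact: ii|exact: ir].
by apply: eq_Rintegral => x _; rewrite ImM.
Qed.

Lemma cintegralB D f g : measurable D -> cintegrable D f -> cintegrable D g ->
  cintegral D (fun x => f x - g x) = cintegral D f - cintegral D g.
Proof.
move=> mD fi gi; rewrite -[- cintegral D g]mulN1r -cintegralZ//.
rewrite -cintegralD//; last exact: cintegrableZ.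
by apply: eq_cintegral => x _; rewrite mulN1r.
Qed.

(** Real and imaginary part are estimated separately, whence the factor 2; no sharp
    constant is needed below. *)
Lemma normc_cintegral_le D f (k : R -> R) : measurable D -> cintegrable D f ->
  mu.-integrable D (EFin \o k) -> (forall x, D x -> normc (f x) <= k x) ->
  normc (cintegral D f) <= 2 * \int[mu]_(x in D) k x.
Proof.
move=> mD [fr fi] ki fk; apply: (le_trans (normc_le_ReIm _)) => /=.
rewrite mulr_natl mulr2n; apply: lerD.
- apply: le_trans (le_normr_Rintegral mD fr) _.
  apply: le_Rintegral => //; first exact: (integrable_norm fr).
  by move=> x Dx; apply: le_trans (fk x Dx); exact: le_normc_Re.
- apply: le_trans (le_normr_Rintegral mD fi) _.
  apply: le_Rintegral => //; first exact: (integrable_norm fi).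
  by move=> x Dx; apply: le_trans (fk x Dx); exact: le_normc_Im.
Qed.

Lemma cintegrable_le D f (k : R -> R) : measurable D ->
  measurable_fun D (fun x => Re (f x)) -> measurable_fun D (fun x => Im (f x)) ->
  mu.-integrable D (EFin \o k) -> (forall x, D x -> normc (f x) <= k x) ->
  cintegrable D f.
Proof.
move=> mD mr mi ki fk; split.
- apply: (le_integrable mD) ki; first exact/measurable_EFinP.
  move=> x Dx /=; rewrite lee_fin (le_trans (le_normc_Re _))//.
  by rewrite (le_trans (fk x Dx))// ler_norm.
- apply: (le_integrable mD) ki; first exact/measurable_EFinP.
  move=> x Dx /=; rewrite lee_fin (le_trans (le_normc_Im _))//.
  by rewrite (le_trans (fk x Dx))// ler_norm.
Qed.

Lemma cintegrable_normc D f : measurable D -> cintegrable D f ->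
  mu.-integrable D (EFin \o (fun x => normc (f x))).
Proof.
move=> mD [fr fi].
have fN := integrableD mD (integrable_norm fr) (integrable_norm fi).
apply: (le_integrable mD) fN.
- apply/measurable_EFinP.
  have mr : measurable_fun D (fun x => Re (f x)).
    by case/integrableP: fr => /measurable_EFinP.
  have mi : measurable_fun D (fun x => Im (f x)).
    by case/integrableP: fi => /measurable_EFinP.
  apply: (eq_measurable_fun (fun x => Num.sqrt (Re (f x) ^+ 2 + Im (f x) ^+ 2))).
    by move=> x _; case: (f x).
  apply: (@measurableT_comp _ _ _ _ _ _ (@Num.sqrt R)).
    by apply: continuous_measurable_fun; exact: sqrt_continuous.
  apply: measurable_funD.
    exact: (measurable_funX 2 mr).
  exact: (measurable_funX 2 mi).
- move=> x Dx /=; rewrite lee_fin (ger0_norm (normc_ge0 _)).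
  by rewrite (le_trans (normc_le_ReIm _))// ler_norm.
Qed.

Section Continuous.
Variables (a b : R) (f : R -> C).
Hypothesis fc : {in `[a, b], continuous f}.

Lemma continuous_in_Re : {in `[a, b], continuous (fun x => Re (f x))}.
Proof.
move=> x xab; apply: continuous_comp; first exact: fc.
exact: continuous_Re.
Qed.

Lemma continuous_in_Im : {in `[a, b], continuous (fun x => Im (f x))}.
Proof.
move=> x xab; apply: continuous_comp; first exact: fc.
exact: continuous_Im.
Qed.

Lemma continuous_in_integrable (h : R -> R) : {in `[a, b], continuous h} ->
  mu.-integrable `[a, b] (EFin \o h).
Proof.
move=> hc; apply: continuous_compact_integrable; first exact: segment_compact.
by apply: continuous_in_subspaceT => x; rewrite inE; exact: hc.
Qed.

Lemma continuous_cintegrable : cintegrable `[a, b] f.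
Proof.
split; apply: continuous_in_integrable.
- exact: continuous_in_Re.
- exact: continuous_in_Im.
Qed.

Lemma normc_cintegral_seg (M : R) : a <= b ->
  (forall x, a <= x <= b -> normc (f x) <= M) ->
  normc (cintegral `[a, b] f) <= 2 * M * (b - a).
Proof.
move=> ab fM; rewrite -mulrA.
have -> : M * (b - a) = \int[mu]_(x in `[a, b]) (fun=> M) x.
  rewrite Rintegral_cst//= lebesgue_measure_itv/= lte_fin.
  by move: ab; rewrite le_eqVlt => /orP[/eqP ->|->]//; rewrite ltxx subrr mulr0.
apply: normc_cintegral_le => //; first exact: continuous_cintegrable.
by apply: continuous_in_integrable => x _; exact: cvg_cst.
Qed.

Lemma cintegral_split (c : R) : a <= c <= b ->
  cintegral `[a, b] f = cintegral `[a, c] f + cintegral `[c, b] f.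
Proof.
move=> /andP[ac cb]; have [fr fi] := continuous_cintegrable.
have H (h : R -> R) : mu.-integrable `[a, b] (EFin \o h) ->
    \int[mu]_(x in `[a, b]) h x =
    \int[mu]_(x in `[a, c]) h x + \int[mu]_(x in `[c, b]) h x.
  move=> ih; have := @Rintegral_itvB _ h (BLeft a) (BRight b) c ih.
  rewrite !bnd_simp => /(_ ac cb).
  rewrite Rintegral_itv_obnd_cbnd; first by move=> <-; rewrite addrC subrK.
  apply: integrableS ih => //; apply: subset_itvr; by rewrite bnd_simp.
by apply: eq_ReIm; rewrite ?ReD ?ImD /=; exact: H.
Qed.

End Continuous.

(** By coordinates: the plane is a normed module over the complex numbers only,
    so a path has no derivative in the sense of [is_derive]. *)
Definition path_derive (p : R -> C) (t : R) (d : C) : Prop :=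
  is_derive t (1 : R) (fun s => Re (p s)) (Re d) /\
  is_derive t (1 : R) (fun s => Im (p s)) (Im d).

(** The derivative is given at the end points too, from both sides, which frees the
    user from one-sided limits. *)
Lemma Rintegral_FTC (a b : R) (u du : R -> R) : a <= b ->
  {in `[a, b], continuous du} ->
  (forall t, a <= t <= b -> is_derive t (1 : R) u (du t)) ->
  \int[mu]_(x in `[a, b]) du x = u b - u a.
Proof.
rewrite le_eqVlt => /predU1P[<- _ _|ab duc duE].
  by rewrite set_itv1 Rintegral_set1 subrr.
rewrite /Rintegral (continuous_FTC2 ab (F := u))//.
- by apply: continuous_in_subspaceT => x; rewrite inE; exact: duc.
- have cu t : a <= t <= b -> {for t, continuous u}.
    move=> tab; apply: differentiable_continuous.
    by apply/derivable1_diffP; case: (duE t tab).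
  split.
  + move=> t; rewrite in_itv/= => /andP[at_ tb].
    by case: (duE t) => //; rewrite !ltW.
  + by apply: cvg_at_right_filter; apply: cu; rewrite lexx ltW.
  + by apply: cvg_at_left_filter; apply: cu; rewrite lexx ltW.
- move=> t; rewrite in_itv/= => /andP[at_ tb].
  by rewrite derive1E; case: (duE t) => //; rewrite !ltW.
Qed.

Lemma path_FTC (a b : R) (p dp : R -> C) : a <= b ->
  {in `[a, b], continuous dp} ->
  (forall t, a <= t <= b -> path_derive p t (dp t)) ->
  cintegral `[a, b] dp = p b - p a.
Proof.
move=> ab dpc dpE; apply: eq_ReIm; rewrite ?ReD ?ImD ?ReN ?ImN /=.
- apply: (@Rintegral_FTC a b (fun t => Re (p t)) (fun t => Re (dp t)) ab).
    exact: continuous_in_Re.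
  by move=> t /dpE[].
- apply: (@Rintegral_FTC a b (fun t => Im (p t)) (fun t => Im (dp t)) ab).
    exact: continuous_in_Im.
  by move=> t /dpE[].
Qed.

Lemma cintegral_affine (c d : R) (f : R -> C) (a b : R) : a <= b -> 0 < c ->
  {in `[c * a + d, c * b + d], continuous f} ->
  cintegral `[c * a + d, c * b + d] f =
  c%:C * cintegral `[a, b] (fun t => f (c * t + d)).
Proof.
move=> ab c0 fc.
have dF x : is_derive x (1 : R) (fun t => c * t + d) c.
  by apply: is_derive_eq; rewrite /GRing.scale /= mulr1 ?scaler0 addr0.
have H (h : R -> R) : {in `[c * a + d, c * b + d], continuous h} ->
    \int[mu]_(x in `[c * a + d, c * b + d]) h x =
    c * \int[mu]_(x in `[a, b]) h (c * x + d).
  move=> hc.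
  have F'E : derive1 (fun t => c * t + d) = cst c.
    by apply/funext => x; rewrite derive1E; case: (dF x).
  have cF : continuous (fun t : R => c * t + d).
    move=> x; apply: differentiable_continuous.
    by apply/derivable1_diffP; case: (dF x).
  have mono x y : x < y -> c * x + d < c * y + d.
    by rewrite ltrD2r ltr_pM2l.
  have hFc : {in `[a, b], continuous (fun x => h (c * x + d))}.
    move=> x; rewrite in_itv/= => /andP[ax xb].
    apply: (@continuous_comp _ _ _ (fun t => c * t + d) h); first exact: cF.
    by apply: hc; rewrite in_itv/= !lerD2r !ler_pM2l// ax.
  rewrite -RintegralZl//; last exact: continuous_in_integrable.
  rewrite /Rintegral (@integration_by_substitution_increasing _ (fun t => c * t + d))//.
  - by congr fine; apply: eq_integral => x _ /=; rewrite F'E /= mulrC.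
  - by move=> x y _ _; exact: mono.
  - by rewrite F'E => x _; exact: cvg_cst.
  - by rewrite F'E; exact: is_cvg_cst.
  - by rewrite F'E; exact: is_cvg_cst.
  - split.
    + by move=> x _; case: (dF x).
    + by apply: cvg_at_right_filter; exact: cF.
    + by apply: cvg_at_left_filter; exact: cF.
  - by apply: continuous_in_subspaceT => x; rewrite inE; exact: hc.
apply: eq_ReIm; rewrite ?ReMr ?ImMr /=.
- by apply: (H (fun t => Re (f t))); exact: continuous_in_Re.
- by apply: (H (fun t => Im (f t))); exact: continuous_in_Im.
Qed.
End ComplexIntegral.

(** * Integrals over segments *)

Section LineIntegrals.
Variable R : realType.
Local Notation C := R[i].
Local Notation mu := (@lebesgue_measure R).
Implicit Types (z w : C) (g : C -> C).

(** The error bound without division by [h], so that [h = 0] needs no separate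
    treatment. *)
Lemma cderiveP g z d :
  is_derive z (1 : C) g d <->
  forall e : R, 0 < e ->
  exists2 r : R, 0 < r & forall h, normc h < r ->
    normc (g (z + h) - g z - d * h) <= e * normc h.
Proof.
split=> [/is_derive_approx H e e0|H].
  have e0' : 0 < e%:C by rewrite ltcR.
  have /nbhscP[r r0 Hr] := H _ e0'.
  exists r => // h hr; have := Hr h; rewrite subr0 => /(_ hr).
  by rewrite /GRing.scale /= !normcE -rmorphM lecR mulrC.
apply/is_derive_approx => -[e1 e2]; rewrite ltcE/= => /andP[/eqP -> e0].
apply/nbhscP; have [r r0 Hr] := H _ e0.
exists r => // h; rewrite subr0 => hr.
by have := Hr _ hr; rewrite -lecR rmorphM [h *: d]mulrC.
Qed.

Lemma path_deriveP (p : R -> C) (t : R) (d : C) :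
  path_derive p t d <->
  forall e : R, 0 < e -> \forall h \near (0 : R),
    normc (p (t + h) - p t - h%:C * d) <= e * `|h|.
Proof.
split=> [[/is_derive_approx Hr /is_derive_approx Hi] e e0|H].
  have e2 : 0 < e / 2 by rewrite divr_gt0.
  have := Hi _ e2; have := Hr _ e2; apply: filterS2 => h rh ih.
  apply: (le_trans (normc_le_ReIm _)).
  rewrite !(ReD, ImD, ReN, ImN, ReMr, ImMr) (splitr e) mulrDl.
  exact: lerD.
split; apply/is_derive_approx => e e0; have := H e e0; apply: filterS => h.
  apply: le_trans; apply: le_trans (le_normc_Re _).
  by rewrite !(ReD, ReN, ReMr).
apply: le_trans; apply: le_trans (le_normc_Im _).
by rewrite !(ImD, ImN, ImMr).
Qed.

Lemma derivable_continuousc g z : derivable g z (1 : C) -> {for z, continuous g}.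
Proof. by move=> /derivable1_diffP; exact: differentiable_continuous. Qed.

Lemma is_derive_continuousc g z d :
  is_derive z (1 : C) g d -> {for z, continuous g}.
Proof. by case=> dg _; exact: derivable_continuousc. Qed.

(** The common part of the chain rules for a path and for a complex function:
    [k] is the increment of the inner map, [l] that of its argument. *)
Lemma chain_estimate g w D d (e : R) : is_derive w (1 : C) g D -> 0 < e ->
  exists2 e' : R, 0 < e' & exists2 r : R, 0 < r & forall k l : C,
    normc (k - l * d) <= e' * normc l -> normc l < r ->
    normc (g (w + k) - g w - l * (D * d)) <= e * normc l.
Proof.
move=> /cderiveP Hg e0.
pose M := normc d + 1.
have M0 : 0 < M by rewrite ltr_wpDl// normc_ge0.
pose N := normc D + 1.
have N0 : 0 < N by rewrite ltr_wpDl// normc_ge0.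
have e1 : 0 < e / 2 / M by rewrite !divr_gt0.
have [r r0 Hr] := Hg _ e1.
exists (Num.min 1 (e / 2 / N)); first by rewrite lt_min ltr01 !divr_gt0.
exists (r / M); first by rewrite divr_gt0.
move=> k l kl lr.
have kM : normc k <= M * normc l.
  rewrite -[k](subrK (l * d)) (le_trans (normcD _ _))// normcM /M.
  rewrite mulrDl mul1r addrC [normc l * _]mulrC lerD2l.
  by rewrite (le_trans kl)// ler_piMl ?normc_ge0// ge_min lexx.
have kr : normc k < r.
  by rewrite (le_lt_trans kM)// mulrC -ltr_pdivlMr.
have {}Hr := Hr _ kr.
have -> : g (w + k) - g w - l * (D * d) =
  (g (w + k) - g w - D * k) + D * (k - l * d) by ring.
rewrite (le_trans (normcD _ _))// (splitr e) mulrDl; apply: lerD.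
  apply: (le_trans Hr); rewrite -mulrA ler_wpM2l ?divr_ge0 ?(ltW e0)//.
  by rewrite mulrC ler_pdivrMr// mulrC.
rewrite normcM; apply: (@le_trans _ _ (N * (Num.min 1 (e / 2 / N) * normc l))).
  by rewrite ler_pM ?normc_ge0// lerDl.
rewrite mulrA ler_wpM2r ?normc_ge0//.
by rewrite mulrC -ler_pdivlMr// ge_min lexx orbT.
Qed.

Lemma path_derive_comp (g : C -> C) (p : R -> C) t d D :
  path_derive p t d -> is_derive (p t) (1 : C) g D ->
  path_derive (g \o p) t (D * d).
Proof.
move=> /path_deriveP Hp Hg; apply/path_deriveP => e e0.
have [e' e'0 [r r0 Hr]] := chain_estimate d Hg e0.
have hr : \forall h \near (0 : R), `|h| < r by exact: nbhs0_lt.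
have := Hp _ e'0; move: hr; apply: filterS2 => h hr ph.
have := Hr (p (t + h) - p t) h%:C; 
by rewrite normcR addrCA subrr addr0; exact.
Qed.

Lemma is_derive_compc (f g : C -> C) z d D :
  is_derive z (1 : C) f d -> is_derive (f z) (1 : C) g D ->
  is_derive z (1 : C) (g \o f) (D * d).
Proof.
move=> /cderiveP Hf Hg; apply/cderiveP => e e0.
have [e' e'0 [r r0 Hr]] := chain_estimate d Hg e0.
have [r' r'0 Hr'] := Hf _ e'0.
exists (Num.min r r'); first by rewrite lt_min r0.
move=> h; rewrite lt_min => /andP[hr hr'].
have := Hr (f (z + h) - f z) h.
rewrite [f z + _]addrCA subrr addr0 [h * d]mulrC [h * (D * d)]mulrC.
by apply => //; exact: Hr'.
Qed.

Definition seg_path z w (t : R) : C := z + t%:C * (w - z).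

Lemma seg_path0 z w : seg_path z w 0 = z.
Proof. by rewrite /seg_path mul0r addr0. Qed.

Lemma seg_path1 z w : seg_path z w 1 = w.
Proof. by rewrite /seg_path mul1r addrC subrK. Qed.

Lemma path_derive_seg z w t : path_derive (seg_path z w) t (w - z).
Proof.
apply/path_deriveP => e e0; near=> h.
rewrite /seg_path rmorphD mulrDl.
have -> : z + (t%:C * (w - z) + h%:C * (w - z)) - (z + t%:C * (w - z))
  - h%:C * (w - z) = 0 by ring.
by rewrite normc0 mulr_ge0// ltW.
Unshelve. all: by end_near. Qed.

Lemma path_derive_continuous (p : R -> C) t d :
  path_derive p t d -> {for t, continuous p}.
Proof.
move=> [[dr _] [di _]].
move/derivable1_diffP: dr => /differentiable_continuous cr.
move/derivable1_diffP: di => /differentiable_continuous ci.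
exact/(cvg_ReIm (nbhs_filter t)).
Qed.

Lemma continuous_seg z w : continuous (seg_path z w).
Proof. by move=> t; exact: (path_derive_continuous (path_derive_seg z w t)). Qed.

Definition line_integral g z w : C :=
  (w - z) * cintegral `[0, 1] (fun t => g (seg_path z w t)).

(** Continuity as a function on the plane, which is stronger than continuity of
    the restriction of [g] to the segment. *)
Definition continuous_seg_on g z w :=
  forall t : R, 0 <= t <= 1 -> {for seg_path z w t, continuous g}.

Lemma continuous_seg_comp g z w : continuous_seg_on g z w ->
  {in `[0, 1], continuous (fun t => g (seg_path z w t))}.
Proof.
move=> gc t; rewrite in_itv/= => t01; apply: continuous_comp.
  exact: continuous_seg.
exact: gc.
Qed.

(** The chain rule turns [G] into a primitive along the segment. *)
Lemma line_FTC (G g : C -> C) z w : continuous_seg_on g z w ->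
  (forall t : R, 0 <= t <= 1 ->
    is_derive (seg_path z w t) (1 : C) G (g (seg_path z w t))) ->
  line_integral g z w = G w - G z.
Proof.
move=> gc Gg; have gc' := continuous_seg_comp gc.
rewrite /line_integral -cintegralZ//; last exact: continuous_cintegrable.
have -> : G w - G z = (G \o seg_path z w) 1 - (G \o seg_path z w) 0.
  by rewrite /= seg_path0 seg_path1.
apply: (path_FTC (p := G \o seg_path z w)); first exact: ler01.
  move=> t t01; apply: cvgM; [exact: cvg_cst|exact: gc'].
move=> t t01; rewrite mulrC; apply: path_derive_comp.
  exact: path_derive_seg.
exact: Gg.
Qed.

Lemma line_integralZ g z w c : continuous_seg_on g z w ->
  line_integral (fun y => c * g y) z w = c * line_integral g z w.
Proof.
move=> gc; rewrite /line_integral cintegralZ//; first by rewrite mulrCA.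
exact/continuous_cintegrable/continuous_seg_comp.
Qed.

Lemma line_integralB g (h : C -> C) z w :
  continuous_seg_on g z w -> continuous_seg_on h z w ->
  line_integral (fun y => g y - h y) z w =
  line_integral g z w - line_integral h z w.
Proof.
move=> gc hc; rewrite /line_integral cintegralB ?mulrBr//.
- exact/continuous_cintegrable/continuous_seg_comp.
- exact/continuous_cintegrable/continuous_seg_comp.
Qed.

Lemma normc_line_integral g z w (M : R) : continuous_seg_on g z w ->
  (forall t : R, 0 <= t <= 1 -> normc (g (seg_path z w t)) <= M) ->
  normc (line_integral g z w) <= 2 * M * normc (w - z).
Proof.
move=> gc gM; rewrite /line_integral normcM mulrC ler_wpM2r ?normc_ge0//.
have := normc_cintegral_seg (continuous_seg_comp gc) ler01 gM.
by rewrite subr0 mulr1.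
Qed.

Lemma seg_path_sub z w s t (u : R) :
  seg_path (seg_path z w s) (seg_path z w t) u = seg_path z w (s + u * (t - s)).
Proof. by rewrite /seg_path rmorphD rmorphM rmorphB; ring. Qed.

Lemma line_integral_sub g z w (s t : R) : 0 <= s -> s <= t -> t <= 1 ->
  continuous_seg_on g z w ->
  line_integral g (seg_path z w s) (seg_path z w t) =
  (w - z) * cintegral `[s, t] (fun u => g (seg_path z w u)).
Proof.
move=> s0; rewrite le_eqVlt => /predU1P[<- _ _|st t1 gc].
  rewrite /line_integral subrr mul0r.
  have -> : cintegral `[s, s] (fun u => g (seg_path z w u)) = 0.
    by apply: eq_ReIm => /=; rewrite set_itv1 Rintegral_set1.
  by rewrite mulr0.
have gc' : {in `[(t - s) * 0 + s, (t - s) * 1 + s],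
    continuous (fun u => g (seg_path z w u))}.
  rewrite mulr0 add0r mulr1 subrK => u; rewrite in_itv/= => /andP[su ut].
  apply: (continuous_seg_comp gc); rewrite in_itv/=.
  by rewrite (le_trans s0)//= (le_trans ut).
have ts0 : 0 < t - s by rewrite subr_gt0.
have := cintegral_affine ler01 ts0 gc'.
rewrite mulr0 add0r mulr1 subrK => ->.
rewrite /line_integral mulrA; congr (_ * _).
  by rewrite /seg_path rmorphB; ring.
by apply: eq_cintegral => u _; rewrite seg_path_sub addrC [u * _]mulrC.
Qed.

Lemma line_integral_split g z w (s : R) : 0 <= s <= 1 ->
  continuous_seg_on g z w ->
  line_integral g z w =
  line_integral g z (seg_path z w s) + line_integral g (seg_path z w s) w.
Proof.
move=> s01 gc; have /andP[s0 s1] := s01.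
have := line_integral_sub (lexx _) s0 s1 gc; rewrite seg_path0 => ->.
have := line_integral_sub s0 s1 (lexx _) gc; rewrite seg_path1 => ->.
rewrite -mulrDr -cintegral_split//; exact: continuous_seg_comp.
Qed.

Lemma seg_path_rev z w t : seg_path w z t = seg_path z w (1 - t).
Proof. by rewrite /seg_path rmorphB; ring. Qed.

Lemma continuous_seg_rev g z w :
  continuous_seg_on g z w -> continuous_seg_on g w z.
Proof.
move=> gc t /andP[t0 t1]; rewrite seg_path_rev; apply: gc.
by rewrite subr_ge0 t1 lerBlDr lerDl.
Qed.

Lemma line_integral_rev g z w : continuous_seg_on g z w ->
  line_integral g w z = - line_integral g z w.
Proof.
move=> gc; rewrite /line_integral -mulNr opprB; congr (_ * _).
have H (h : R -> R) : {in `[0, 1], continuous h} ->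
    \int[mu]_(x in `[0, 1]) h (1 - x) = \int[mu]_(x in `[0, 1]) h x.
  move=> hc; have r1 : (0 : R) <= 1 <= (1 : R) by rewrite lexx ler01.
  have hc' : {within `[(0 : R), 1], continuous h}.
    by apply: continuous_in_subspaceT => x; rewrite inE; exact: hc.
  rewrite (Rintegration_by_substitution_onem r1 hc') unstable.onem1.
  by apply: eq_Rintegral.
have gc' := continuous_seg_comp gc.
apply: eq_ReIm => /=.
- rewrite -(H (fun t => Re (g (seg_path z w t)))).
    by apply: eq_Rintegral => t _; rewrite seg_path_rev.
  exact: continuous_in_Re.
- rewrite -(H (fun t => Im (g (seg_path z w t)))).
    by apply: eq_Rintegral => t _; rewrite seg_path_rev.
  exact: continuous_in_Im.
Qed.

End LineIntegrals.

Section ContinuousSeg.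
Variable R : realType.
Local Notation C := R[i].
Implicit Types (z w : C) (g h : C -> C).

Lemma continuous_segB g h z w : continuous_seg_on g z w ->
  continuous_seg_on h z w -> continuous_seg_on (fun y => g y - h y) z w.
Proof.
move=> gc hc t t01.
exact: (@cvgB C C _ _ _ g h _ _ (gc t t01) (hc t t01)).
Qed.

Lemma line_integral_refl g z : line_integral g z z = 0.
Proof. by rewrite /line_integral subrr mul0r. Qed.

End ContinuousSeg.

(** * The complex exponential *)

Section ComplexExponential.
Variable R : realType.
Local Notation C := R[i].
Implicit Types z w : C.

Lemma cexpD z w : cexp (z + w) = cexp z * cexp w.
Proof.
rewrite /cexp ReD ImD expRD cosD sinD rmorphM mulrACA; congr (_ * _).
by apply: eq_ReIm => /=; ring.
Qed.

Lemma cexp0 : cexp (0 : C) = 1.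
Proof. by rewrite /cexp /= expR0 cos0 sin0 mul1r. Qed.

Lemma normc_cexp z : normc (cexp z) = expR (Re z).
Proof.
by rewrite /cexp normcM normcR ger0_norm ?expR_ge0//= cos2Dsin2 sqrtr1 mulr1.
Qed.

Lemma cexp_neq0 z : cexp z != 0.
Proof. by rewrite -normc_gt0 normc_cexp expR_gt0. Qed.

Lemma path_derive_cexp z t :
  path_derive (fun s => cexp (s%:C * z)) t (z * cexp (t%:C * z)).
Proof.
case: z => a b.
have da : is_derive t (1 : R) (fun s => s * a) a.
  by apply: is_derive_eq; rewrite /GRing.scale /= mulr0 add0r mulr1.
have db : is_derive t (1 : R) (fun s => s * b) b.
  by apply: is_derive_eq; rewrite /GRing.scale /= mulr0 add0r mulr1.
have de := @is_derive1_comp R (@expR R) (fun s => s * a) t _ _ (is_derive_expR (t * a)) da.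
have dc := @is_derive1_comp R (@cos R) (fun s => s * b) t _ _ (is_derive_cos (t * b)) db.
have ds := @is_derive1_comp R (@sin R) (fun s => s * b) t _ _ (is_derive_sin (t * b)) db.
rewrite /cexp; split.
- have -> : (fun s => Re ((expR (Re (s%:C * (a +i* b))))%:C *
    (cos (Im (s%:C * (a +i* b))) +i* sin (Im (s%:C * (a +i* b)))))) =
    ((@expR R \o (fun s => s * a)) * (@cos R \o (fun s => s * b))).
    by apply/funext => s; rewrite ReMr ReMr ImMr.
  apply: is_derive_eq; rewrite ReM ReMr ImMr ReMr ImMr /GRing.scale /=; ring.
- have -> : (fun s => Im ((expR (Re (s%:C * (a +i* b))))%:C *
    (cos (Im (s%:C * (a +i* b))) +i* sin (Im (s%:C * (a +i* b)))))) =
    ((@expR R \o (fun s => s * a)) * (@sin R \o (fun s => s * b))).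
    by apply/funext => s; rewrite ImMr ReMr ImMr.
  apply: is_derive_eq; rewrite ImM ReMr ImMr ReMr ImMr /GRing.scale /=; ring.
Qed.

Lemma Re_le_normc z (t : R) : 0 <= t <= 1 -> Re (t%:C * z) <= normc z.
Proof.
move=> /andP[t0 t1]; rewrite ReMr (le_trans (ler_norm _))//.
by rewrite normrM (ger0_norm t0) (le_trans _ (le_normc_Re z))// ler_piMl.
Qed.

Lemma normc_cexpB1 z : normc (cexp z - 1) <= 2 * (normc z * expR (normc z)).
Proof.
have cc : {in `[0, 1], continuous (fun t : R => z * cexp (t%:C * z))}.
  move=> t _; apply: cvgM; first exact: cvg_cst.
  exact: (path_derive_continuous (path_derive_cexp z t)).
have := path_FTC ler01 cc (fun t _ => path_derive_cexp z t).
rewrite mul1r mul0r cexp0 => <-.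
have H t : 0 <= t <= 1 ->
    normc (z * cexp (t%:C * z)) <= normc z * expR (normc z).
  move=> t01; rewrite normcM normc_cexp ler_wpM2l ?normc_ge0// ler_expR.
  exact: Re_le_normc.
by have := normc_cintegral_seg cc ler01 H; rewrite subr0 mulr1.
Qed.

(** Integrating the bound for [cexp - 1] along the segment from 0 to [z]. *)
Lemma normc_cexpB1B z :
  normc (cexp z - 1 - z) <= 4 * (normc z ^+ 2 * expR (normc z)).
Proof.
have cc : {in `[0, 1], continuous (fun t : R => z * (cexp (t%:C * z) - 1))}.
  move=> t _; apply: cvgM; first exact: cvg_cst.
  apply: (@cvgB C C _ _ _ (fun t : R => cexp (t%:C * z)) (fun=> 1)); last exact: cvg_cst.
  exact: (path_derive_continuous (path_derive_cexp z t)).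
have D t : 0 <= t <= 1 -> path_derive
    (fun s : R => cexp (s%:C * z) - s%:C * z) t (z * (cexp (t%:C * z) - 1)).
  move=> _; apply/path_deriveP => e e0.
  have /path_deriveP/(_ e e0) := path_derive_cexp z t.
  apply: filterS => h; congr (normc _ <= _).
  by rewrite rmorphD; ring.
have := path_FTC ler01 cc D.
rewrite mul1r mul0r cexp0 subr0 => E.
have -> : cexp z - 1 - z = cexp z - z - 1 by ring.
rewrite -E.
have H t : 0 <= t <= 1 ->
    normc (z * (cexp (t%:C * z) - 1)) <= 2 * (normc z ^+ 2 * expR (normc z)).
  move=> t01; rewrite normcM.
  have := normc_cexpB1 (t%:C * z).
  have tz : normc (t%:C * z) <= normc z.
    by case/andP: t01 => t0 t1; rewrite normcM normcR ger0_norm// ler_piMl// normc_ge0.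
  move=> H; rewrite expr2 -mulrA mulrCA ler_wpM2l ?normc_ge0// (le_trans H)//.
  by rewrite ler_wpM2l// ler_pM ?normc_ge0 ?expR_ge0// ler_expR.
have := normc_cintegral_seg cc ler01 H; rewrite subr0 mulr1.
by move=> /le_trans; apply; lra.
Qed.

Lemma is_derive_cexp z : is_derive z (1 : C) (@cexp R) (cexp z).
Proof.
apply/cderiveP => e e0.
pose K := 4 * expR 1 * normc (cexp z).
have K0 : 0 < K by rewrite !mulr_gt0 ?expR_gt0// normc_gt0 cexp_neq0.
exists (Num.min 1 (e / K)); first by rewrite lt_min ltr01 divr_gt0.
move=> h; rewrite lt_min => /andP[h1 hK].
have -> : cexp (z + h) - cexp z - cexp z * h = cexp z * (cexp h - 1 - h).
  by rewrite cexpD; ring.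
rewrite normcM (le_trans (ler_wpM2l (normc_ge0 _) (normc_cexpB1B h)))//.
apply: (@le_trans _ _ (K * normc h * normc h)).
  have -> : K * normc h * normc h =
    normc (cexp z) * (4 * (normc h ^+ 2 * expR 1)) by rewrite /K; ring.
  rewrite !ler_wpM2l ?normc_ge0// ?exprn_ge0 ?normc_ge0//.
  by rewrite ler_expR ltW.
by rewrite ler_wpM2r ?normc_ge0// mulrC -ler_pdivlMr// ltW.
Qed.

End ComplexExponential.

(** * Goursat's theorem *)

Section Goursat.
Local Opaque line_integral.
Variable R : realType.
Local Notation C := R[i].
Implicit Types (z w p q : C) (g : C -> C).

Definition cbox p q z : bool :=
  (Re p <= Re z <= Re q) && (Im p <= Im z <= Im q).

Lemma seg_path_Re z w t : Re (seg_path z w t) = (1 - t) * Re z + t * Re w.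
Proof. by rewrite /seg_path ReD ReMr ReD ReN; ring. Qed.

Lemma seg_path_Im z w t : Im (seg_path z w t) = (1 - t) * Im z + t * Im w.
Proof. by rewrite /seg_path ImD ImMr ImD ImN; ring. Qed.

Lemma convex_comb_le (a x y b t : R) : 0 <= t <= 1 -> a <= x <= b ->
  a <= y <= b -> a <= (1 - t) * x + t * y <= b.
Proof.
move=> /andP[t0 t1] /andP[ax xb] /andP[ay yb].
have t1' : 0 <= 1 - t by rewrite subr_ge0.
by apply/andP; split; nra.
Qed.

Lemma cbox_seg p q z w t : cbox p q z -> cbox p q w -> 0 <= t <= 1 ->
  cbox p q (seg_path z w t).
Proof.
move=> /andP[zr zi] /andP[wr wi] t01.
by rewrite /cbox seg_path_Re seg_path_Im !convex_comb_le.
Qed.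

Definition tri_integral g (x y z : C) :=
  line_integral g x y + line_integral g y z + line_integral g z x.

Definition perimeter (x y z : C) := normc (y - x) + normc (z - y) + normc (x - z).

Local Notation mid z w := (seg_path z w (2^-1 : R)).

Lemma half01 : (0 : R) <= 2^-1 <= (1 : R).
Proof. by apply/andP; split; lra. Qed.

Lemma tri_integral_bisect g (x y z : C) :
  (forall v w, v \in [:: x; y; z; mid x y; mid y z; mid z x] ->
     w \in [:: x; y; z; mid x y; mid y z; mid z x] -> continuous_seg_on g v w) ->
  tri_integral g x y z =
    tri_integral g x (mid x y) (mid z x) +
    tri_integral g (mid x y) y (mid y z) +
    tri_integral g (mid z x) (mid y z) z +
    tri_integral g (mid y z) (mid z x) (mid x y).
Proof.
move=> gc; rewrite /tri_integral.
have inx v w : v \in [:: x; y; z; mid x y; mid y z; mid z x] ->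
   w \in [:: x; y; z; mid x y; mid y z; mid z x] -> continuous_seg_on g v w by exact: gc.
rewrite (@line_integral_split _ g x y 2^-1)//; [|exact: half01|by apply: gc; rewrite !inE eqxx ?orbT].
rewrite (@line_integral_split _ g y z 2^-1)//; [|exact: half01|by apply: gc; rewrite !inE eqxx ?orbT].
rewrite (@line_integral_split _ g z x 2^-1)//; [|exact: half01|by apply: gc; rewrite !inE eqxx ?orbT].
rewrite (@line_integral_rev _ g (mid x y) (mid z x)); last by apply: gc; rewrite !inE eqxx ?orbT.
rewrite (@line_integral_rev _ g (mid y z) (mid x y)); last by apply: gc; rewrite !inE eqxx ?orbT.
rewrite (@line_integral_rev _ g (mid z x) (mid y z)); last by apply: gc; rewrite !inE eqxx ?orbT.
by ring.
Qed.

Lemma mid_dist z w v : normc (mid z w - mid z v) = normc (w - v) / 2.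
Proof.
have -> : mid z w - mid z v = (2^-1)%:C * (w - v) by rewrite /seg_path; ring.
by rewrite normcM normcR ger0_norm ?invr_ge0 ?ler0n// mulrC.
Qed.

Lemma midC z w : mid z w = mid w z.
Proof.
rewrite seg_path_rev; congr seg_path.
by rewrite [LHS]splitr; field.
Qed.

Lemma mid_dist0 z w : normc (mid z w - z) = normc (w - z) / 2.
Proof.
have -> : mid z w - z = (2^-1)%:C * (w - z) by rewrite /seg_path; ring.
by rewrite normcM normcR ger0_norm ?invr_ge0 ?ler0n// mulrC.
Qed.

(** The integrals over the four parts sum up to the integral over the triangle,
    so at least one of them is at least a quarter of it. *)
Lemma tri_integral_step g p q (x y z : C) :
  (forall w, cbox p q w -> {for w, continuous g}) ->
  cbox p q x -> cbox p q y -> cbox p q z ->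
  exists x' y' z', [/\ cbox p q x', cbox p q y' & cbox p q z'] /\
    [/\ normc (tri_integral g x y z) <= 4 * normc (tri_integral g x' y' z'),
       perimeter x' y' z' = perimeter x y z / 2 &
       normc (x' - x) <= perimeter x y z].
Proof.
move=> gc bx by_ bz.
have bm v w : cbox p q v -> cbox p q w -> cbox p q (mid v w).
  by move=> bv bw; apply: cbox_seg => //; exact: half01.
have H := @tri_integral_bisect g x y z.
have {}H := H _.
have E : tri_integral g x y z =
    tri_integral g x (mid x y) (mid z x) +
    tri_integral g (mid x y) y (mid y z) +
    tri_integral g (mid z x) (mid y z) z +
    tri_integral g (mid y z) (mid z x) (mid x y).
  apply: H => v w; rewrite !inE => vx wx t t01; apply: gc.
  have bb u : [|| u == x, u == y, u == z, u == mid x y, u == mid y z | u == mid z x] ->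
      cbox p q u.
    by move=> /or3P[/eqP->|/eqP->|/or4P[]/eqP->]//; exact: bm.
  by apply: cbox_seg => //; exact: bb.
have le4 (a b c d : C) (e : R) : normc a < e -> normc b < e -> normc c < e ->
    normc d < e -> normc (a + b + c + d) < 4 * e.
  move=> ae be ce de.
  have -> : 4 * e = e + e + e + e by ring.
  rewrite (le_lt_trans (normcD _ _))// ltrD// (le_lt_trans (normcD _ _))// ltrD//.
  by rewrite (le_lt_trans (normcD _ _))// ltrD.
pose e := normc (tri_integral g x y z) / 4.
have Ee : normc (tri_integral g x y z) = 4 * e by rewrite /e mulrC divfK.
have per0 (v : R) : 0 <= v -> v / 2 <= v by move=> v0; lra.
have nn := @normc_ge0 R.
have sxy := distc_sym x y; have syz := distc_sym y z; have szx := distc_sym z x.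
have dxy : normc (y - x) <= perimeter x y z by rewrite /perimeter -addrA lerDl addr_ge0.
have dxz : normc (x - z) <= perimeter x y z by rewrite /perimeter lerDr addr_ge0.
case: (lerP e (normc (tri_integral g x (mid x y) (mid z x)))) => [h1|h1].
  exists x, (mid x y), (mid z x); split; first by split => //; exact: bm.
  split; first by rewrite Ee ler_pM2l.
    rewrite /perimeter mid_dist0 (midC z x) mid_dist distc_sym (distc_sym _ (mid x z)) mid_dist0.
    by rewrite ?sxy ?syz ?szx; lra.
  by rewrite subrr normc0 /perimeter !addr_ge0.
case: (lerP e (normc (tri_integral g (mid x y) y (mid y z)))) => [h2|h2].
  exists (mid x y), y, (mid y z); split; first by split => //; exact: bm.
  split; first by rewrite Ee ler_pM2l.
    rewrite /perimeter (midC x y) (distc_sym y) !mid_dist0 mid_dist.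
    by rewrite ?sxy ?syz ?szx; lra.
  by rewrite mid_dist0; apply: le_trans dxy; apply: per0.
case: (lerP e (normc (tri_integral g (mid z x) (mid y z) z))) => [h3|h3].
  exists (mid z x), (mid y z), z; split; first by split => //; exact: bm.
  split; first by rewrite Ee ler_pM2l.
    rewrite /perimeter (midC y z) mid_dist (distc_sym z (mid z y)) !mid_dist0.
    by rewrite ?sxy ?syz ?szx; lra.
  by rewrite midC mid_dist0 distc_sym; apply: le_trans dxz; apply: per0.
case: (lerP e (normc (tri_integral g (mid y z) (mid z x) (mid x y)))) => [h4|h4].
  exists (mid y z), (mid z x), (mid x y); split; first by split => //; exact: bm.
  split; first by rewrite Ee ler_pM2l.
    rewrite /perimeter (midC y z) mid_dist (midC z x) mid_dist (midC z y) (midC x y) mid_dist.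
    by rewrite ?sxy ?syz ?szx; lra.
  rewrite -[X in normc X](subrKA (mid x y)) (le_trans (normcD _ _))//.
  rewrite mid_dist0 (midC x y) mid_dist.
  rewrite /perimeter.
  have := nn (y - x); have := nn (z - y); have := nn (x - z).
  by rewrite (distc_sym x z); lra.
by have := le4 _ _ _ _ _ h1 h2 h3 h4; rewrite -E Ee ltxx.
Qed.
End Goursat.

Section GoursatTriangle.
Local Opaque line_integral.
Variable R : realType.
Local Notation C := R[i].
Implicit Types (z w p q : C) (g : C -> C).

(** The limit is the common point of the intervals from [u k - 2 * d k] to
    [u k + 2 * d k], which are nested. *)
Lemma halving_limit (u d : nat -> R) (a b : R) :
  (forall k, `|u k.+1 - u k| <= d k) -> (forall k, d k.+1 = d k / 2) ->
  (forall k, 0 <= d k) -> (forall e, 0 < e -> exists k, d k < e) ->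
  (forall k, a <= u k <= b) ->
  exists2 x, a <= x <= b & forall k, `|x - u k| <= 2 * d k.
Proof.
move=> ud dS d0 dlim uab.
pose l k := u k - 2 * d k; pose r k := u k + 2 * d k.
have lS k : l k <= l k.+1.
  by have := ud k; rewrite ler_norml /l dS => /andP[h1 h2]; lra.
have rS k : r k.+1 <= r k.
  by have := ud k; rewrite ler_norml /r dS => /andP[h1 h2]; lra.
have lmono j k : (j <= k)%N -> l j <= l k.
  by apply: (@homo_leq _ l Order.le) => // x y z; exact: le_trans.
have rmono j k : (j <= k)%N -> r k <= r j.
  by apply: (@homo_leq _ r (fun x y => y <= x)) => // x y z h1 h2; exact: le_trans h2 h1.
have lr j k : l j <= r k.
  apply: (le_trans (lmono _ _ (leq_maxl j k))).
  apply: (le_trans _ (rmono _ _ (leq_maxr j k))).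
  by rewrite /l /r; have := d0 (maxn j k); lra.
have hs : has_sup (range l).
  split; first by exists (l 0%N); exists 0%N.
  by exists (r 0%N) => _ [k _ <-].
have sl k : l k <= sup (range l).
  by apply: ub_le_sup; [case: hs|exists k].
have sr k : sup (range l) <= r k.
  by apply: ge_sup; [case: hs|move=> _ [j _ <-]].
exists (sup (range l)); last first.
  by move=> k; rewrite ler_norml; have := sl k; have := sr k; rewrite /l /r => h1 h2; apply/andP; split; lra.
apply/andP; split; apply/ler_addgt0Pr => e e0.
- have e2 : 0 < e / 2 by rewrite divr_gt0.
  have [k dk] := dlim _ e2.
  by have := sl k; have := uab k; rewrite /l => /andP[h1 h2]; lra.
- have e2 : 0 < e / 2 by rewrite divr_gt0.
  have [k dk] := dlim _ e2.
  by have := sr k; have := uab k; rewrite /r => /andP[h1 h2]; lra.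
Qed.

Lemma halving_small (c e : R) : 0 <= c -> 0 < e -> exists k : nat, c / 2 ^+ k < e.
Proof.
move=> c0 e0; pose k := Num.bound (c / e); exists k.
have kce : c / e < k%:R.
  by apply: archi_boundP; rewrite divr_ge0// ltW.
rewrite ltr_pdivrMr ?exprn_gt0// mulrC -ltr_pdivrMr//.
by rewrite (lt_trans kce)// -natrX ltr_nat ltn_expl.
Qed.

(** An affine function has a quadratic primitive. *)
Lemma tri_integral_affine (al be p x y z : C) :
  tri_integral (fun w => al + be * (w - p)) x y z = 0.
Proof.
pose G w := al * w + be * (w - p) ^+ 2 / 2.
have DG w : is_derive w (1 : C) G (al + be * (w - p)).
  apply/cderiveP => e e0.
  pose K := normc be + 1.
  have K0 : 0 < K by rewrite ltr_wpDl// normc_ge0.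
  exists (e / K); first by rewrite divr_gt0.
  move=> h hK.
  have -> : G (w + h) - G w - (al + be * (w - p)) * h = be * (h * h / 2).
    by rewrite /G; field.
  have h2 : normc (h * h / 2) <= normc h * normc h.
    rewrite normcM normcM ler_piMr ?mulr_ge0 ?normc_ge0// normcV.
    have -> : (2 : C) = (2 : R)%:C by rewrite rmorphMn.
    by rewrite normcR ger0_norm//; lra.
  rewrite normcM; apply: (@le_trans _ _ (K * (normc h * normc h))).
    by rewrite ler_pM ?normc_ge0// lerDl.
  by rewrite mulrA ler_wpM2r ?normc_ge0// mulrC -ler_pdivlMr// ltW.
have gc v w : continuous_seg_on (fun w => al + be * (w - p)) v w.
  move=> t _; apply: (@is_derive_continuousc _ _ _ be); apply/cderiveP => e e0.
  exists 1 => // h _; have -> : al + be * (seg_path v w t + h - p) -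
    (al + be * (seg_path v w t - p)) - be * h = 0 by ring.
  by rewrite normc0 mulr_ge0 ?normc_ge0// ltW.
have gG v w : line_integral (fun w => al + be * (w - p)) v w = G w - G v.
  by apply: line_FTC => // t _; exact: DG.
by rewrite /tri_integral !gG; ring.
Qed.

(** The triangle is bisected into four, and one keeps a part carrying at least
    a quarter of the integral.  The parts shrink to a point, where the integrand
    is affine up to an error that is small compared with their size. *)
Theorem Goursat_triangle g p q (x y z : C) :
  (forall w, cbox p q w -> derivable g w (1 : C)) ->
  cbox p q x -> cbox p q y -> cbox p q z -> tri_integral g x y z = 0.
Proof.
move=> dg bx by_ bz.
have gc w : cbox p q w -> {for w, continuous g}.
  by move=> /dg; exact: derivable_continuousc.
pose T := (C * C * C)%type.
pose inb (t : T) := [&& cbox p q t.1.1, cbox p q t.1.2 & cbox p q t.2].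
pose I (t : T) := normc (tri_integral g t.1.1 t.1.2 t.2).
pose P (t : T) := perimeter t.1.1 t.1.2 t.2.
have /choice[f Hf] : forall t : T, exists t' : T, inb t ->
    [/\ inb t', I t <= 4 * I t', P t' = P t / 2 & normc (t'.1.1 - t.1.1) <= P t].
  move=> [[a b] c]; have [/and3P[ba bb bc]|nb] := boolP (inb (a, b, c)).
    have [a' [b' [c' [[h1 h2 h3] [h4 h5 h6]]]]] := tri_integral_step gc ba bb bc.
    by exists (a', b', c') => _; split => //; rewrite /inb /= h1 h2.
  by exists (a, b, c).
pose t0 : T := (x, y, z).
pose s k := iter k f t0.
have sb k : inb (s k).
  elim: k => [|k IH]; first by rewrite /inb /= bx by_.
  by case: (Hf _ IH).
have IS k : I (s k) <= 4 * I (s k.+1) by case: (Hf _ (sb k)).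
have PS k : P (s k.+1) = P (s k) / 2 by case: (Hf _ (sb k)).
have AS k : normc ((s k.+1).1.1 - (s k).1.1) <= P (s k) by case: (Hf _ (sb k)).
have nn := @normc_ge0 R.
have P0 k : 0 <= P (s k) by rewrite /P /perimeter !addr_ge0.
have PE k : P (s k) = P t0 / 2 ^+ k.
  elim: k => [|k IH]; first by rewrite expr0 divr1.
  by rewrite PS IH exprS; field; rewrite expf_neq0.
have I0 k : I t0 <= 4 ^+ k * I (s k).
  elim: k => [|k IH]; first by rewrite expr0 mul1r.
  rewrite (le_trans IH)// exprSr -mulrA ler_wpM2l ?exprn_ge0//.
have Psmall e : 0 < e -> exists k, P (s k) < e.
  move=> e0; have [k] := halving_small (P0 0%N) e0.
  by exists k; rewrite PE.
have [ar arb arE] : exists2 a, Re p <= a <= Re q &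
    forall k, `|a - Re (s k).1.1| <= 2 * P (s k).
  apply: (halving_limit _ PS P0 Psmall) => k.
    by rewrite (le_trans _ (AS k))// -ReN -ReD le_normc_Re.
  by have /and3P[/andP[]] := sb k.
have [ai aib aiE] : exists2 a, Im p <= a <= Im q &
    forall k, `|a - Im (s k).1.1| <= 2 * P (s k).
  apply: (halving_limit _ PS P0 Psmall) => k.
    by rewrite (le_trans _ (AS k))// -ImN -ImD le_normc_Im.
  by have /and3P[/andP[]] := sb k.
pose a := ar +i* ai.
have ab : cbox p q a by rewrite /cbox /= arb aib.
have aE k : normc (a - (s k).1.1) <= 4 * P (s k).
  rewrite (le_trans (normc_le_ReIm _))// ReD ImD ReN ImN /=.
  by have := arE k; have := aiE k; lra.
have [d /cderiveP gd] : exists d, is_derive a (1 : C) g d.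
  by exists ('D_1 g a); split => //; exact: dg.
have key e : 0 < e -> I t0 <= 10 * e * P t0 ^+ 2.
  move=> e0; have [r r0 Hr] := gd _ e0.
  have r5 : 0 < r / 5 by rewrite divr_gt0.
  have [k kr] := Psmall _ r5.
  pose A := (s k).1.1; pose B := (s k).1.2; pose D := (s k).2.
  have /and3P[bA bB bD] := sb k.
  have PABD : P (s k) = normc (B - A) + normc (D - B) + normc (A - D) by [].
  pose aff w := g a + d * (w - a).
  have affc v w : continuous_seg_on aff v w.
    move=> t _; apply: (@is_derive_continuousc _ _ _ d); apply/cderiveP => e' e'0.
    exists 1 => // h _; have -> : aff (seg_path v w t + h) -
      aff (seg_path v w t) - d * h = 0 by rewrite /aff; ring.
    by rewrite normc0 mulr_ge0 ?normc_ge0// ltW.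
  have segc v w : cbox p q v -> cbox p q w -> continuous_seg_on g v w.
    by move=> bv bw t t01; apply: gc; exact: cbox_seg.
  have side v w : cbox p q v -> cbox p q w -> normc (v - A) <= P (s k) ->
      normc (w - A) <= P (s k) ->
      normc (line_integral g v w - line_integral aff v w) <=
        10 * e * P (s k) * normc (w - v).
    move=> bv bw vA wA; rewrite -line_integralB//; last exact: segc.
    have -> : 10 * e * P (s k) = 2 * (e * (5 * P (s k))) by ring.
    apply: normc_line_integral.
      by apply: continuous_segB; [exact: segc|exact: affc].
    move=> t t01; set u := seg_path v w t.
    have uA : normc (u - A) <= P (s k).
      have -> : u - A = (1 - t)%:C * (v - A) + t%:C * (w - A).
        by rewrite /u /seg_path rmorphB; ring.
      case/andP: t01 => t_0 t_1.
      rewrite (le_trans (normcD _ _))// !normcM !normcR ger0_norm ?subr_ge0//.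
      by rewrite ger0_norm//; nra.
    have ua : normc (u - a) <= 5 * P (s k).
      have -> : u - a = (u - A) - (a - A) by ring.
      by rewrite (le_trans (normcB _ _))//; have := aE k; rewrite -/A; lra.
    have := Hr (u - a); rewrite [a + _]addrC subrK => /(_ _)/le_trans.
    have -> : g u - aff u = g u - g a - d * (u - a) by rewrite /aff; ring.
    apply; first by rewrite (le_lt_trans ua)//; lra.
    by rewrite ler_wpM2l// ltW.
  have nAA : normc (A - A) <= P (s k) by rewrite subrr normc0.
  have nBA : normc (B - A) <= P (s k).
    by rewrite PABD; have := nn (D - B); have := nn (A - D); lra.
  have nDA : normc (D - A) <= P (s k).
    by rewrite distc_sym PABD; have := nn (D - B); have := nn (B - A); lra.
  have IK : I (s k) <= 10 * e * P (s k) ^+ 2.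
    have -> : I (s k) = normc ((line_integral g A B - line_integral aff A B) +
        (line_integral g B D - line_integral aff B D) +
        (line_integral g D A - line_integral aff D A)).
      rewrite /I -[X in normc X]subr0 -(tri_integral_affine (g a) d a A B D).
      by rewrite /tri_integral -/A -/B -/D; congr normc; rewrite /aff; ring.
    have := side _ _ bA bB nAA nBA.
    have := side _ _ bB bD nBA nDA.
    have := side _ _ bD bA nDA nAA.
    have -> : 10 * e * P (s k) ^+ 2 = 10 * e * P (s k) * normc (B - A) +
      10 * e * P (s k) * normc (D - B) + 10 * e * P (s k) * normc (A - D).
      by rewrite -!mulrDr -PABD expr2 mulrA.
    move=> h1 h2 h3; rewrite (le_trans (normcD _ _))// lerD//.
    by rewrite (le_trans (normcD _ _))// lerD.
  apply: (le_trans (I0 k)); apply: (le_trans (ler_wpM2l _ IK)).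
    by rewrite exprn_ge0.
  rewrite PE le_eqVlt; apply/orP; left; apply/eqP.
  have -> : (4 : R) = 2 ^+ 2 by rewrite expr2 -natrM.
  by rewrite -exprM mulnC exprM; field; rewrite expf_neq0.
have : I t0 <= 0.
  apply/ler_addgt0Pr => e e0; rewrite add0r.
  pose K := 10 * (P t0 ^+ 2 + 1).
  have K0 : 0 < K by rewrite mulr_gt0// ltr_wpDl// exprn_ge0// (P0 0%N).
  have := key _ (divr_gt0 e0 K0) => /le_trans; apply.
  rewrite mulrAC mulrA ler_pdivrMr// [e * _]mulrC ler_wpM2r ?ltW//.
  by rewrite /K; lra.
rewrite /I /=; have := nn (tri_integral g x y z) => h1 h2.
by apply: Normc.eq0_normc; apply/eqP; rewrite eq_le h1 h2.
Qed.
End GoursatTriangle.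

(** * Primitives on half planes *)

Section Primitive.
Variable R : realType.
Local Notation C := R[i].
Implicit Types (z w p q : C) (g h : C -> C).

Lemma line_integral_cst (c : C) z w : line_integral (fun=> c) z w = c * (w - z).
Proof.
rewrite /line_integral mulrC; congr (_ * _); apply: eq_ReIm => /=.
- by rewrite Rintegral_cst//= lebesgue_measure_itv/= lte_fin ltr01 /= subr0 mulr1.
- by rewrite Rintegral_cst//= lebesgue_measure_itv/= lte_fin ltr01 /= subr0 mulr1.
Qed.

Lemma derivable_seg g z w :
  (forall t : R, 0 <= t <= 1 -> derivable g (seg_path z w t) (1 : C)) ->
  continuous_seg_on g z w.
Proof. by move=> dg t t01; apply: derivable_continuousc; exact: dg. Qed.

Lemma continuous_cst_seg (c : C) z w : continuous_seg_on (fun=> c) z w.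
Proof. by apply: derivable_seg => t _; exact: derivable_cst. Qed.

Lemma seg_path_Re_lt (L : R) z w t : Re z < L -> Re w < L -> 0 <= t <= 1 ->
  Re (seg_path z w t) < L.
Proof.
move=> zL wL t01; rewrite seg_path_Re.
pose m := Num.max (Re z) (Re w); pose l := Num.min (Re z) (Re w).
have /(_ _ _)/andP[] := @convex_comb_le _ l (Re z) (Re w) m t t01.
- by rewrite /l /m ge_min le_max lexx.
- by rewrite /l /m ge_min le_max lexx !orbT.
- by move=> _ /le_lt_trans; apply; rewrite gt_max zL.
Qed.

(** Along a short segment [g] differs little from its value at [w]. *)
Lemma line_integral_deriv g w :
  (exists2 r : R, 0 < r & forall z, normc (z - w) < r -> {for z, continuous g}) ->
  forall e : R, 0 < e -> exists2 r : R, 0 < r & forall k, normc k < r ->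
    normc (line_integral g w (w + k) - g w * k) <= e * normc k.
Proof.
move=> [r0 r00 gc] e e0.
have gw : {for w, continuous g} by apply: gc; rewrite subrr normc0.
have e2 : 0 < e / 2 by rewrite divr_gt0.
have /nbhscP[r1 r10 Hr] := (cvgcP (nbhs_filter w) g (g w)).1 gw _ e2.
exists (Num.min r0 r1); first by rewrite lt_min r00.
move=> k; rewrite lt_min => /andP[k0 k1].
have kt t : 0 <= t <= 1 -> normc (seg_path w (w + k) t - w) <= normc k.
  move=> /andP[t0 t1]; have -> : seg_path w (w + k) t - w = t%:C * k.
    by rewrite /seg_path; ring.
  by rewrite normcM normcR ger0_norm// ler_piMl// normc_ge0.
have gs : continuous_seg_on g w (w + k).
  by move=> t t01; apply: gc; apply: le_lt_trans k0; exact: kt.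
have -> : g w * k = line_integral (fun=> g w) w (w + k).
  by rewrite line_integral_cst; congr (_ * _); rewrite addrC addKr.
have gw0 : continuous_seg_on (fun=> g w) w (w + k).
  exact: continuous_cst_seg.
rewrite -(line_integralB gs gw0).
have -> : e * normc k = 2 * (e / 2) * normc (w + k - w).
  by rewrite [w + k]addrC addrK; field.
apply: normc_line_integral => [|t t01].
  exact: (continuous_segB gs gw0).
by rewrite distc_sym ltW// Hr// (le_lt_trans (kt _ t01)).
Qed.

(** The integral of [h] from a base point is a primitive: its increments are
    integrals over short segments because the integral over a triangle vanishes. *)
Lemma primitive_halfplane h (L : R) :
  (forall w, Re w < L -> derivable h w (1 : C)) ->
  exists G : C -> C, forall w, Re w < L -> is_derive w (1 : C) G (h w).
Proof.
move=> dh; pose w0 : C := (L - 1) +i* 0.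
have w0L : Re w0 < L by rewrite /= ltrBlDr ltrDl.
exists (fun w => line_integral h w0 w) => w wL.
have segc z z' : Re z < L -> Re z' < L -> continuous_seg_on h z z'.
  by move=> zL z'L; apply: derivable_seg => t t01; apply: dh; exact: seg_path_Re_lt.
have split_at w' : Re w' < L -> line_integral h w0 w' - line_integral h w0 w =
    line_integral h w w'.
  move=> w'L.
  (* a box of the half plane that contains the three vertices *)
  pose Q := Num.max (Re w0) (Num.max (Re w) (Re w')).
  pose N := normc w0 + normc w + normc w'.
  have QL : Q < L by rewrite !gt_max w0L wL.
  have nn := @normc_ge0 R.
  have inN z : normc z <= N -> Re z <= Q -> cbox ((- N) +i* (- N)) (Q +i* N) z.
    move=> zN zQ; rewrite /cbox /= zQ.
    have := le_trans (le_normc_Re z) zN; have := le_trans (le_normc_Im z) zN.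
    by rewrite !ler_norml => /andP[-> ->] /andP[-> _].
  have b0 : cbox ((- N) +i* (- N)) (Q +i* N) w0.
    by apply: inN; rewrite /Q ?le_max ?lexx// /N -addrA lerDl addr_ge0.
  have b1 : cbox ((- N) +i* (- N)) (Q +i* N) w.
    by apply: inN; rewrite /Q ?le_max ?lexx ?orbT// /N addrAC lerDr addr_ge0.
  have b2 : cbox ((- N) +i* (- N)) (Q +i* N) w'.
    by apply: inN; rewrite /Q ?le_max ?lexx ?orbT// /N lerDr addr_ge0.
  have := @Goursat_triangle _ h _ _ w0 w w' _ b0 b1 b2.
  move=> /(_ _); rewrite /tri_integral (@line_integral_rev _ h w0 w'); last exact: segc.
  move=> H; apply/eqP; rewrite subr_eq addrC -subr_eq0 -oppr_eq0 opprB; apply/eqP.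
  apply: H => z; rewrite /cbox /= => /andP[/andP[_ zQ] _].
  by apply: dh; exact: le_lt_trans QL.
apply/cderiveP => e e0.
have rL : 0 < L - Re w by rewrite subr_gt0.
have near_L z : normc (z - w) < L - Re w -> Re z < L.
  move=> H; have := le_lt_trans (le_normc_Re _) H.
  by rewrite ReD ReN ltr_norml => /andP[_]; lra.
have [|r r0 Hr] := @line_integral_deriv h w _ e e0.
  by exists (L - Re w) => // z /near_L zL; exact/derivable_continuousc/dh.
exists (Num.min r (L - Re w)); first by rewrite lt_min r0.
move=> k; rewrite lt_min => /andP[kr kL].
rewrite split_at; first exact: Hr.
by apply: near_L; rewrite [w + k]addrC addrK.
Qed.

End Primitive.

(** * Integrals over rectangles *)

Section Rectangles.
Local Opaque line_integral.
Variable R : realType.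
Local Notation C := R[i].
Implicit Types (z w p q : C) (g h : C -> C).

Definition rect_integral g (x1 x2 y1 y2 : R) : C :=
  line_integral g (x1 +i* y1) (x2 +i* y1) +
  line_integral g (x2 +i* y1) (x2 +i* y2) +
  line_integral g (x2 +i* y2) (x1 +i* y2) +
  line_integral g (x1 +i* y2) (x1 +i* y1).

(** A diagonal cuts the rectangle into two triangles. *)
Lemma Goursat_rect g (x1 x2 y1 y2 : R) : x1 <= x2 -> y1 <= y2 ->
  (forall z, cbox (x1 +i* y1) (x2 +i* y2) z -> derivable g z (1 : C)) ->
  rect_integral g x1 x2 y1 y2 = 0.
Proof.
move=> x12 y12 dg.
have b x y : x1 <= x <= x2 -> y1 <= y <= y2 ->
    cbox (x1 +i* y1) (x2 +i* y2) (x +i* y) by rewrite /cbox /= => -> ->.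
have b11 := b x1 y1; have b12 := b x1 y2; have b21 := b x2 y1.
have b22 := b x2 y2.
rewrite !lexx x12 y12 /= in b11 b12 b21 b22.
have T1 := Goursat_triangle dg (b11 isT isT) (b21 isT isT) (b22 isT isT).
have T2 := Goursat_triangle dg (b11 isT isT) (b22 isT isT) (b12 isT isT).
rewrite -[RHS](addr0 0) -{1}T1 -T2 /rect_integral /tri_integral.
rewrite (@line_integral_rev _ g (x1 +i* y1) (x2 +i* y2)); first by ring.
apply: derivable_seg => t t01; apply: dg; apply: cbox_seg => //.
- exact: b11.
- exact: b22.
Qed.

Lemma line_integral_hsplit g (x1 x2 c y : R) : x1 <= c <= x2 ->
  continuous_seg_on g (x1 +i* y) (x2 +i* y) ->
  line_integral g (x1 +i* y) (x2 +i* y) =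
  line_integral g (x1 +i* y) (c +i* y) + line_integral g (c +i* y) (x2 +i* y).
Proof.
move=> /andP[xc cx] gc.
have [x12|] := ltrP x1 x2; last first.
  move=> x21; have -> : c = x1 by apply/eqP; rewrite eq_le xc (le_trans cx).
  by rewrite line_integral_refl add0r.
have d0 : 0 < x2 - x1 by rewrite subr_gt0.
pose s := (c - x1) / (x2 - x1).
have s01 : 0 <= s <= 1.
  by rewrite divr_ge0 ?subr_ge0 ?(ltW x12)//= ler_pdivrMr// mul1r lerB.
have E : seg_path (x1 +i* y) (x2 +i* y) s = c +i* y.
  apply: eq_ReIm; rewrite ?seg_path_Re ?seg_path_Im /=; last by ring.
  by rewrite /s; field; rewrite gt_eqF.
by rewrite (line_integral_split s01 gc) E.
Qed.

Lemma line_integral_vsplit g (x y1 y2 c : R) : y1 <= c <= y2 ->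
  continuous_seg_on g (x +i* y1) (x +i* y2) ->
  line_integral g (x +i* y1) (x +i* y2) =
  line_integral g (x +i* y1) (x +i* c) + line_integral g (x +i* c) (x +i* y2).
Proof.
move=> /andP[xc cx] gc.
have [x12|] := ltrP y1 y2; last first.
  move=> x21; have -> : c = y1 by apply/eqP; rewrite eq_le xc (le_trans cx).
  by rewrite line_integral_refl add0r.
have d0 : 0 < y2 - y1 by rewrite subr_gt0.
pose s := (c - y1) / (y2 - y1).
have s01 : 0 <= s <= 1.
  by rewrite divr_ge0 ?subr_ge0 ?(ltW x12)//= ler_pdivrMr// mul1r lerB.
have E : seg_path (x +i* y1) (x +i* y2) s = x +i* c.
  apply: eq_ReIm; rewrite ?seg_path_Re ?seg_path_Im /=; first by ring.
  by rewrite /s; field; rewrite gt_eqF.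
by rewrite (line_integral_split s01 gc) E.
Qed.

Definition continuous_hline g (x1 x2 y : R) :=
  forall x, x1 <= x <= x2 -> {for x +i* y, continuous g}.
Definition continuous_vline g (x y1 y2 : R) :=
  forall y, y1 <= y <= y2 -> {for x +i* y, continuous g}.

Lemma continuous_hline_seg g (x1 x2 y : R) : x1 <= x2 -> continuous_hline g x1 x2 y ->
  continuous_seg_on g (x1 +i* y) (x2 +i* y).
Proof.
move=> x12 gc t /andP[t0 t1].
have -> : seg_path (x1 +i* y) (x2 +i* y) t = ((1 - t) * x1 + t * x2) +i* y.
  apply: eq_ReIm; rewrite ?seg_path_Re ?seg_path_Im /=; by ring.
by apply: gc; apply: convex_comb_le; rewrite ?t0 ?t1 ?lexx ?x12.
Qed.

Lemma continuous_vline_seg g (x y1 y2 : R) : y1 <= y2 -> continuous_vline g x y1 y2 ->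
  continuous_seg_on g (x +i* y1) (x +i* y2).
Proof.
move=> x12 gc t /andP[t0 t1].
have -> : seg_path (x +i* y1) (x +i* y2) t = x +i* ((1 - t) * y1 + t * y2).
  apply: eq_ReIm; rewrite ?seg_path_Re ?seg_path_Im /=; by ring.
by apply: gc; apply: convex_comb_le; rewrite ?t0 ?t1 ?lexx ?x12.
Qed.

(** The integrals along the common side of the two parts cancel. *)
Lemma rect_integral_vcut g (x1 x2 y1 y2 c : R) : x1 <= c <= x2 -> y1 <= y2 ->
  continuous_hline g x1 x2 y1 -> continuous_hline g x1 x2 y2 ->
  continuous_vline g c y1 y2 ->
  rect_integral g x1 x2 y1 y2 =
  rect_integral g x1 c y1 y2 + rect_integral g c x2 y1 y2.
Proof.
move=> xcx y12 h1 h2 v; have /andP[xc cx] := xcx; have x12 := le_trans xc cx.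
have s1 := continuous_hline_seg x12 h1; have s2 := continuous_hline_seg x12 h2.
have sv := continuous_vline_seg y12 v.
have s2l : continuous_seg_on g (x1 +i* y2) (c +i* y2).
  apply: continuous_hline_seg => // x /andP[xx xx']; apply: h2.
  by rewrite xx (le_trans xx').
have s2r : continuous_seg_on g (c +i* y2) (x2 +i* y2).
  apply: continuous_hline_seg => // x /andP[xx xx']; apply: h2.
  by rewrite xx' (le_trans xc).
rewrite /rect_integral (line_integral_hsplit xcx s1).
rewrite (line_integral_rev s2) (line_integral_hsplit xcx s2) (line_integral_rev sv).
by rewrite (line_integral_rev s2l) (line_integral_rev s2r); ring.
Qed.

Lemma rect_integral_hcut g (x1 x2 y1 y2 c : R) : x1 <= x2 -> y1 <= c <= y2 ->
  continuous_vline g x1 y1 y2 -> continuous_vline g x2 y1 y2 ->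
  continuous_hline g x1 x2 c ->
  rect_integral g x1 x2 y1 y2 =
  rect_integral g x1 x2 y1 c + rect_integral g x1 x2 c y2.
Proof.
move=> x12 ycy v1 v2 h; have /andP[yc cy] := ycy; have y12 := le_trans yc cy.
have s1 := continuous_vline_seg y12 v1; have s2 := continuous_vline_seg y12 v2.
have sh := continuous_hline_seg x12 h.
have s1l : continuous_seg_on g (x1 +i* y1) (x1 +i* c).
  apply: continuous_vline_seg => // x /andP[xx xx']; apply: v1.
  by rewrite xx (le_trans xx').
have s1r : continuous_seg_on g (x1 +i* c) (x1 +i* y2).
  apply: continuous_vline_seg => // x /andP[xx xx']; apply: v1.
  by rewrite xx' (le_trans yc).
rewrite /rect_integral (line_integral_vsplit ycy s2).
rewrite (line_integral_rev s1) (line_integral_vsplit ycy s1) (line_integral_rev sh).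
by rewrite (line_integral_rev s1l) (line_integral_rev s1r); ring.
Qed.

End Rectangles.

(** * Logarithmic coordinates around a singularity *)

Section LogarithmicPrimitive.
Variable R : realType.
Local Notation C := R[i].
Implicit Types (z w p q : C) (g h : C -> C).

Lemma cexp_polar (r t : R) : 0 < r ->
  cexp (ln r +i* t) = r%:C * (cos t +i* sin t).
Proof. by move=> r0; rewrite /cexp /= lnK// posrE. Qed.

Lemma path_derive_vertical (x t : R) : path_derive (fun s => x +i* s) t 'i.
Proof. by split => /=; [exact: is_derive_cst|exact: is_derive_id]. Qed.

Definition period : C := 0 +i* (2 * pi).

(** The pull-back of the form g(z) dz under w |-> y0 + exp w. *)
Definition log_pullback g y0 w := g (y0 + cexp w) * cexp w.

(** A logarithm of the side of a square: [exp (log_side s theta t)] runs over the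
    side from s e^(i theta) (1 - i) to s e^(i theta) (1 + i). *)
Definition log_side (s theta t : R) : C :=
  (ln s + ln (1 + (2 * t - 1) ^+ 2) / 2) +i* (atan (2 * t - 1) + theta).

Definition dlog_side (t : R) : C :=
  (2 * (2 * t - 1) / (1 + (2 * t - 1) ^+ 2)) +i* (2 / (1 + (2 * t - 1) ^+ 2)).

Section Circle.
Variables (g : C -> C) (y0 : C) (delta : R) (G : C -> C).
Hypothesis delta0 : 0 < delta.
Hypothesis dg : forall z, 0 < normc (z - y0) < delta -> derivable g z (1 : C).
Let h := log_pullback g y0.
Hypothesis GE : forall w, Re w < ln delta -> is_derive w (1 : C) G (h w).

Lemma cexpD_period w : cexp (w + period) = cexp w.
Proof.
rewrite cexpD -[RHS]mulr1; congr (_ * _); rewrite /cexp /= expR0 mul1r.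
by rewrite mulr_natl cos2pi sin2pi.
Qed.

(** The derivative of [G (w + period) - G w] vanishes, as the pulled-back form is
    periodic. *)
Lemma primitive_period w w0 : Re w < ln delta -> Re w0 < ln delta ->
  G (w + period) - G w = G (w0 + period) - G w0.
Proof.
move=> wd w0d.
pose D (w : C) := G (w + period) - G w.
have dD v : Re v < ln delta -> is_derive v (1 : C) D 0.
  move=> vd; have vd' : Re (v + period) < ln delta by rewrite ReD addr0.
  have Gv := GE vd.
  have Gv' := is_derive_compc (is_derive_shift v (1 : C) period) (GE vd').
  have := @is_deriveB _ _ _ _ _ _ _ _ _ Gv' Gv.
  by rewrite mulr1 /h /log_pullback cexpD_period subrr.
have zc : continuous_seg_on (fun=> 0) w0 w by exact: continuous_cst_seg.
have H := @line_FTC _ D (fun=> 0) w0 w zc.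
rewrite line_integral_cst mul0r in H.
apply/eqP; rewrite -subr_eq0; apply/eqP/esym; apply: H => t t01.
by apply: dD; apply: seg_path_Re_lt.
Qed.

Lemma derivable_log_pullback w : Re w < ln delta -> derivable h w (1 : C).
Proof.
move=> wd; have De := is_derive_cexp w.
have De' : is_derive w (1 : C) (fun v => y0 + cexp v) (0 + cexp w).
  exact: (is_deriveD (is_derive_cst y0 w (1 : C)) De).
have /dg dgz : 0 < normc (y0 + cexp w - y0) < delta.
  rewrite addrC addKr normc_cexp expR_gt0 -[ltRHS]lnK ?posrE//.
  by rewrite ltr_expR.
have Dg := DeriveDef dgz erefl.
have [dgc _] := is_derive_compc De' Dg.
have [dcexp _] := De.
exact: (derivableM dgc dcexp).
Qed.

Let continuous_h w : Re w < ln delta -> {for w, continuous h}.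
Proof. by move=> wd; apply/derivable_continuousc/derivable_log_pullback. Qed.

Lemma path_FTC_log (p dp : R -> C) (a b : R) : a <= b ->
  (forall t, a <= t <= b -> Re (p t) < ln delta) ->
  (forall t, a <= t <= b -> path_derive p t (dp t)) ->
  {in `[a, b], continuous dp} ->
  cintegral `[a, b] (fun t => h (p t) * dp t) = G (p b) - G (p a).
Proof.
move=> ab pd pdp dpc.
apply: (@path_FTC _ a b (G \o p) (fun t => h (p t) * dp t) ab).
  move=> t tab; apply: cvgM; last exact: dpc.
  have tab' : a <= t <= b by move: tab; rewrite in_itv.
  apply: continuous_comp; first exact: (path_derive_continuous (pdp t tab')).
  exact/continuous_h/pd.
by move=> t tab; apply: path_derive_comp (pdp t tab) (GE (pd t tab)).
Qed.

(** In logarithmic coordinates the circle is a vertical segment of length one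
    period. *)
Lemma circle_integral_primitive rho w : 0 < rho < delta -> Re w < ln delta ->
  circle_integral g y0 rho = G (w + period) - G w.
Proof.
move=> /andP[r0 rd] wd.
have pi20 : 0 <= 2 * pi :> R by rewrite mulr_ge0// pi_ge0.
have lr : ln rho < ln delta by rewrite ltr_ln ?posrE.
transitivity (cintegral `[0, 2 * pi] (fun t : R => h (ln rho +i* t) * 'i)).
  apply: eq_cintegral => t _; rewrite /h /log_pullback cexp_polar//.
  by rewrite -[RHS]mulrA; congr (_ * _); rewrite -[LHS]mulrA mulrC.
rewrite (path_FTC_log (p := fun t => ln rho +i* t) (dp := fun=> 'i))//.
- have -> : ln rho +i* (2 * pi) = (ln rho +i* 0) + period.
    by apply: eq_ReIm => /=; rewrite ?addr0 ?add0r.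
  exact: primitive_period.
- by move=> t _; exact: path_derive_vertical.
- by move=> t _; exact: cvg_cst.
Qed.

Lemma sqrt_expR_ln (x : R) : 0 < x -> expR (ln x / 2) = Num.sqrt x.
Proof.
move=> x0; have e0 : 0 <= expR (ln x / 2) by exact: expR_ge0.
rewrite -(ger0_norm e0) -sqrtr_sqr; congr Num.sqrt.
by rewrite expr2 -expRD -splitr lnK// posrE.
Qed.

Lemma sin_atan (x : R) : sin (atan x) = x * cos (atan x).
Proof.
have c0 : cos (atan x) != 0.
  by rewrite cos_atan invr_eq0 sqrtr_eq0 -ltNge ltr_wpDr// sqr_ge0.
by rewrite -{2}(atanK x) /tan divfK.
Qed.

Lemma sqr1_gt0 (x : R) : 0 < 1 + x ^+ 2.
Proof. by rewrite ltr_wpDr// sqr_ge0. Qed.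

Lemma cexp_log_side s theta t : 0 < s ->
  cexp (log_side s theta t) = s%:C * (cos theta +i* sin theta) * (1 +i* (2 * t - 1)).
Proof.
move=> s0; rewrite /log_side; set x := 2 * t - 1; have x0 := sqr1_gt0 x.
have q0 : Num.sqrt (1 + x ^+ 2) != 0 by rewrite sqrtr_eq0 -ltNge.
rewrite /cexp /= expRD lnK ?posrE// sqrt_expR_ln// cosD sinD sin_atan cos_atan.
apply: eq_ReIm; rewrite !(ReM, ImM) /=; field => //.
Qed.

Lemma path_derive_log_side s theta t : path_derive (log_side s theta) t (dlog_side t).
Proof.
rewrite /log_side /dlog_side; set x := 2 * t - 1; have x0 := sqr1_gt0 x.
have Dx : is_derive t (1 : R) (fun u : R => 2 * u - 1) 2.
  by apply: is_derive_eq; rewrite /GRing.scale /=; ring.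
have Dx2 : is_derive t (1 : R) (fun u : R => 1 + (2 * u - 1) ^+ 2) (2 * x * 2).
  by apply: is_derive_eq; rewrite /x /GRing.scale /=; ring.
have Dl := @is_derive1_comp R (@ln R) (fun u : R => 1 + (2 * u - 1) ^+ 2) t _ _ (is_derive1_ln x0) Dx2.
have Da := @is_derive1_comp R (@atan R) (fun u : R => 2 * u - 1) t _ _ (is_derive1_atan x) Dx.
split => /=.
- have -> : (fun u : R => ln s + ln (1 + (2 * u - 1) ^+ 2) / 2) =
    cst (ln s) + 2^-1 *: (@ln R \o (fun u : R => 1 + (2 * u - 1) ^+ 2)).
    by apply/funext => u; rewrite /= mulrC.
  have D1 := is_deriveD (is_derive_cst (ln s) t (1 : R)) (is_deriveZ 2^-1 Dl).
  apply: (is_derive_eq D1); rewrite /GRing.scale /=; field.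
  by rewrite gt_eqF.
- have -> : (fun u : R => atan (2 * u - 1) + theta) =
    (@atan R \o (fun u : R => 2 * u - 1)) + cst theta by [].
  have D1 := is_deriveD Da (is_derive_cst theta t (1 : R)).
  by apply: (is_derive_eq D1); rewrite addr0 mulrC.
Qed.

Lemma Re_log_side_lt s theta t : 0 < s -> 2 * s < delta -> 0 <= t <= 1 ->
  Re (log_side s theta t) < ln delta.
Proof.
move=> s0 sd /andP[t0 t1]; rewrite -ltr_expR lnK ?posrE// -normc_cexp cexp_log_side//.
have n1 : normc (1 +i* (2 * t - 1)) <= 2.
  rewrite (le_trans (normc_le_ReIm _))//= normr1 -lerBrDl ler_norml.
  by apply/andP; split; lra.
have n2 : normc (cos theta +i* sin theta) = 1 by rewrite /= cos2Dsin2 sqrtr1.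
rewrite !normcM normcR n2 mulr1 gtr0_norm// (le_lt_trans _ sd)// mulrC.
by rewrite ler_wpM2r// ltW.
Qed.

(** The substitution along [log_side] avoids comparing logarithms on the sides of
    the square with a fixed branch: each side is a rotation of the same one. *)
Lemma side_integral_primitive s theta : 0 < s -> 2 * s < delta ->
  let c := s%:C * (cos theta +i* sin theta) in
  line_integral g (y0 + c * (1 +i* (-1))) (y0 + c * (1 +i* 1)) =
  G (log_side s theta 1) - G (log_side s theta 0).
Proof.
move=> s0 sd c.
have lt_side t (t01 : 0 <= t <= 1) := Re_log_side_lt theta s0 sd t01.
rewrite -(path_FTC_log ler01 lt_side (fun t _ => path_derive_log_side s theta t)).
  have seg t : seg_path (y0 + c * (1 +i* (-1))) (y0 + c * (1 +i* 1)) t =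
      y0 + cexp (log_side s theta t).
    rewrite cexp_log_side// -/c /seg_path.
    have -> : 1 +i* (2 * t - 1) = 1 +i* (-1) + t%:C * (0 +i* 2) :> C.
      by apply: eq_ReIm; rewrite !(ReD, ImD, ReMr, ImMr) /=; ring.
    have -> : 0 +i* 2 = 1 +i* 1 - (1 +i* (-1)) :> C.
      by apply: eq_ReIm; rewrite !(ReD, ImD, ReN, ImN) /=; ring.
    by ring.
  have gc : continuous_seg_on g (y0 + c * (1 +i* (-1))) (y0 + c * (1 +i* 1)).
    move=> t t01; rewrite seg; apply/derivable_continuousc/dg.
    rewrite addrC addKr normc_cexp expR_gt0 -[ltRHS]lnK ?posrE//.
    by rewrite ltr_expR lt_side.
  rewrite /line_integral -cintegralZ//; last first.
    exact/continuous_cintegrable/continuous_seg_comp.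
  apply: eq_cintegral => t _; rewrite seg /h /log_pullback -mulrA mulrC; congr (_ * _).
  rewrite cexp_log_side// -/c -mulrA.
  have -> : y0 + c * (1 +i* 1) - (y0 + c * (1 +i* (-1))) =
    c * (1 +i* 1 - (1 +i* (-1))) by ring.
  congr (_ * _); have x0 := sqr1_gt0 (2 * t - 1); rewrite /dlog_side.
  by apply: eq_ReIm; rewrite !(ReD, ImD, ReN, ImN, ReM, ImM) /=; field; rewrite gt_eqF.
move=> t _; apply/(cvg_ReIm (nbhs_filter t)); rewrite /dlog_side /=.
have cx : (fun u : R => 2 * u - 1) u @[u --> t] --> 2 * t - 1.
  by apply: cvgB; [apply: cvgM; [exact: cvg_cst|exact: cvg_id]|exact: cvg_cst].
have ci : (1 + (2 * u - 1) ^+ 2)^-1 @[u --> t] --> (1 + (2 * t - 1) ^+ 2)^-1.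
  apply: cvgV; first by rewrite gt_eqF// sqr1_gt0.
  by apply: cvgD; [exact: cvg_cst|rewrite expr2; apply: cvgM].
split.
- by apply: cvgM => //; apply: cvgM => //; exact: cvg_cst.
- by apply: cvgM => //; exact: cvg_cst.
Qed.

End Circle.

(** Around [y0] the primitive in the coordinate [log (z - y0)] increases by the same
    amount over every circle and over every square.  On the square the four logarithms of
    the sides fit together at the corners, and the last end point is the first
    one moved by a period. *)
Lemma punctured_disc_integrals g y0 (delta : R) : 0 < delta ->
  (forall z, 0 < normc (z - y0) < delta -> derivable g z (1 : C)) ->
  exists kappa : C,
    (forall rho, 0 < rho < delta -> circle_integral g y0 rho = kappa) /\
    (forall s, 0 < s -> 2 * s < delta ->
      rect_integral g (Re y0 - s) (Re y0 + s) (Im y0 - s) (Im y0 + s) = kappa).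
Proof.
move=> d0 dg.
have [G GE] := primitive_halfplane (derivable_log_pullback d0 dg).
pose w0 : C := (ln delta - 1) +i* 0.
have w0d : Re w0 < ln delta by rewrite /= ltrBlDr ltrDl.
exists (G (w0 + period) - G w0); split => [rho rhod|s s0 sd].
  exact: (circle_integral_primitive d0 dg GE).
have side theta p q : p = y0 + s%:C * (cos theta +i* sin theta) * (1 +i* (-1)) ->
    q = y0 + s%:C * (cos theta +i* sin theta) * (1 +i* 1) ->
    line_integral g p q = G (log_side s theta 1) - G (log_side s theta 0).
  by move=> -> ->; exact: (side_integral_primitive d0 dg GE theta s0 sd).
have corner theta : log_side s theta 1 = log_side s (theta + pi / 2) 0.
  rewrite /log_side; have -> : 2 * 1 - 1 = 1 :> R by ring.
  have -> : 2 * 0 - 1 = -1 :> R by ring.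
  by rewrite sqrrN atanN atan1; congr (_ +i* _); field.
have last_corner : log_side s (pi + pi / 2) 1 = log_side s 0 0 + period.
  rewrite /log_side /period; have -> : 2 * 1 - 1 = 1 :> R by ring.
  have -> : 2 * 0 - 1 = -1 :> R by ring.
  by apply: eq_ReIm; rewrite ?ReD ?ImD /= ?sqrrN ?addr0// atanN atan1; field.
have lt0 : Re (log_side s 0 0) < ln delta.
  by apply: (Re_log_side_lt d0 0 s0 sd); rewrite lexx ler01.
have trig1 := (cosDpi (pi : R), cosDpihalf (pi : R), sinDpihalf (pi : R), @cos0 R,
  @sin0 R, @cos_pihalf R, @sin_pihalf R, @cospi R, @sinpi R).
rewrite /rect_integral (side (pi + pi / 2)); first last.
- by rewrite !trig1; apply: eq_ReIm; rewrite !(ReD, ImD, ReM, ImM) /=; ring.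
- by rewrite !trig1; apply: eq_ReIm; rewrite !(ReD, ImD, ReM, ImM) /=; ring.
rewrite (side 0); first last.
- by rewrite !trig1; apply: eq_ReIm; rewrite !(ReD, ImD, ReM, ImM) /=; ring.
- by rewrite !trig1; apply: eq_ReIm; rewrite !(ReD, ImD, ReM, ImM) /=; ring.
rewrite (side (pi / 2)); first last.
- by rewrite !trig1; apply: eq_ReIm; rewrite !(ReD, ImD, ReM, ImM) /=; ring.
- by rewrite !trig1; apply: eq_ReIm; rewrite !(ReD, ImD, ReM, ImM) /=; ring.
rewrite (side pi); first last.
- by rewrite !trig1; apply: eq_ReIm; rewrite !(ReD, ImD, ReM, ImM) /=; ring.
- by rewrite !trig1; apply: eq_ReIm; rewrite !(ReD, ImD, ReM, ImM) /=; ring.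
rewrite last_corner (corner pi) (corner 0) add0r (corner (pi / 2)) -splitr.
by rewrite -(primitive_period GE lt0 w0d); ring.
Qed.

End LogarithmicPrimitive.

(** * The residue theorem on rectangles *)

Section ResidueTheorem.
Variable R : realType.
Local Notation C := R[i].
Implicit Types (z w p q : C) (g h : C -> C) (s : seq C).
Local Opaque line_integral rect_integral.

Lemma two_pi_i_neq0 : two_pi_i R != 0.
Proof.
rewrite mulf_neq0//; last by rewrite -normc_gt0 normci.
by rewrite -normc_gt0 normcR normr_gt0 mulf_neq0// gt_eqF// pi_gt0.
Qed.

(** The expression whose limit is the residue is constant for small radii. *)
Lemma residue_punctured g p (delta : R) : 0 < delta ->
  (forall z, 0 < normc (z - p) < delta -> derivable g z (1 : C)) ->
  (forall rho, 0 < rho < delta ->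
     circle_integral g p rho = two_pi_i R * residue g p) /\
  (forall t, 0 < t -> 2 * t < delta ->
     rect_integral g (Re p - t) (Re p + t) (Im p - t) (Im p + t) =
     two_pi_i R * residue g p).
Proof.
move=> d0 dg; have [kappa [circ rect]] := punctured_disc_integrals d0 dg.
suff -> : two_pi_i R * residue g p = kappa by [].
have H : (two_pi_i R)^-1 * circle_integral g p rho @[rho --> 0^'+] -->
    (two_pi_i R)^-1 * kappa.
  apply: cvg_near_cst; near=> rho; rewrite circ//.
  apply/andP; split; near: rho; first exact: nbhs_right_gt.
  exact: nbhs_right_lt.
have -> : residue g p = (two_pi_i R)^-1 * kappa.
  by apply: cvg_lim; first exact: norm_hausdorff.
by rewrite mulrA divff ?mul1r// two_pi_i_neq0.
Unshelve. all: by end_near. Qed.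

Definition inside (x1 x2 y1 y2 : R) p : bool :=
  (x1 < Re p < x2) && (y1 < Im p < y2).

(** Points of [s] off the rectangle are allowed, so that the same list [s] serves
    all the rectangles of a subdivision. *)
Definition admissible g s (x1 x2 y1 y2 : R) : Prop :=
  [/\ x1 <= x2, y1 <= y2,
    forall p, p \in s -> cbox (x1 +i* y1) (x2 +i* y2) p -> inside x1 x2 y1 y2 p &
    forall z, cbox (x1 +i* y1) (x2 +i* y2) z -> z \notin s ->
      derivable g z (1 : C)].

Definition residue_formula g s (x1 x2 y1 y2 : R) : Prop :=
  rect_integral g x1 x2 y1 y2 =
  two_pi_i R * \sum_(p <- s | inside x1 x2 y1 y2 p) residue g p.

(** Goursat's theorem: neither the interior nor the boundary meets [s]. *)
Lemma residue_formula_none g s x1 x2 y1 y2 : admissible g s x1 x2 y1 y2 ->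
  (forall p, p \in s -> ~~ inside x1 x2 y1 y2 p) ->
  residue_formula g s x1 x2 y1 y2.
Proof.
move=> [x12 y12 sin dg] s0; rewrite /residue_formula big_seq_cond big1; last first.
  by move=> p /andP[ps]; rewrite (negbTE (s0 p ps)).
rewrite mulr0; apply: Goursat_rect => // z zb; apply: dg => //.
by apply/negP => zs; have := s0 _ zs; rewrite (sin _ zs zb).
Qed.

Lemma admissible_vcut g s x1 x2 y1 y2 c : admissible g s x1 x2 y1 y2 ->
  x1 < c < x2 -> (forall p, p \in s -> inside x1 x2 y1 y2 p -> Re p != c) ->
  admissible g s x1 c y1 y2 /\ admissible g s c x2 y1 y2.
Proof.
move=> [x12 y12 sin dg] /andP[xc cx] sc.
split; split => //; try exact: ltW.
- move=> p ps /andP[/= /andP[h1 h2] h3].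
  have pin : inside x1 x2 y1 y2 p.
    by apply: sin => //; rewrite /cbox /= h1 h3 (le_trans h2)// ltW.
  have := sc _ ps pin; move: pin => /andP[/andP[h4 _] h5].
  by rewrite /inside h4 h5 andbT /= lt_neqAle h2 andbT.
- move=> z /andP[/= /andP[h1 h2] h3]; apply: dg.
  by rewrite /cbox /= h1 h3 (le_trans h2)// ltW.
- move=> p ps /andP[/= /andP[h1 h2] h3].
  have pin : inside x1 x2 y1 y2 p.
    by apply: sin => //; rewrite /cbox /= h2 h3 (le_trans _ h1)// ltW.
  have := sc _ ps pin; move: pin => /andP[/andP[_ h4] h5].
  by rewrite /inside h4 h5 !andbT lt_neqAle h1 andbT eq_sym.
- move=> z /andP[/= /andP[h1 h2] h3]; apply: dg.
  by rewrite /cbox /= h2 h3 (le_trans _ h1)// ltW.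
Qed.

Lemma admissible_hcut g s x1 x2 y1 y2 c : admissible g s x1 x2 y1 y2 ->
  y1 < c < y2 -> (forall p, p \in s -> inside x1 x2 y1 y2 p -> Im p != c) ->
  admissible g s x1 x2 y1 c /\ admissible g s x1 x2 c y2.
Proof.
move=> [x12 y12 sin dg] /andP[xc cx] sc.
split; split => //; try exact: ltW.
- move=> p ps /andP[/= h3 /andP[h1 h2]].
  have pin : inside x1 x2 y1 y2 p.
    by apply: sin => //; rewrite /cbox /= h1 h3 (le_trans h2)// ltW.
  have := sc _ ps pin; move: pin => /andP[h4 /andP[h5 _]].
  by rewrite /inside h4 h5 /= lt_neqAle h2 andbT.
- move=> z /andP[/= h3 /andP[h1 h2]]; apply: dg.
  by rewrite /cbox /= h1 h3 (le_trans h2)// ltW.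
- move=> p ps /andP[/= h3 /andP[h1 h2]].
  have pin : inside x1 x2 y1 y2 p.
    by apply: sin => //; rewrite /cbox /= h2 h3 (le_trans _ h1)// ltW.
  have := sc _ ps pin; move: pin => /andP[h4 /andP[_ h5]].
  by rewrite /inside h4 h5 /= andbT lt_neqAle h1 andbT eq_sym.
- move=> z /andP[/= h3 /andP[h1 h2]]; apply: dg.
  by rewrite /cbox /= h2 h3 (le_trans _ h1)// ltW.
Qed.

Lemma big_inside_vcut (T : Type) (idx : T) (op : Monoid.com_law idx)
    (F : C -> T) s x1 x2 y1 y2 c :
  x1 < c < x2 -> (forall p, p \in s -> inside x1 x2 y1 y2 p -> Re p != c) ->
  \big[op/idx]_(p <- s | inside x1 x2 y1 y2 p) F p =
  op (\big[op/idx]_(p <- s | inside x1 c y1 y2 p) F p)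
     (\big[op/idx]_(p <- s | inside c x2 y1 y2 p) F p).
Proof.
move=> /andP[xc cx] sc; rewrite (bigID (fun p => Re p < c)) /=; congr (op _ _).
- apply: eq_bigl => p; rewrite /inside.
  case: (ltP (Re p) c) => pc; last by rewrite !andbF.
  by rewrite andbT (lt_trans pc cx).
- rewrite big_seq_cond [RHS]big_seq_cond; apply: eq_bigl => p.
  case ps : (p \in s) => //=; have := sc _ ps; rewrite /inside.
  case: (ltgtP (Re p) c) => //= pc; rewrite ?andbF ?andbT.
  + by [].
  + by rewrite (lt_trans xc pc).
  + by move=> H; apply/negP => /H.
Qed.

Lemma big_inside_hcut (T : Type) (idx : T) (op : Monoid.com_law idx)
    (F : C -> T) s x1 x2 y1 y2 c :
  y1 < c < y2 -> (forall p, p \in s -> inside x1 x2 y1 y2 p -> Im p != c) ->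
  \big[op/idx]_(p <- s | inside x1 x2 y1 y2 p) F p =
  op (\big[op/idx]_(p <- s | inside x1 x2 y1 c p) F p)
     (\big[op/idx]_(p <- s | inside x1 x2 c y2 p) F p).
Proof.
move=> /andP[xc cx] sc; rewrite (bigID (fun p => Im p < c)) /=; congr (op _ _).
- apply: eq_bigl => p; rewrite /inside.
  case: (ltP (Im p) c) => pc; last by rewrite !andbF.
  by rewrite andbT (lt_trans pc cx).
- rewrite big_seq_cond [RHS]big_seq_cond; apply: eq_bigl => p.
  case ps : (p \in s) => //=; have := sc _ ps; rewrite /inside.
  case: (ltgtP (Im p) c) => //= pc; rewrite ?andbF ?andbT.
  + by [].
  + by rewrite (lt_trans xc pc).
  + by move=> H; apply/negP => /H.
Qed.

Lemma admissible_continuous g s x1 x2 y1 y2 z : admissible g s x1 x2 y1 y2 ->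
  cbox (x1 +i* y1) (x2 +i* y2) z -> ~~ inside x1 x2 y1 y2 z ->
  {for z, continuous g}.
Proof.
move=> [_ _ sin dg] zb zin; apply/derivable_continuousc/dg => //.
by apply/negP => zs; rewrite (sin _ zs zb) in zin.
Qed.

Lemma residue_formula_vcut g s x1 x2 y1 y2 c : admissible g s x1 x2 y1 y2 ->
  x1 < c < x2 -> (forall p, p \in s -> inside x1 x2 y1 y2 p -> Re p != c) ->
  residue_formula g s x1 c y1 y2 -> residue_formula g s c x2 y1 y2 ->
  residue_formula g s x1 x2 y1 y2.
Proof.
move=> A cc sc Ql Qr; have [x12 y12 sin dg] := A; have /andP[xc cx] := cc.
rewrite /residue_formula (rect_integral_vcut (c := c))//.
- by rewrite Ql Qr -mulrDr (big_inside_vcut _ _ cc sc).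
- by rewrite (ltW xc) (ltW cx).
- move=> x xx; apply: (admissible_continuous A); rewrite /cbox /inside /= ?xx ?lexx ?y12//.
  by rewrite ltxx andbF.
- move=> x xx; apply: (admissible_continuous A); rewrite /cbox /inside /= ?xx ?lexx ?y12//.
  by rewrite ltxx !andbF.
- move=> y yy; have cb : cbox (x1 +i* y1) (x2 +i* y2) (c +i* y).
    by rewrite /cbox /= yy (ltW xc) (ltW cx).
  apply/derivable_continuousc/dg => //; apply/negP => ps.
  by have := sc _ ps (sin _ ps cb); rewrite eqxx.
Qed.

Lemma residue_formula_hcut g s x1 x2 y1 y2 c : admissible g s x1 x2 y1 y2 ->
  y1 < c < y2 -> (forall p, p \in s -> inside x1 x2 y1 y2 p -> Im p != c) ->
  residue_formula g s x1 x2 y1 c -> residue_formula g s x1 x2 c y2 ->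
  residue_formula g s x1 x2 y1 y2.
Proof.
move=> A cc sc Ql Qr; have [x12 y12 sin dg] := A; have /andP[xc cx] := cc.
rewrite /residue_formula (rect_integral_hcut (c := c))//.
- by rewrite Ql Qr -mulrDr (big_inside_hcut _ _ cc sc).
- by rewrite (ltW xc) (ltW cx).
- move=> x xx; apply: (admissible_continuous A); rewrite /cbox /inside /= ?xx ?lexx ?x12//.
  by rewrite ltxx.
- move=> x xx; apply: (admissible_continuous A); rewrite /cbox /inside /= ?xx ?lexx ?x12//.
  by rewrite ltxx !andbF.
- move=> y yy; have cb : cbox (x1 +i* y1) (x2 +i* y2) (y +i* c).
    by rewrite /cbox /= yy (ltW xc) (ltW cx).
  apply/derivable_continuousc/dg => //; apply/negP => ps.
  by have := sc _ ps (sin _ ps cb); rewrite eqxx.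
Qed.

(** A cut between two singularities must not pass through a third. *)
Lemma exists_between_avoiding (a b : R) (l : seq R) : a < b ->
  exists2 c, a < c < b & c \notin l.
Proof.
move=> ab.
suff [a' [b' [ab' aa' bb' H]]] : exists a' b' : R, [/\ a' < b', a <= a', b' <= b &
    forall c, a' < c < b' -> c \notin l].
  have cc : a' < (a' + b') / 2 < b' by rewrite !midf_lt.
  by exists ((a' + b') / 2); [case/andP: cc => h1 h2; rewrite (le_lt_trans aa')// (lt_le_trans h2)|exact: H].
elim: l => [|x l [a' [b' [ab' aa' bb' H]]]]; first by exists a, b.
have [/andP[ax xb]|xN] := boolP (a' < x < b').
  exists x, b'; split => //; first by rewrite (le_trans aa')// ltW.
  move=> c /andP[xc cb]; rewrite inE negb_or gt_eqF//=.
  by apply: H; rewrite cb (lt_trans ax).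
exists a', b'; split => // c cc; rewrite inE negb_or H// andbT.
by apply: contra xN => /eqP <-.
Qed.

(** A rectangle around a single singularity is trimmed down, by four cuts, to a
    small square centred at it. *)
Lemma residue_formula_one g s x1 x2 y1 y2 p : uniq s ->
  admissible g s x1 x2 y1 y2 -> p \in s -> inside x1 x2 y1 y2 p ->
  (forall q, q \in s -> inside x1 x2 y1 y2 q -> q = p) ->
  residue_formula g s x1 x2 y1 y2.
Proof.
move=> us A ps pin sp; have /andP[/andP[x1p px2] /andP[y1p py2]] := pin.
pose d := Num.min (Num.min (Re p - x1) (x2 - Re p))
                  (Num.min (Im p - y1) (y2 - Im p)).
have d0 : 0 < d by rewrite !lt_min !subr_gt0 x1p px2 y1p.
have [dx1 dx2 dy1 dy2] : [/\ d <= Re p - x1, d <= x2 - Re p, d <= Im p - y1 &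
    d <= y2 - Im p] by split; rewrite !ge_min lexx ?orbT.
(* the square of half-side t lies in the disc of radius d, as 2 t < d *)
pose t := d / 4.
have t0 : 0 < t by rewrite divr_gt0.
have t2 : 2 * t < d by rewrite /t; lra.
have none a b c e : admissible g s a b c e ->
    x1 <= a -> b <= x2 -> y1 <= c -> e <= y2 -> ~~ inside a b c e p ->
    residue_formula g s a b c e.
  move=> A' xa bx yc ey pN; apply: residue_formula_none => // q qs.
  apply: contra pN => qin; suff -> : p = q by [].
  apply/esym/sp => //; move: qin => /andP[/andP[h1 h2] /andP[h3 h4]].
  by rewrite /inside (le_lt_trans xa)// (lt_le_trans h2)// (le_lt_trans yc)// (lt_le_trans h4).
have vne a b c e r q : x1 <= a -> b <= x2 -> y1 <= c -> e <= y2 -> r != 0 ->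
    q \in s -> inside a b c e q -> Re q != Re p + r.
  move=> xa bx yc ey r0 qs /andP[/andP[h1 h2] /andP[h3 h4]].
  have -> : q = p.
    apply: sp => //.
    by rewrite /inside (le_lt_trans xa)// (lt_le_trans h2)// (le_lt_trans yc)// (lt_le_trans h4).
  by rewrite -subr_eq0 opprD addrA subrr sub0r oppr_eq0.
have hne a b c e r q : x1 <= a -> b <= x2 -> y1 <= c -> e <= y2 -> r != 0 ->
    q \in s -> inside a b c e q -> Im q != Im p + r.
  move=> xa bx yc ey r0 qs /andP[/andP[h1 h2] /andP[h3 h4]].
  have -> : q = p.
    apply: sp => //.
    by rewrite /inside (le_lt_trans xa)// (lt_le_trans h2)// (le_lt_trans yc)// (lt_le_trans h4).
  by rewrite -subr_eq0 opprD addrA subrr sub0r oppr_eq0.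
have tn0 : t != 0 by rewrite gt_eqF.
have tNn0 : - t != 0 by rewrite oppr_eq0.
have c1 : x1 < Re p - t < x2 by apply/andP; split; lra.
have n1 q (qs : q \in s) := @vne x1 x2 y1 y2 (- t) q (lexx _) (lexx _) (lexx _) (lexx _) tNn0 qs.
have [A1 A2] := admissible_vcut A c1 n1.
apply: (residue_formula_vcut A c1 n1).
  apply: none A1 _ _ _ _ _ => //; first by case/andP: c1 => _ /ltW.
  by apply/negP => /andP[/andP[_ h] _]; move: h; lra.
have c2 : Re p - t < Re p + t < x2 by apply/andP; split; lra.
have x1t : x1 <= Re p - t by case/andP: c1 => /ltW.
have n2 q (qs : q \in s) := @vne (Re p - t) x2 y1 y2 t q x1t (lexx _) (lexx _) (lexx _) tn0 qs.
have [A3 A4] := admissible_vcut A2 c2 n2.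
apply: (residue_formula_vcut A2 c2 n2); last first.
  apply: none A4 _ _ _ _ _ => //; first by lra.
  by apply/negP => /andP[/andP[h _] _]; move: h; lra.
have x2t : Re p + t <= x2 by lra.
have c3 : y1 < Im p - t < y2 by apply/andP; split; lra.
have n3 q (qs : q \in s) := @hne (Re p - t) (Re p + t) y1 y2 (- t) q x1t x2t (lexx _) (lexx _) tNn0 qs.
have [A5 A6] := admissible_hcut A3 c3 n3.
apply: (residue_formula_hcut A3 c3 n3).
  apply: none A5 _ _ _ _ _ => //; first by lra.
  by apply/negP => /andP[_ /andP[_ h]]; move: h; lra.
have c4 : Im p - t < Im p + t < y2 by apply/andP; split; lra.
have y1t : y1 <= Im p - t by lra.
have n4 q (qs : q \in s) := @hne (Re p - t) (Re p + t) (Im p - t) y2 t q x1t x2t y1t (lexx _) tn0 qs.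
have [A7 A8] := admissible_hcut A6 c4 n4.
apply: (residue_formula_hcut A6 c4 n4); last first.
  apply: none A8 _ _ _ _ _ => //; first by lra.
  by apply/negP => /andP[_ /andP[h _]]; move: h; lra.
have dg z : 0 < normc (z - p) < d -> derivable g z (1 : C).
  move=> /andP[zp zd].
  have zb : cbox (x1 +i* y1) (x2 +i* y2) z.
    have := le_lt_trans (le_normc_Re _) zd; have := le_lt_trans (le_normc_Im _) zd.
    rewrite ReD ImD ReN ImN !ltr_norml /cbox /= => /andP[i1 i2] /andP[r1 r2].
    by apply/andP; split; apply/andP; split; lra.
  case: A => _ _ sin; apply => //; apply/negP => zs.
  by move: zp; rewrite (sp _ zs (sin _ zs zb)) subrr normc0 ltxx.
have [_ H] := residue_punctured d0 dg.
rewrite /residue_formula (H t t0 t2); congr (_ * _).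
rewrite big_seq_cond (eq_bigl (fun q => (q \in s) && (q == p))).
  rewrite -big_seq_cond -big_filter filter_pred1_uniq// big_seq1//.
move=> q; case qs : (q \in s) => //=; apply/idP/eqP => [/andP[/andP[h1 h2] /andP[h3 h4]]|->].
  by apply: sp => //; rewrite /inside; apply/andP; split; apply/andP; split; lra.
by rewrite /inside; apply/andP; split; apply/andP; split; lra.
Qed.

(** As long as there are two singularities inside, a line between them cuts the
    rectangle into two parts with fewer singularities each. *)
Theorem rect_residue_theorem g s x1 x2 y1 y2 : uniq s ->
  admissible g s x1 x2 y1 y2 -> residue_formula g s x1 x2 y1 y2.
Proof.
move=> us; have [n] := ubnP (count (inside x1 x2 y1 y2) s).
elim: n x1 x2 y1 y2 => // n IH x1 x2 y1 y2; rewrite ltnS => cn A.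
case E : (seq.filter (inside x1 x2 y1 y2) s) => [|p [|q l]].
- apply: residue_formula_none => // p ps.
  have : p \notin seq.filter (inside x1 x2 y1 y2) s by rewrite E.
  by rewrite mem_filter ps andbT.
- have pf : p \in seq.filter (inside x1 x2 y1 y2) s by rewrite E inE.
  move: pf; rewrite mem_filter => /andP[pin ps].
  apply: (residue_formula_one us A ps pin) => q qs qin.
  have : q \in seq.filter (inside x1 x2 y1 y2) s by rewrite mem_filter qin.
  by rewrite E inE => /eqP.
have /andP[pin ps] : inside x1 x2 y1 y2 p && (p \in s).
  by rewrite -mem_filter E inE eqxx.
have /andP[qin qs] : inside x1 x2 y1 y2 q && (q \in s).
  by rewrite -mem_filter E !inE eqxx orbT.
have pq : p != q.
  have := filter_uniq (inside x1 x2 y1 y2) us.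
  by rewrite E /= inE negb_or => /andP[/andP[]].
have smaller (P Q : pred C) v : count (inside x1 x2 y1 y2) s = (count P s + count Q s)%N ->
    v \in s -> Q v -> (count P s < n)%N.
  move=> cE vs Qv; apply: leq_trans cn; rewrite cE -[X in (X < _)%N]addn0 ltn_add2l.
  by rewrite -has_count; apply/hasP; exists v.
have vcount c : x1 < c < x2 ->
    (forall p, p \in s -> inside x1 x2 y1 y2 p -> Re p != c) ->
    count (inside x1 x2 y1 y2) s =
    (count (inside x1 c y1 y2) s + count (inside c x2 y1 y2) s)%N.
  by move=> cc nc; rewrite -!sum1_count; exact: big_inside_vcut.
have hcount c : y1 < c < y2 ->
    (forall p, p \in s -> inside x1 x2 y1 y2 p -> Im p != c) ->
    count (inside x1 x2 y1 y2) s =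
    (count (inside x1 x2 y1 c) s + count (inside x1 x2 c y2) s)%N.
  by move=> cc nc; rewrite -!sum1_count; exact: big_inside_hcut.
have vcase u v : u \in s -> v \in s -> inside x1 x2 y1 y2 u ->
    inside x1 x2 y1 y2 v -> Re u < Re v -> residue_formula g s x1 x2 y1 y2.
  move=> us' vs uin vin uv.
  have /andP[/andP[xu ux] yu] := uin; have /andP[/andP[xv vx] yv] := vin.
  have [c /andP[uc cv] cN] := exists_between_avoiding (map (fun z : C => Re z) s) uv.
  have cc : x1 < c < x2 by rewrite (lt_trans xu uc) (lt_trans cv vx).
  have nc r : r \in s -> inside x1 x2 y1 y2 r -> Re r != c.
    by move=> rs _; apply: contraNN cN => /eqP <-; apply/mapP; exists r.
  have [A1 A2] := admissible_vcut A cc nc.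
  apply: (residue_formula_vcut A cc nc).
    apply: IH => //; apply: smaller (vcount c cc nc) vs _.
    by rewrite /inside cv vx yv.
  apply: IH => //; apply: (smaller _ (inside x1 c y1 y2)) us' _.
    by rewrite addnC; exact: vcount.
  by rewrite /inside uc xu yu.
have hcase u v : u \in s -> v \in s -> inside x1 x2 y1 y2 u ->
    inside x1 x2 y1 y2 v -> Im u < Im v -> residue_formula g s x1 x2 y1 y2.
  move=> us' vs uin vin uv.
  have /andP[yu /andP[xu ux]] := uin; have /andP[yv /andP[xv vx]] := vin.
  have [c /andP[uc cv] cN] := exists_between_avoiding (map (fun z : C => Im z) s) uv.
  have cc : y1 < c < y2 by rewrite (lt_trans xu uc) (lt_trans cv vx).
  have nc r : r \in s -> inside x1 x2 y1 y2 r -> Im r != c.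
    by move=> rs _; apply: contraNN cN => /eqP <-; apply/mapP; exists r.
  have [A1 A2] := admissible_hcut A cc nc.
  apply: (residue_formula_hcut A cc nc).
    apply: IH => //; apply: smaller (hcount c cc nc) vs _.
    by rewrite /inside cv vx yv.
  apply: IH => //; apply: (smaller _ (inside x1 x2 y1 c)) us' _.
    by rewrite addnC; exact: hcount.
  by rewrite /inside uc xu yu.
have [r|r|r] := ltgtP (Re p) (Re q).
- exact: (vcase p q).
- exact: (vcase q p).
have [i|i|i] := ltgtP (Im p) (Im q).
- exact: (hcase p q).
- exact: (hcase q p).
by move: pq; rewrite (eq_ReIm r i) eqxx.
Qed.

End ResidueTheorem.

(** * Estimates along horizontal and vertical segments *)

Section Inversion.
Variable R : realType.
Local Notation C := R[i].
Implicit Types (z w p q : C) (g h : C -> C) (s : seq C).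

Lemma segment_integralE (a : R) g (T : R) : 0 < T ->
  continuous_vline g a (- T) T ->
  segment_integral a g T = line_integral g (a +i* (- T)) (a +i* T).
Proof.
move=> T0 gc.
have T2 : 0 < 2 * T by rewrite mulr_gt0.
have gc' : {in `[2 * T * 0 + - T, 2 * T * 1 + - T],
    continuous (fun t : R => g (a +i* t))}.
  move=> t; rewrite in_itv/= mulr0 add0r => /andP[tT Tt].
  apply: continuous_comp; last by apply: gc; rewrite tT; lra.
  exact: (path_derive_continuous (path_derive_vertical a t)).
have := cintegral_affine ler01 T2 gc'.
have -> : 2 * T * 1 + - T = T by ring.
rewrite mulr0 add0r /segment_integral => ->.
rewrite /line_integral mulrA; congr (_ * _).
  by apply: eq_ReIm; rewrite !(ReM, ImM, ReD, ImD, ReN, ImN) /=; ring.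
apply: eq_cintegral => t _; congr g; apply: eq_ReIm.
  by rewrite seg_path_Re /=; ring.
by rewrite seg_path_Im /=; ring.
Qed.

Lemma Rintegral_expR_affine (A B : R) : B != 0 ->
  \int[lebesgue_measure]_(t in `[0, 1]) expR (A + t * B) =
  (expR (A + B) - expR A) / B.
Proof.
move=> B0.
have D t : is_derive t (1 : R) (fun u : R => expR (A + u * B) / B) (expR (A + t * B)).
  have Da : is_derive t (1 : R) (fun u : R => A + u * B) B.
    by apply: is_derive_eq; rewrite /GRing.scale /=; ring.
  have De := @is_derive1_comp R (@expR R) (fun u : R => A + u * B) t _ _ (is_derive_expR _) Da.
  have -> : (fun u : R => expR (A + u * B) / B) =
      B^-1 *: (@expR R \o (fun u : R => A + u * B)).
    by apply/funext => u; rewrite /= mulrC.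
  by apply: (is_derive_eq (is_deriveZ B^-1 De)); rewrite /GRing.scale /=; field.
rewrite (@Rintegral_FTC R 0 1 (fun u : R => expR (A + u * B) / B))//.
- by rewrite mul1r mul0r addr0 mulrBl.
- move=> t _; apply: continuous_comp; last exact: continuous_expR.
  by apply: cvgD; [exact: cvg_cst|apply: cvgM; [exact: cvg_id|exact: cvg_cst]].
Qed.

(** The exponential decay towards the left makes the integral over an
    arbitrarily long horizontal segment bounded. *)
Lemma line_integral_exp_bound g z w (K u : R) : 0 < u -> 0 <= K ->
  continuous_seg_on g z w -> Im z = Im w -> Re z < Re w ->
  (forall t : R, 0 <= t <= 1 ->
    normc (g (seg_path z w t)) <= K * expR (u * Re (seg_path z w t))) ->
  normc (line_integral g z w) <= 2 * K * expR (u * Re w) / u.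
Proof.
move=> u0 K0 gc zw rzw gK.
have B0 : 0 < u * (Re w - Re z) by rewrite mulr_gt0// subr_gt0.
pose k t := K * expR (u * Re z + t * (u * (Re w - Re z))).
have ki : (@lebesgue_measure R).-integrable `[0, 1] (EFin \o k).
  apply: continuous_in_integrable => t _; apply: cvgM; first exact: cvg_cst.
  apply: continuous_comp; last exact: continuous_expR.
  by apply: cvgD; [exact: cvg_cst|apply: cvgM; [exact: cvg_id|exact: cvg_cst]].
have kg t : `[0, 1]%classic t -> normc (g (seg_path z w t)) <= k t.
  rewrite /= in_itv/= => t01; rewrite (le_trans (gK t t01))// /k seg_path_Re.
  by rewrite le_eqVlt; apply/orP; left; apply/eqP; congr (_ * expR _); ring.
have := normc_cintegral_le (measurable_itv _)
  (continuous_cintegrable (continuous_seg_comp gc)) ki kg.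
rewrite /k RintegralZl//; last first.
  apply: continuous_in_integrable => t _.
  apply: continuous_comp; last exact: continuous_expR.
  by apply: cvgD; [exact: cvg_cst|apply: cvgM; [exact: cvg_id|exact: cvg_cst]].
rewrite Rintegral_expR_affine ?gt_eqF// => H.
have nwz : normc (w - z) = Re w - Re z.
  have -> : w - z = (Re w - Re z)%:C.
    by apply: eq_ReIm; rewrite ?ReD ?ImD ?ReN ?ImN //= zw subrr.
  by rewrite normcR gtr0_norm ?subr_gt0.
have -> : line_integral g z w = (w - z) * cintegral `[0, 1] (fun t => g (seg_path z w t)) by [].
rewrite normcM nwz; apply: (le_trans (ler_wpM2l _ H)).
  by rewrite subr_ge0 ltW.
have -> : u * Re z + u * (Re w - Re z) = u * Re w by ring.
have -> : (Re w - Re z) * (2 * (K * ((expR (u * Re w) - expR (u * Re z)) /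
    (u * (Re w - Re z))))) = 2 * K * (expR (u * Re w) - expR (u * Re z)) / u.
  by field; rewrite (gt_eqF u0) gt_eqF// subr_gt0.
rewrite ler_pM2r ?invr_gt0// ler_wpM2l ?mulr_ge0//.
by rewrite gerBl expR_ge0.
Qed.

End Inversion.

(** * The inversion integral as a sum of residues *)

Section BromwichIntegral.
Variable R : realType.
Local Notation C := R[i].
Implicit Types (z w p q : C).

Lemma derivable_inversion_integrand n (F : C -> C) (x : R) z :
  derivable F z (1 : C) -> derivable (inversion_integrand n F x) z (1 : C).
Proof.
move=> dF.
have Dl : is_derive z (1 : C) (fun y : C => y * (x ^+ n)%:C) (x ^+ n)%:C.
  apply/cderiveP => e e0; exists 1 => // h _.
  have -> : (z + h) * (x ^+ n)%:C - z * (x ^+ n)%:C - (x ^+ n)%:C * h = 0 by ring.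
  by rewrite normc0 mulr_ge0 ?normc_ge0// ltW.
have [De _] := is_derive_compc Dl (is_derive_cexp _).
have dn := derivable_cst (n%:R : C) z (1 : C).
exact: (derivableM (derivableM dn dF) De).
Qed.

Lemma normc_inversion_integrand n (F : C -> C) (x : R) z :
  normc (inversion_integrand n F x z) =
  n%:R * normc (F z) * expR (x ^+ n * Re z).
Proof.
rewrite /inversion_integrand normcM (normcM n%:R) normc_cexp ReM /= mulr0 subr0.
rewrite [Re z * _]mulrC; congr (_ * _ * _).
have -> : (n%:R : C) = (n%:R : R)%:C by rewrite rmorph_nat.
by rewrite normcR ger0_norm.
Qed.

Section Bromwich.
Variables (F : C -> C) (a : R) (m : nat) (y_ : 'I_m -> C).
Hypothesis y_inj : injective y_.
Hypothesis F_analytic :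
  forall y, (forall j, y <> y_ j) -> derivable F y (1 : C).
Hypothesis y_left : forall j, Re (y_ j) < a.

(** From this size on the squares and rectangles used below have all the
    singularities inside; adding 1 makes the bounds strict. *)
Definition bound_y : R := \sum_(j < m) normc (y_ j) + `|a| + 1.

Lemma bound_y_gt j : normc (y_ j) < bound_y.
Proof.
rewrite /bound_y (bigD1 j)//= -!addrA ltrDl; apply: ltr_wpDl.
  by apply: sumr_ge0 => i _; exact: normc_ge0.
by rewrite ltr_wpDl.
Qed.

Lemma bound_y_gt_a : `|a| < bound_y.
Proof.
rewrite /bound_y ltr_pwDr// lerDr sumr_ge0// => i _; exact: normc_ge0.
Qed.

Lemma bound_y_gt0 : 0 < bound_y.
Proof. exact: le_lt_trans bound_y_gt_a. Qed.

Let s := [seq y_ j | j <- enum 'I_m].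

Lemma uniq_singularities : uniq s.
Proof. by rewrite map_inj_uniq// enum_uniq. Qed.

Lemma derivable_off_singularities z : z \notin s -> derivable F z (1 : C).
Proof.
move=> zs; apply: F_analytic => j zj; move/negP: zs; apply.
by apply/mapP; exists j => //; rewrite mem_enum.
Qed.

Lemma singularity_inside (B : R) p : bound_y <= B -> p \in s ->
  inside (- B) a (- B) B p.
Proof.
move=> bB /mapP[j _ ->]; rewrite /inside y_left andbT.
have := lt_le_trans (bound_y_gt j) bB => yB.
have := le_lt_trans (le_normc_Re _) yB; have := le_lt_trans (le_normc_Im _) yB.
by rewrite !ltr_norml => -> /andP[-> _].
Qed.

Lemma admissible_box g (B : R) : bound_y <= B ->
  (forall z, Re z <= a -> derivable F z (1 : C) -> derivable g z (1 : C)) ->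
  admissible g s (- B) a (- B) B.
Proof.
move=> bB gF; have B0 : 0 < B := lt_le_trans bound_y_gt0 bB.
have aB := lt_le_trans bound_y_gt_a bB.
split.
- by move: aB; rewrite ltr_norml => /andP[/ltW].
- by rewrite ge0_cp// ltW.
- by move=> p ps _; exact: singularity_inside.
- move=> z /andP[/= /andP[_ za] _] zs; apply: gF => //.
  exact: derivable_off_singularities.
Qed.

Lemma rect_residues g (B : R) : bound_y <= B ->
  (forall z, Re z <= a -> derivable F z (1 : C) -> derivable g z (1 : C)) ->
  rect_integral g (- B) a (- B) B =
  two_pi_i R * \sum_(j < m) residue g (y_ j).
Proof.
move=> bB gF.
rewrite (rect_residue_theorem uniq_singularities (admissible_box bB gF)).
congr (_ * _); rewrite big_seq_cond.
rewrite (eq_bigl (fun p => p \in s)) -?big_seq ?big_map ?big_enum//.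
by move=> p; case ps : (p \in s) => //=; exact: singularity_inside.
Qed.

Hypothesis F_vanish :
  vanishes_at_infinity_on [set y : C | Re y <= a] F.

Lemma F_small (e : R) : 0 < e ->
  exists2 M : R, 0 < M & forall y, Re y <= a -> M <= normc y -> normc (F y) <= e.
Proof.
move=> e0; have [M HM] := F_vanish e0; exists (Num.max M 0 + 1).
  by rewrite ltr_wpDl// le_max lexx orbT.
move=> y ya My; have := HM y ya; rewrite !normcE !ltcR => /(_ _)/ltW; apply.
by apply: lt_le_trans My; rewrite ltr_pwDr// le_max lexx.
Qed.

Lemma x_le_expR (v : R) : v <= expR v.
Proof. by rewrite (le_trans _ (expR_ge1Dx v))// lerDr. Qed.

Section FixedPoint.
Variables (n : nat) (x : R).
Hypotheses (n0 : (0 < n)%N) (x0 : 0 < x).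
Let g := inversion_integrand n F x.
Let u := x ^+ n.

Let u0 : 0 < u. Proof. by rewrite exprn_gt0. Qed.

(** The rectangle integral minus its right side consists of two horizontal sides,
    each bounded uniformly in [T] times the supremum of |F|, and the left side, where
    [2 T expR (- u T)] is at most [2 / u]. *)
Lemma segment_integral_close (e : R) : 0 < e -> exists2 M : R, 0 < M &
  forall T, M <= T ->
  normc (two_pi_i R * \sum_(j < m) residue g (y_ j) - segment_integral a g T)
    <= e.
Proof.
move=> e0.
(* K d is the sum of the bounds for the three sides when |F| <= d on them *)
pose K := n%:R * (4 * expR (u * a) / u + 4 / u).
have K0 : 0 < K.
  rewrite mulr_gt0 ?ltr0n// addr_gt0// ?divr_gt0// ?mulr_gt0 ?expR_gt0//.
pose d := e / K; have d0 : 0 < d by rewrite divr_gt0.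
have [M M0 HM] := F_small d0.
exists (Num.max M bound_y); first by rewrite lt_max M0.
move=> T; rewrite ge_max => /andP[MT bT].
have T0 : 0 < T by exact: lt_le_trans MT.
have aT := lt_le_trans bound_y_gt_a bT.
have [aT1 aT2] : - T < a /\ a < T by move: aT; rewrite ltr_norml => /andP[].
have gF z : Re z <= a -> derivable F z (1 : C) -> derivable g z (1 : C).
  by move=> _; exact: derivable_inversion_integrand.
have A := admissible_box bT gF.
rewrite -(rect_residues bT gF).
have cont z : cbox ((- T) +i* (- T)) (a +i* T) z ->
    ~~ inside (- T) a (- T) T z -> {for z, continuous g}.
  exact: admissible_continuous A.
have TT : - T <= T by rewrite ge0_cp// ltW.
have hb : continuous_hline g (- T) a (- T).
  by move=> v vv; apply: cont; rewrite /cbox /inside /= ?vv ?lexx ?TT// ltxx andbF.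
have ht : continuous_hline g (- T) a T.
  by move=> v vv; apply: cont; rewrite /cbox /inside /= ?vv ?lexx ?TT// ltxx !andbF.
have vl : continuous_vline g (- T) (- T) T.
  by move=> v vv; apply: cont; rewrite /cbox /inside /= ?vv ?lexx ?ltW// ltxx.
have vr : continuous_vline g a (- T) T.
  by move=> v vv; apply: cont; rewrite /cbox /inside /= ?vv ?lexx ?ltW// ltxx andbF.
rewrite segment_integralE//.
have sb := continuous_hline_seg (ltW aT1) hb.
have st := continuous_hline_seg (ltW aT1) ht.
have sl := continuous_vline_seg TT vl.
rewrite /rect_integral.
rewrite (line_integral_rev st) (line_integral_rev sl).
have far z : Re z <= a -> T <= normc z -> normc (g z) <= n%:R * d * expR (u * Re z).
  move=> za Tz; rewrite normc_inversion_integrand ler_wpM2r ?expR_ge0//.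
  by rewrite ler_wpM2l//; apply: HM => //; exact: le_trans Tz.
have hor y : `|y| = T -> continuous_seg_on g ((- T) +i* y) (a +i* y) ->
    normc (line_integral g ((- T) +i* y) (a +i* y)) <=
    2 * (n%:R * d) * expR (u * a) / u.
  move=> yT gc; apply: line_integral_exp_bound => //.
    by rewrite mulr_ge0// ltW.
  move=> t t01; apply: far.
    rewrite seg_path_Re /=.
    have h1 : - T <= - T <= a by rewrite lexx ltW.
    have h2 : - T <= a <= a by rewrite lexx ltW.
    by have /andP[] := convex_comb_le t01 h1 h2.
  have ImE : Im (seg_path ((- T) +i* y) (a +i* y) t) = y.
    by rewrite seg_path_Im /=; ring.
  by apply: le_trans (le_normc_Im _); rewrite ImE yT.
have ver : normc (line_integral g ((- T) +i* (- T)) ((- T) +i* T)) <=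
    4 * (n%:R * d) / u.
  have bnd t : 0 <= t <= 1 ->
      normc (g (seg_path ((- T) +i* (- T)) ((- T) +i* T) t)) <=
      n%:R * d * expR (- (u * T)).
    move=> t01; have Ret : Re (seg_path ((- T) +i* (- T)) ((- T) +i* T) t) = - T.
      by rewrite seg_path_Re /=; ring.
    have := far (seg_path ((- T) +i* (- T)) ((- T) +i* T) t).
    rewrite Ret mulrN; apply; first exact: ltW.
    by apply: le_trans (le_normc_Re _); rewrite Ret normrN ler_norm.
  apply: (le_trans (normc_line_integral sl bnd)).
  have -> : (- T) +i* T - ((- T) +i* (- T)) = (2 * T)%:C * 'i.
    by apply: eq_ReIm; rewrite !(ReD, ImD, ReN, ImN, ReM, ImM) /=; ring.
  rewrite normcM normcR normci mulr1 gtr0_norm ?mulr_gt0// expRN.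
  have -> : 2 * (n%:R * d * (expR (u * T))^-1) * (2 * T) =
    4 * (n%:R * d) / u * (u * T / expR (u * T)).
    by field; rewrite !gt_eqF ?expR_gt0.
  have dn0 : 0 <= n%:R * d by rewrite mulr_ge0// ltW.
  rewrite ler_piMr//; first by rewrite divr_ge0 ?(ltW u0)// mulr_ge0.
  by rewrite ler_pdivrMr ?expR_gt0// mul1r x_le_expR.
have -> (b r t l : C) : b + r + - t + - l - r = b - t - l by ring.
apply: (@le_trans _ _ (2 * (n%:R * d) * expR (u * a) / u +
  2 * (n%:R * d) * expR (u * a) / u + 4 * (n%:R * d) / u)).
  rewrite (le_trans (normcB _ _))// lerD//.
  rewrite (le_trans (normcB _ _))// lerD//.
    by refine (hor _ _ sb); rewrite normrN gtr0_norm.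
  by refine (hor _ _ st); rewrite gtr0_norm.
rewrite le_eqVlt; apply/orP; left; apply/eqP.
have -> : e = d * K by rewrite /d divfK// gt_eqF.
by rewrite /K; field; rewrite gt_eqF.
Qed.

Lemma cvg_segment_integral :
  segment_integral a g T @[T --> +oo] -->
  two_pi_i R * \sum_(j < m) residue g (y_ j).
Proof.
apply/cvgcP => e e0.
have e2 : 0 < e / 2 by rewrite divr_gt0.
have [M M0 HM] := segment_integral_close e2.
near=> T; apply: (@le_lt_trans _ _ (e / 2)); last by rewrite ltr_pdivrMr// ltr_pMr// ltr1n.
by apply: HM; near: T; apply: nbhs_pinfty_ge; rewrite num_real.
Unshelve. all: by end_near. Qed.

Lemma vline_integral_residues :
  vline_integral a g = two_pi_i R * \sum_(j < m) residue g (y_ j).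
Proof. by apply: cvg_lim; [exact: norm_hausdorff|exact: cvg_segment_integral]. Qed.

End FixedPoint.
End Bromwich.
End BromwichIntegral.

(** * Estimates on rectangles and Cauchy's formula *)

Section CauchyFormula.
Variable R : realType.
Local Notation C := R[i].
Implicit Types (z w p q : C) (g h : C -> C) (s : seq C).

Section Boundary.
Variables (g : C -> C) (x1 x2 y1 y2 : R).
Hypotheses (x12 : x1 <= x2) (y12 : y1 <= y2).
Let boundary z := cbox (x1 +i* y1) (x2 +i* y2) z /\ ~~ inside x1 x2 y1 y2 z.

Let bh x : x1 <= x <= x2 -> boundary (x +i* y1) /\ boundary (x +i* y2).
Proof.
by move=> xx; rewrite /boundary /cbox /inside /= xx !lexx y12 !ltxx !andbF.
Qed.

Let bv y : y1 <= y <= y2 -> boundary (x1 +i* y) /\ boundary (x2 +i* y).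
Proof.
by move=> yy; rewrite /boundary /cbox /inside /= yy !lexx x12 !ltxx !andbF.
Qed.

Hypothesis gc : forall z, boundary z -> {for z, continuous g}.

Lemma continuous_boundary_sides :
  [/\ continuous_seg_on g (x1 +i* y1) (x2 +i* y1),
      continuous_seg_on g (x2 +i* y1) (x2 +i* y2),
      continuous_seg_on g (x2 +i* y2) (x1 +i* y2) &
      continuous_seg_on g (x1 +i* y2) (x1 +i* y1)].
Proof.
split.
- by apply: continuous_hline_seg => // x /bh[/gc].
- by apply: continuous_vline_seg => // x /bv[_ /gc].
- by apply/continuous_seg_rev/continuous_hline_seg => // x /bh[_ /gc].
- by apply/continuous_seg_rev/continuous_vline_seg => // x /bv[/gc].
Qed.

Lemma normc_rect_integral (M : R) : (forall z, boundary z -> normc (g z) <= M) ->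
  normc (rect_integral g x1 x2 y1 y2) <= 4 * M * (x2 - x1 + (y2 - y1)).
Proof.
move=> gM; have [c1 c2 c3 c4] := continuous_boundary_sides.
have hseg x x' y t : x1 <= x <= x2 -> x1 <= x' <= x2 -> 0 <= t <= 1 ->
    exists2 v, x1 <= v <= x2 & seg_path (x +i* y) (x' +i* y) t = v +i* y.
  move=> xx xx' t01; exists ((1 - t) * x + t * x'); first exact: convex_comb_le.
  by apply: eq_ReIm; rewrite ?seg_path_Re ?seg_path_Im /=; ring.
have vseg x y y' t : y1 <= y <= y2 -> y1 <= y' <= y2 -> 0 <= t <= 1 ->
    exists2 v, y1 <= v <= y2 & seg_path (x +i* y) (x +i* y') t = x +i* v.
  move=> xx xx' t01; exists ((1 - t) * y + t * y'); first exact: convex_comb_le.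
  by apply: eq_ReIm; rewrite ?seg_path_Re ?seg_path_Im /=; ring.
have X1 : x1 <= x1 <= x2 by rewrite lexx x12.
have X2 : x1 <= x2 <= x2 by rewrite lexx x12.
have Y1 : y1 <= y1 <= y2 by rewrite lexx y12.
have Y2 : y1 <= y2 <= y2 by rewrite lexx y12.
have I1 : normc (line_integral g (x1 +i* y1) (x2 +i* y1)) <= 2 * M * (x2 - x1).
  have -> : x2 - x1 = normc (x2 +i* y1 - (x1 +i* y1)).
    rewrite (_ : _ - _ = (x2 - x1)%:C) ?normcR ?ger0_norm ?subr_ge0//.
    by apply: eq_ReIm; rewrite ?ReD ?ImD ?ReN ?ImN /=; ring.
  apply: normc_line_integral => // t t01.
  by have [v vv ->] := hseg _ _ y1 _ X1 X2 t01; have [/gM] := bh vv.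
have I2 : normc (line_integral g (x2 +i* y1) (x2 +i* y2)) <= 2 * M * (y2 - y1).
  have -> : y2 - y1 = normc (x2 +i* y2 - (x2 +i* y1)).
    rewrite (_ : _ - _ = (y2 - y1)%:C * 'i) ?normcM ?normci ?mulr1 ?normcR ?ger0_norm ?subr_ge0//.
    by apply: eq_ReIm; rewrite !(ReD, ImD, ReN, ImN, ReM, ImM) /=; ring.
  apply: normc_line_integral => // t t01.
  by have [v vv ->] := vseg x2 _ _ _ Y1 Y2 t01; have [_ /gM] := bv vv.
have I3 : normc (line_integral g (x2 +i* y2) (x1 +i* y2)) <= 2 * M * (x2 - x1).
  have -> : x2 - x1 = normc (x1 +i* y2 - (x2 +i* y2)).
    rewrite distc_sym (_ : _ - _ = (x2 - x1)%:C) ?normcR ?ger0_norm ?subr_ge0//.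
    by apply: eq_ReIm; rewrite ?ReD ?ImD ?ReN ?ImN /=; ring.
  apply: normc_line_integral => // t t01.
  by have [v vv ->] := hseg _ _ y2 _ X2 X1 t01; have [_ /gM] := bh vv.
have I4 : normc (line_integral g (x1 +i* y2) (x1 +i* y1)) <= 2 * M * (y2 - y1).
  have -> : y2 - y1 = normc (x1 +i* y1 - (x1 +i* y2)).
    rewrite distc_sym (_ : _ - _ = (y2 - y1)%:C * 'i) ?normcM ?normci ?mulr1 ?normcR ?ger0_norm ?subr_ge0//.
    by apply: eq_ReIm; rewrite !(ReD, ImD, ReN, ImN, ReM, ImM) /=; ring.
  apply: normc_line_integral => // t t01.
  by have [v vv ->] := vseg x1 _ _ _ Y2 Y1 t01; have [/gM] := bv vv.
have -> : 4 * M * (x2 - x1 + (y2 - y1)) = 2 * M * (x2 - x1) + 2 * M * (y2 - y1) +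
  2 * M * (x2 - x1) + 2 * M * (y2 - y1) by ring.
rewrite /rect_integral (le_trans (normcD _ _))// lerD//.
rewrite (le_trans (normcD _ _))// lerD//.
by rewrite (le_trans (normcD _ _))// lerD.
Qed.

(** The extreme value theorem on each of the four sides. *)
Lemma boundary_bounded : exists2 M : R, 0 <= M &
  forall z, boundary z -> normc (g z) <= M.
Proof.
have bnd (c : R -> C) a b : a <= b -> continuous c ->
    (forall t, a <= t <= b -> boundary (c t)) ->
    exists M : R, forall t, a <= t <= b -> normc (g (c t)) <= M.
  move=> ab cc cb.
  have gcc : {in `[a, b], continuous (fun t => g (c t))}.
    move=> t; rewrite in_itv/= => tab; apply: continuous_comp; first exact: cc.
    exact/gc/cb.
  have nc : {within `[a, b], continuous (fun t => `|Re (g (c t))| + `|Im (g (c t))|)}.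
    apply: continuous_in_subspaceT => t; rewrite inE => tab.
    apply: cvgD; apply: cvg_norm.
    - exact: (continuous_in_Re gcc).
    - exact: (continuous_in_Im gcc).
  have [t0 _ Ht0] := EVT_max ab nc.
  exists (`|Re (g (c t0))| + `|Im (g (c t0))|) => t tab.
  by rewrite (le_trans (normc_le_ReIm _))//; apply: Ht0; rewrite in_itv.
have ch (y : R) : continuous (fun x : R => x +i* y).
  move=> x; have D : path_derive (fun x : R => x +i* y) x 1.
    by split => /=; [exact: is_derive_id|exact: is_derive_cst].
  exact: path_derive_continuous D.
have cv (x : R) : continuous (fun y : R => x +i* y).
  by move=> y; exact: (path_derive_continuous (path_derive_vertical x y)).
have [M1 H1] := bnd _ _ _ x12 (ch y1) (fun x xx => (bh xx).1).
have [M2 H2] := bnd _ _ _ x12 (ch y2) (fun x xx => (bh xx).2).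
have [M3 H3] := bnd _ _ _ y12 (cv x1) (fun x xx => (bv xx).1).
have [M4 H4] := bnd _ _ _ y12 (cv x2) (fun x xx => (bv xx).2).
exists (Num.max 0 (Num.max (Num.max M1 M2) (Num.max M3 M4))); first by rewrite le_max lexx.
move=> [x y] [/andP[/= xx yy]].
have /andP[xl xr] := xx; have /andP[yl yr] := yy.
rewrite /inside /=; move: xl xr yl yr; rewrite 4!le_eqVlt.
move=> /predU1P[E|->]; first by rewrite !le_max -E H3 ?orbT.
move=> /predU1P[E|->]; first by rewrite !le_max E H4 ?orbT.
move=> /predU1P[E|->]; first by rewrite !le_max -E H1 ?orbT.
by move=> /predU1P[E|->//]; rewrite !le_max E H2 ?orbT.
Qed.

End Boundary.

Lemma rect_integralB g h x1 x2 y1 y2 :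
  continuous_seg_on g (x1 +i* y1) (x2 +i* y1) /\ continuous_seg_on h (x1 +i* y1) (x2 +i* y1) ->
  continuous_seg_on g (x2 +i* y1) (x2 +i* y2) /\ continuous_seg_on h (x2 +i* y1) (x2 +i* y2) ->
  continuous_seg_on g (x2 +i* y2) (x1 +i* y2) /\ continuous_seg_on h (x2 +i* y2) (x1 +i* y2) ->
  continuous_seg_on g (x1 +i* y2) (x1 +i* y1) /\ continuous_seg_on h (x1 +i* y2) (x1 +i* y1) ->
  rect_integral (fun z => g z - h z) x1 x2 y1 y2 =
  rect_integral g x1 x2 y1 y2 - rect_integral h x1 x2 y1 y2.
Proof.
move=> [g1 h1] [g2 h2] [g3 h3] [g4 h4]; rewrite /rect_integral.
rewrite (line_integralB g1 h1) (line_integralB g2 h2) (line_integralB g3 h3).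
rewrite (line_integralB g4 h4).
have E (a b c d a' b' c' d' : C) : a - a' + (b - b') + (c - c') + (d - d') =
  a + b + c + d - (a' + b' + c' + d') by ring.
exact: E.
Qed.

Lemma derivable_subr w z : derivable (fun v : C => v - w) z (1 : C).
Proof.
suff : is_derive z (1 : C) (fun v : C => v - w) 1 by case.
apply/cderiveP => e e0; exists 1 => // h _.
have -> : z + h - w - (z - w) - 1 * h = 0 by ring.
by rewrite normc0 mulr_ge0 ?normc_ge0// ltW.
Qed.

Lemma derivable_pole h w z : derivable h z (1 : C) -> z != w ->
  derivable (fun v => h v / (v - w)) z (1 : C).
Proof.
move=> dh zw; have zw0 : z - w != 0 by rewrite subr_eq0.
have dV := @derivableV C C (fun v => v - w) z 1 zw0 (@derivable_subr w z).
exact: (@derivableM C C h (fun v => (v - w)^-1) z 1 dh dV).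
Qed.

(** On a small circle [h] is close to [h w], and [1 / (z - w)] integrates to
    [2 pi i] over the circle. *)
Lemma residue_simple_pole h w (delta : R) : 0 < delta ->
  (forall z, normc (z - w) < delta -> derivable h z (1 : C)) ->
  residue (fun z => h z / (z - w)) w = h w.
Proof.
move=> d0 dh; pose g z := h z / (z - w).
have dg z : 0 < normc (z - w) < delta -> derivable g z (1 : C).
  move=> /andP[z0 zd]; apply: derivable_pole; first exact: dh.
  by rewrite -subr_eq0 -normc_gt0.
have [circ _] := residue_punctured d0 dg.
have hw : {for w, continuous h}.
  by apply/derivable_continuousc/dh; rewrite subrr normc0.
apply: (mulfI (two_pi_i_neq0 R)); apply/eqP; rewrite -subr_eq0.
suff : normc (two_pi_i R * residue g w - two_pi_i R * h w) <= 0.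
  move=> H; apply/eqP/Normc.eq0_normc/eqP; rewrite eq_le H; exact: normc_ge0.
apply/ler_addgt0Pr => e e0; rewrite add0r.
have pi0 : 0 < pi :> R := pi_gt0 R.
have e4 : 0 < e / (4 * pi) by rewrite divr_gt0// mulr_gt0.
have /nbhscP[r r0 Hr] := (cvgcP (nbhs_filter w) h (h w)).1 hw _ e4.
pose rho := Num.min r delta / 2.
have m0 : 0 < Num.min r delta by rewrite lt_min r0.
have rho0 : 0 < rho by rewrite divr_gt0.
have rhom : rho < Num.min r delta by rewrite /rho ltr_pdivrMr// ltr_pMr// ltr1n.
have [rhor rhod] : rho < r /\ rho < delta by move: rhom; rewrite lt_min => /andP[].
rewrite -(circ rho); last by rewrite rho0.
pose c t : C := w + rho%:C * (cos t +i* sin t).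
have cw t : normc (c t - w) = rho.
  by rewrite /c addrC addKr normcM normcR gtr0_norm//= cos2Dsin2 sqrtr1 mulr1.
have cE t : c t = w + cexp (ln rho +i* t) by rewrite cexp_polar.
have cc : continuous c.
  move=> t; apply: (@path_derive_continuous _ _ _ (cexp (ln rho +i* t) * 'i)).
  have D1 : is_derive (ln rho +i* t) (1 : C) (fun v => w + cexp v) (cexp (ln rho +i* t)).
    have := is_deriveD (is_derive_cst w (ln rho +i* t) (1 : C)) (is_derive_cexp (ln rho +i* t)).
    by rewrite add0r.
  have := path_derive_comp (path_derive_vertical (ln rho) t) D1.
  by congr path_derive; apply/funext => s; rewrite /= -cE.
have hc : {in `[0, 2 * pi], continuous (fun t => 'i * h (c t))}.
  move=> t _; apply: cvgM; first exact: cvg_cst.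
  apply: continuous_comp; first exact: cc.
  by apply/derivable_continuousc/dh; rewrite cw.
have kc : {in `[0, 2 * pi], continuous (fun t : R => 'i * h w)}.
  by move=> t _; exact: cvg_cst.
have pi20 : 0 <= 2 * pi :> R by rewrite mulr_ge0// ltW.
have -> : circle_integral g w rho = cintegral `[0, 2 * pi] (fun t => 'i * h (c t)).
  apply: eq_cintegral => t _; rewrite /g -/(c t).
  have -> : c t - w = rho%:C * (cos t +i* sin t) by rewrite /c addrC addKr.
  have : rho%:C * (cos t +i* sin t) != 0 :> C.
    by rewrite -cexp_polar// cexp_neq0.
  rewrite mulf_eq0 negb_or => /andP[n1 n2].
  by field; rewrite n1 n2.
have -> : two_pi_i R * h w = cintegral `[0, 2 * pi] (fun t => 'i * h w).
  rewrite /two_pi_i; apply: eq_ReIm; rewrite /= Rintegral_cst//= lebesgue_measure_itv/= lte_fin mulr_gt0//= subr0.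
    by rewrite !(ReM, ImM) /=; ring.
  by rewrite !(ReM, ImM) /=; ring.
rewrite -(cintegralB (measurable_itv _) (continuous_cintegrable hc)
  (continuous_cintegrable kc)).
have := @normc_cintegral_seg _ 0 (2 * pi) (fun t => 'i * h (c t) - 'i * h w) _ (e / (4 * pi)) pi20.
have pin0 : (pi : R) != 0 by rewrite gt_eqF.
have E (x p : R) : p != 0 -> 2 * (x / (4 * p)) * (2 * p - 0) = x.
  by move=> p0; field.
rewrite E//; apply.
- by move=> t tt; apply: cvgB; [exact: hc|exact: kc].
- move=> t _; rewrite -mulrBr normcM normci mul1r distc_sym ltW//.
  by apply: Hr; rewrite cw.
Qed.

Theorem Cauchy_formula_rect h w x1 x2 y1 y2 :
  (forall z, cbox (x1 +i* y1) (x2 +i* y2) z -> derivable h z (1 : C)) ->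
  inside x1 x2 y1 y2 w ->
  rect_integral (fun z => h z / (z - w)) x1 x2 y1 y2 = two_pi_i R * h w.
Proof.
move=> dh win; have /andP[/andP[x1w wx2] /andP[y1w wy2]] := win.
have A : admissible (fun z => h z / (z - w)) [:: w] x1 x2 y1 y2.
  split; [exact/ltW/(lt_trans x1w)|exact/ltW/(lt_trans y1w)| |].
    by move=> p; rewrite inE => /eqP ->.
  by move=> z zb; rewrite inE => zw; apply: derivable_pole => //; exact: dh.
have := rect_residue_theorem (s := [:: w]) isT A.
rewrite /residue_formula big_cons win big_nil addr0 => ->; congr (_ * _).
pose d := Num.min (Num.min (Re w - x1) (x2 - Re w)) (Num.min (Im w - y1) (y2 - Im w)).
apply: (@residue_simple_pole h w d); first by rewrite !lt_min !subr_gt0 x1w wx2 y1w.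
move=> z zd; apply: dh.
have [dx1 dx2 dy1 dy2] : [/\ d <= Re w - x1, d <= x2 - Re w, d <= Im w - y1 &
    d <= y2 - Im w] by split; rewrite !ge_min lexx ?orbT.
have := le_lt_trans (le_normc_Re _) zd; have := le_lt_trans (le_normc_Im _) zd.
rewrite ReD ImD ReN ImN !ltr_norml /cbox /= => /andP[i1 i2] /andP[r1 r2].
by apply/andP; split; apply/andP; split; lra.
Qed.

End CauchyFormula.

(** * The identity theorem on half planes *)

Section IdentityTheorem.
Variable R : realType.
Local Notation C := R[i].
Implicit Types (z w p q : C) (g h : C -> C).

Lemma geometric_le0 (X K q : R) : 0 <= q < 1 ->
  (forall k : nat, X <= K * q ^+ k) -> X <= 0.
Proof.
move=> /andP[q0 q1] H.
have cK : (fun k => K * q ^+ k) @ \oo --> K * 0.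
  by apply: cvgM; [exact: cvg_cst|apply: cvg_expr; rewrite ger0_norm].
rewrite mulr0 in cK.
have H' : \forall k \near \oo, X <= K * q ^+ k by exact: nearW.
have := limr_ge (cvgP _ cK) H'.
by rewrite (cvg_lim _ cK)//; apply; exact: eventually_filter.
Qed.

Lemma derivable_subX p z k : derivable (fun v => (v - p) ^+ k) z (1 : C).
Proof.
elim: k => [|k IH].
  have -> : (fun v => (v - p) ^+ 0) = cst (1 : C).
    by apply/funext => v; rewrite expr0.
  exact: derivable_cst.
have -> : (fun v => (v - p) ^+ k.+1) = (fun v => (v - p) * (v - p) ^+ k).
  by apply/funext => v; rewrite exprS.
exact: (@derivableM C C (fun v => v - p) (fun v => (v - p) ^+ k) z 1
  (@derivable_subr _ p z) IH).
Qed.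

(** If [H] vanishes near [p], then [H z / (z - p) ^+ k] is holomorphic for every
    [k]; letting [k] tend to infinity in its Cauchy formula on a square centred at
    [p] shows that [H] vanishes on the disc inscribed in the square.  Since [p]
    may be taken far to the right, at the height of [w], a single square reaches
    [w], and no chain of discs is needed. *)
Theorem identity_halfplane (H : C -> C) (a c : R) :
  (forall z, a < Re z -> derivable H z (1 : C)) ->
  (forall z, c < Re z -> H z = 0) ->
  forall w, a < Re w -> H w = 0.
Proof.
move=> dH H0 w aw.
(* the square centred at p, of half-side rho, reaches beyond w by eta *)
pose P := Num.max (c + 1) (Re w + 1).
have [Pc Pw] : c + 1 <= P /\ Re w + 1 <= P by rewrite !le_max !lexx orbT.
pose p : C := P +i* Im w.
pose eta := (Re w - a) / 2.
have eta0 : 0 < eta by rewrite divr_gt0// subr_gt0.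
pose r := P - Re w; pose rho := r + eta.
have r1 : 1 <= r by rewrite /r; lra.
have rho0 : 0 < rho by rewrite /rho; lra.
have pw : normc (w - p) = r.
  rewrite distc_sym; have -> : p - w = r%:C.
    by apply: eq_ReIm; rewrite ?ReD ?ImD ?ReN ?ImN //= subrr.
  by rewrite normcR ger0_norm//; lra.
pose x1 := P - rho; pose x2 := P + rho.
pose y1 := Im w - rho; pose y2 := Im w + rho.
have ax1 : a < x1 by rewrite /x1 /rho /r /eta; lra.
have x12 : x1 <= x2 by rewrite /x1 /x2; lra.
have y12 : y1 <= y2 by rewrite /y1 /y2; lra.
have win : inside x1 x2 y1 y2 w.
  by rewrite /inside /x1 /x2 /y1 /y2 /rho /r; apply/andP; split; apply/andP; split; lra.
have box_a z : cbox (x1 +i* y1) (x2 +i* y2) z -> a < Re z.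
  by move=> /andP[/= /andP[h _] _]; exact: lt_le_trans h.
have far z : cbox (x1 +i* y1) (x2 +i* y2) z -> ~~ inside x1 x2 y1 y2 z ->
    rho <= normc (z - p).
  move=> zb zi; rewrite leNgt; apply: contra zi => zp.
  have := le_lt_trans (le_normc_Re _) zp; have := le_lt_trans (le_normc_Im _) zp.
  rewrite ReD ImD ReN ImN !ltr_norml /= => /andP[i1 i2] /andP[r2 r3].
  by rewrite /inside /x1 /x2 /y1 /y2; apply/andP; split; apply/andP; split; lra.
have far_w z : rho <= normc (z - p) -> eta <= normc (z - w).
  move=> zp; have := normcD (z - w) (w - p); rewrite addrA subrK pw.
  by move: zp; rewrite /rho; lra.
have [M M0 HM] : exists2 M : R, 0 <= M & forall z,
    cbox (x1 +i* y1) (x2 +i* y2) z /\ ~~ inside x1 x2 y1 y2 z -> normc (H z) <= M.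
  apply: boundary_bounded => // z [zb _].
  exact/derivable_continuousc/dH/box_a.
pose h k z := H z / (z - p) ^+ k.
have dh k z : cbox (x1 +i* y1) (x2 +i* y2) z -> derivable (h k) z (1 : C).
  move=> zb; have [->|zp] := eqVneq z p.
    suff : is_derive p (1 : C) (h k) 0 by case.
    apply/cderiveP => e e0; exists (P - c); first by lra.
    move=> v vP; have Hv : H (p + v) = 0.
      apply: H0; rewrite ReD /=.
      by have := le_lt_trans (le_normc_Re _) vP; rewrite ltr_norml => /andP[]; lra.
    have Hp : H p = 0 by apply: H0 => /=; lra.
    by rewrite /h Hv Hp !mul0r subrr subr0 normc0 mulr_ge0 ?normc_ge0// ltW.
  have zp0 : (z - p) ^+ k != 0 by rewrite expf_neq0// subr_eq0.
  have dV := @derivableV C C (fun v => (v - p) ^+ k) z 1 zp0 (@derivable_subX p z k).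
  exact: (@derivableM C C H (fun v => ((v - p) ^+ k)^-1) z 1 (dH z (box_a z zb)) dV).
have pi0 : 0 < pi :> R := pi_gt0 R.
pose K := 16 * M * rho / (eta * (2 * pi)).
have key k : normc (H w) <= K * (r / rho) ^+ k.
  have E := Cauchy_formula_rect (dh k) win.
  have cont z : cbox (x1 +i* y1) (x2 +i* y2) z /\ ~~ inside x1 x2 y1 y2 z ->
      {for z, continuous (fun z => h k z / (z - w))}.
    move=> [zb zi]; apply/derivable_continuousc/derivable_pole; first exact: dh.
    by apply: contraNneq zi => ->.
  have bnd z : cbox (x1 +i* y1) (x2 +i* y2) z /\ ~~ inside x1 x2 y1 y2 z ->
      normc (h k z / (z - w)) <= M / rho ^+ k / eta.
    move=> zbi; have [zb zi] := zbi; have fz := far _ zb zi.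
    rewrite /h !normcM !normcV normcX; apply: ler_pM.
    - by rewrite mulr_ge0 ?invr_ge0 ?exprn_ge0 ?normc_ge0.
    - by rewrite invr_ge0 normc_ge0.
    - apply: ler_pM; rewrite ?invr_ge0 ?exprn_ge0 ?normc_ge0//; first exact: HM.
      rewrite lef_pV2 ?posrE ?exprn_gt0//; last exact: lt_le_trans fz.
      by rewrite lerXn2r ?nnegrE ?normc_ge0// ltW.
    - by rewrite lef_pV2 ?posrE//; [exact: far_w|exact: lt_le_trans (far_w _ fz)].
  have := normc_rect_integral x12 y12 cont bnd.
  rewrite E normcM /two_pi_i normcM normci mulr1 normcR gtr0_norm ?mulr_gt0//.
  rewrite /h normcM normcV normcX pw.
  have -> : x2 - x1 + (y2 - y1) = 4 * rho by rewrite /x1 /x2 /y1 /y2; ring.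
  have r0 : 0 < r by lra.
  rewrite -ler_pdivlMl ?mulr_gt0// -ler_pdivlMr ?invr_gt0 ?exprn_gt0//.
  move=> /le_trans; apply; rewrite le_eqVlt; apply/orP; left; apply/eqP.
  rewrite /K; have E2 (q : R) : q != 0 ->
      (2 * q)^-1 * (4 * (M / rho ^+ k / eta) * (4 * rho)) / (r ^+ k)^-1 =
      16 * M * rho / (eta * (2 * q)) * (r / rho) ^+ k.
    move=> q0; rewrite expr_div_n; field.
    by rewrite q0 (gt_eqF eta0) !expf_neq0 ?(gt_eqF r0) ?(gt_eqF rho0).
  by rewrite E2// gt_eqF.
have : normc (H w) <= 0.
  apply: (geometric_le0 (q := r / rho)) key.
  rewrite divr_ge0 ?(ltW rho0) ?ltr_pdivrMr ?mul1r//=; rewrite /rho; lra.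
by move=> Hw; apply/Normc.eq0_normc/eqP; rewrite eq_le Hw normc_ge0.
Qed.

End IdentityTheorem.

(** * Holomorphy of the transform *)

Section LaplaceTransform.
Variable R : realType.
Local Notation C := R[i].
Local Notation mu := (@lebesgue_measure R).
Implicit Types (y z w : C).

Lemma measurable_fun_continuousc (D : set (measurableTypeR R)) (p : R -> C) :
  measurable D -> continuous p ->
  measurable_fun D (fun x => Re (p x)) /\ measurable_fun D (fun x => Im (p x)).
Proof.
move=> mD pc; split; apply: measurable_funS (@measurableT _ _) (@subsetT _ _) _.
- apply: continuous_measurable_fun => x.
  apply: continuous_comp; [exact: pc|exact: continuous_Re].
- apply: continuous_measurable_fun => x.
  apply: continuous_comp; [exact: pc|exact: continuous_Im].
Qed.

Lemma cintegrable_measurable (D : set (measurableTypeR R)) (g : R -> C) :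
  cintegrable D g ->
  measurable_fun D (fun x => Re (g x)) /\ measurable_fun D (fun x => Im (g x)).
Proof.
by move=> [/integrableP[/measurable_EFinP mr _] /integrableP[/measurable_EFinP mi _]].
Qed.

Lemma cintegrableM (D : set (measurableTypeR R)) (p g : R -> C) (K : R) :
  measurable D -> continuous p -> 0 <= K -> (forall x, D x -> normc (p x) <= K) ->
  cintegrable D g -> cintegrable D (fun x => p x * g x).
Proof.
move=> mD pc K0 pK gi.
have [pr pi] := measurable_fun_continuousc mD pc.
have [gr gi'] := cintegrable_measurable gi.
apply: (@cintegrable_le _ D _ (fun x => K * normc (g x)) mD).
- apply: (eq_measurable_fun (fun x => Re (p x) * Re (g x) - Im (p x) * Im (g x))).
    by move=> x _; rewrite ReM.
  by apply: measurable_funB; exact: measurable_funM.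
- apply: (eq_measurable_fun (fun x => Re (p x) * Im (g x) + Im (p x) * Re (g x))).
    by move=> x _; rewrite ImM.
  by apply: measurable_funD; exact: measurable_funM.
- have := integrableZl mD K (cintegrable_normc mD gi).
  by apply: eq_integrable.
- by move=> x Dx; rewrite normcM ler_wpM2r ?normc_ge0//; exact: pK.
Qed.

(** The integrand of the L_n-transform, with y^(1/n) in place of y. *)
Definition laplace_integrand n (f : R -> C) y (x : R) : C :=
  (x ^+ n.-1)%:C * cexp (- ((x ^+ n)%:C * y)) * f x.

Lemma Ln_integrand_root n f y : (0 < n)%N ->
  Ln_integrand n f (n.-root y) = laplace_integrand n f y.
Proof. by move=> n0; apply/funext => x; rewrite /Ln_integrand rootCK. Qed.

Lemma continuous_pow_cexp n w :
  continuous (fun x : R => cexp (- ((x ^+ n)%:C * w))).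
Proof.
move=> x; apply: (@continuous_comp _ _ _ (fun t : R => - ((t ^+ n)%:C * w)) (@cexp R)).
  apply: (@cvgN C C); apply: (@cvgM C); last exact: cvg_cst.
  apply: continuous_comp; last exact: continuous_RtoC.
  exact: exprn_continuous.
exact: (is_derive_continuousc (is_derive_cexp _)).
Qed.

Lemma normc_pow_cexp n w (x : R) :
  normc (cexp (- ((x ^+ n)%:C * w))) = expR (- (x ^+ n * Re w)).
Proof. by rewrite normc_cexp ReN ReMr. Qed.

Lemma mul_expRN_le (p r : R) : 0 < r -> p * expR (- (p * r)) <= r^-1.
Proof.
move=> r0; rewrite expRN ler_pdivrMr ?expR_gt0// mulrC -ler_pdivrMr ?invr_gt0//.
by rewrite invrK; exact: x_le_expR.
Qed.

Section Transform.
Variables (n : nat) (f : R -> C) (a : R).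
Local Notation D := `]0, +oo[%classic.
Hypothesis conv : cintegrable D (laplace_integrand n f a%:C).
Let G y := cintegral D (laplace_integrand n f y).
Let A := \int[mu]_(x in D) normc (laplace_integrand n f a%:C x).

Let mD : measurable (D : set (measurableTypeR R)).
Proof. exact: measurable_itv. Qed.

Let D_gt0 (x : R) : D x -> 0 < x.
Proof. by rewrite /= in_itv/= andbT. Qed.

Lemma laplace_integrand_shift y x : laplace_integrand n f y x =
  cexp (- ((x ^+ n)%:C * (y - a%:C))) * laplace_integrand n f a%:C x.
Proof.
rewrite /laplace_integrand.
have -> : - ((x ^+ n)%:C * y) = - ((x ^+ n)%:C * (y - a%:C)) + - ((x ^+ n)%:C * a%:C).
  by ring.
rewrite cexpD; have E (u v w t : C) : u * (v * w) * t = v * (u * w * t) by ring.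
exact: E.
Qed.

Lemma weight_le1 y x : a <= Re y -> D x ->
  normc (cexp (- ((x ^+ n)%:C * (y - a%:C)))) <= 1.
Proof.
move=> ay /D_gt0 x0; rewrite normc_pow_cexp ReD ReN.
by rewrite -expR0 ler_expR oppr_le0 mulr_ge0 ?subr_ge0// exprn_ge0// ltW.
Qed.

Lemma cintegrable_laplace y : a <= Re y -> cintegrable D (laplace_integrand n f y).
Proof.
move=> ay.
have := cintegrableM mD (@continuous_pow_cexp n (y - a%:C)) ler01
  (fun x Dx => weight_le1 ay Dx) conv.
by apply: eq_cintegrable => // x _; rewrite -laplace_integrand_shift.
Qed.

Lemma normc_laplace_le y x : a <= Re y -> D x ->
  normc (laplace_integrand n f y x) <= normc (laplace_integrand n f a%:C x).
Proof.
move=> ay Dx; rewrite laplace_integrand_shift normcM.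
by rewrite ler_piMl ?normc_ge0// weight_le1.
Qed.

Lemma laplace_bounded y : a <= Re y -> normc (G y) <= 2 * A.
Proof.
move=> ay; apply: normc_cintegral_le => //; first exact: cintegrable_laplace.
  exact: cintegrable_normc.
by move=> x Dx; exact: normc_laplace_le.
Qed.

(** The second-order remainder of the exponential under the integral sign is
    dominated by an integrable function, up to the factor [normc h ^+ 2]. *)
Lemma derivable_laplace y : a < Re y -> derivable G y (1 : C).
Proof.
move=> ay; pose d := (Re y - a) / 2.
have d0 : 0 < d by rewrite divr_gt0// subr_gt0.
have A0 : 0 <= A by apply: Rintegral_ge0 => x _; exact: normc_ge0.
pose v (x : R) : C := (x ^+ n)%:C.
pose E x := laplace_integrand n f a%:C x.
have Di : cintegrable D (fun x => v x * laplace_integrand n f y x).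
  pose p x := v x * cexp (- (v x * (y - a%:C))).
  have pc : continuous p.
    move=> x; apply: (@cvgM C); last exact: continuous_pow_cexp.
    apply: continuous_comp; last exact: continuous_RtoC.
    exact: exprn_continuous.
  have pK x : D x -> normc (p x) <= d^-1.
    move=> Dx; apply: le_trans (mul_expRN_le (x ^+ n) d0); rewrite /p normcM normc_pow_cexp normcR.
    have x0 := D_gt0 Dx.
    rewrite ger0_norm ?exprn_ge0 ?(ltW x0)// ler_wpM2l ?exprn_ge0 ?(ltW x0)//.
    rewrite ler_expR lerN2 ler_wpM2l ?exprn_ge0 ?(ltW x0)//.
    by rewrite ReD ReN /= /d; lra.
  have d10 : 0 <= d^-1 by rewrite invr_ge0 ltW.
  have := cintegrableM mD pc d10 pK conv.
  apply: eq_cintegrable => // x _; rewrite /p -mulrA.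
  by rewrite -laplace_integrand_shift.
suff : is_derive y (1 : C) G (- cintegral D (fun x => v x * laplace_integrand n f y x)) by case.
apply/cderiveP => e e0.
pose K := 2 * (4 * (4 / d ^+ 2)) * A + 1.
have K0 : 0 < K.
  by rewrite ltr_wpDl// mulr_ge0// !mulr_ge0// ?invr_ge0 ?exprn_ge0// ltW.
exists (Num.min (d / 2) (e / K)).
  by rewrite lt_min (divr_gt0 e0 K0) andbT (divr_gt0 d0).
move=> h; rewrite lt_min => /andP[hd hK].
have ayh : a <= Re (y + h).
  have := le_lt_trans (le_normc_Re h) hd; rewrite ltr_norml ReD => /andP[h1 _].
  by move: h1; rewrite /d; lra.
have i1 := cintegrable_laplace ayh; have i2 := cintegrable_laplace (ltW ay).
have i3 := cintegrableZ h mD Di.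
have -> : G (y + h) - G y - - cintegral D (fun x => v x * laplace_integrand n f y x) * h =
    cintegral D (fun x => laplace_integrand n f (y + h) x - laplace_integrand n f y x -
      (- h) * (v x * laplace_integrand n f y x)).
  have i12 := cintegrableB mD i1 i2.
  have i3' := cintegrableZ (- h) mD Di.
  rewrite (cintegralB mD i12 i3') (cintegralB mD i1 i2) (cintegralZ _ mD Di).
  by rewrite mulNr mulNr [_ * h]mulrC.
have rem x : D x -> normc (laplace_integrand n f (y + h) x - laplace_integrand n f y x -
      (- h) * (v x * laplace_integrand n f y x)) <=
    4 * (4 / d ^+ 2) * normc h ^+ 2 * normc (E x).
  move=> Dx; have x0 := D_gt0 Dx.
  have v0 : 0 <= x ^+ n by rewrite exprn_ge0// ltW.
  have -> : laplace_integrand n f (y + h) x - laplace_integrand n f y x -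
      (- h) * (v x * laplace_integrand n f y x) =
      (cexp (- (v x * h)) - 1 - - (v x * h)) * laplace_integrand n f y x.
    have -> : laplace_integrand n f (y + h) x = cexp (- (v x * h)) * laplace_integrand n f y x.
      rewrite /laplace_integrand mulrDr opprD cexpD.
      have E4 (p q r t : C) : p * (q * r) * t = r * (p * q * t) by ring.
      exact: E4.
    have E5 (p q r t : C) : p * t - t - (- q) * (r * t) = (p - 1 - - (r * q)) * t by ring.
    exact: E5.
  rewrite normcM laplace_integrand_shift normcM normc_pow_cexp mulrA.
  rewrite ler_wpM2r ?normc_ge0//.
  have := normc_cexpB1B (- (v x * h)); rewrite normcN normcM normcR (ger0_norm v0).
  set V := x ^+ n in v0 *; set H := normc h => hb.
  have H0 : 0 <= H := normc_ge0 _.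
  have yE : Re (y - a%:C) = 2 * d by rewrite ReD ReN /= /d; lra.
  rewrite yE; apply: (le_trans (ler_wpM2r (expR_ge0 _) hb)).
  have -> : 4 * ((V * H) ^+ 2 * expR (V * H)) * expR (- (V * (2 * d))) =
    4 * H ^+ 2 * (V ^+ 2 * (expR (V * H) * expR (- (V * (2 * d))))) by ring.
  have -> : 4 * (4 / d ^+ 2) * H ^+ 2 = 4 * H ^+ 2 * (4 / d ^+ 2) by ring.
  rewrite ler_wpM2l ?mulr_ge0 ?exprn_ge0// -expRD.
  apply: (@le_trans _ _ (V ^+ 2 * expR (- (V * d)))).
    apply: ler_wpM2l; first by rewrite exprn_ge0.
    rewrite ler_expR.
    have gen (p q r : R) : 0 <= p -> q < r / 2 -> 0 < r ->
        p * q + - (p * (2 * r)) <= - (p * r) by move=> *; nra.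
    exact: gen.
  (* the square of v e^(-v d/2) <= 2 / d *)
  have -> : V ^+ 2 * expR (- (V * d)) = (V * expR (- (V * (d / 2)))) ^+ 2.
    by rewrite exprMn (expr2 (expR _)) -expRD; congr (_ * expR _); lra.
  have gen2 (r : R) : 4 / r ^+ 2 = (2 / r) ^+ 2 by rewrite expr_div_n -natrX.
  rewrite gen2.
  rewrite lerXn2r ?nnegrE ?mulr_ge0 ?expR_ge0 ?invr_ge0 ?(ltW d0)//.
  have gen3 (r : R) : (r / 2)^-1 = 2 / r by rewrite invf_div.
  by rewrite -gen3; apply: mul_expRN_le; rewrite (divr_gt0 d0).
have ri := integrableZl mD (4 * (4 / d ^+ 2) * normc h ^+ 2) (cintegrable_normc mD conv).
have rc : cintegrable D (fun x => laplace_integrand n f (y + h) x - laplace_integrand n f y x -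
      (- h) * (v x * laplace_integrand n f y x)).
  exact: (cintegrableB mD (cintegrableB mD i1 i2) (cintegrableZ (- h) mD Di)).
apply: (le_trans (normc_cintegral_le mD rc ri rem)).
rewrite RintegralZl//; last exact: cintegrable_normc.
rewrite -/A.
have -> : 2 * (4 * (4 / d ^+ 2) * normc h ^+ 2 * A) = 2 * (4 * (4 / d ^+ 2)) * A * normc h * normc h.
  by ring.
rewrite ler_wpM2r ?normc_ge0//; apply: (@le_trans _ _ (K * normc h)).
  by rewrite ler_wpM2r ?normc_ge0// /K lerDl.
by rewrite mulrC -ler_pdivlMr// ltW.
Qed.

End Transform.
End LaplaceTransform.

(** * Principal parts and Liouville's theorem *)

Section PrincipalPart.
Variable R : realType.
Local Notation C := R[i].
Implicit Types (y z w : C).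

Section Singularities.
Variables (F : C -> C) (a : R) (m : nat) (y_ : 'I_m -> C).
Hypothesis y_inj : injective y_.
Hypothesis F_analytic :
  forall y, (forall j, y <> y_ j) -> derivable F y (1 : C).
Hypothesis y_left : forall j, Re (y_ j) < a.
Let B := bound_y a y_.

(** The value at [y], for [Re y > a], of the sum of the principal parts of [F] at
    its singularities: [F z / (z - y)] is integrated around all of them, but not
    around [y]. *)
Definition principal_part y : C :=
  - ((two_pi_i R)^-1 * rect_integral (fun z => F z / (z - y)) (- B) a (- B) B).

Lemma derivable_right z : a <= Re z -> derivable F z (1 : C).
Proof.
by move=> az; apply: F_analytic => j zj; have := y_left j; rewrite -zj ltNge az.
Qed.

Let s := [seq y_ j | j <- enum 'I_m].

(** The residue theorem for [F z / (z - y)] on a square that contains [y] and all the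
    singularities: the residue at [y] is [F y], the others sum up to
    [- principal_part y]. *)
Lemma regular_part y (T : R) : a < Re y -> B <= T -> normc y < T ->
  admissible (fun z => F z / (z - y)) (y :: s) (- T) T (- T) T /\
  F y - principal_part y =
  (two_pi_i R)^-1 * rect_integral (fun z => F z / (z - y)) (- T) T (- T) T.
Proof.
move=> ay BT yT; pose g z := F z / (z - y).
have T0 : 0 < T := lt_le_trans (bound_y_gt0 a y_) BT.
have TT : - T <= T by rewrite ge0_cp// ltW.
have in_square p : normc p < T -> inside (- T) T (- T) T p.
  move=> pT; have := le_lt_trans (le_normc_Re _) pT.
  have := le_lt_trans (le_normc_Im _) pT.
  by rewrite !ltr_norml /inside => -> ->.
have all_in p : p \in y :: s -> inside (- T) T (- T) T p.
  rewrite inE => /predU1P[->|/mapP[j _ ->]]; first exact: in_square.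
  by apply: in_square; apply: lt_le_trans BT; exact: bound_y_gt.
have A : admissible g (y :: s) (- T) T (- T) T.
  split => // [p ps _|z _]; first exact: all_in.
  rewrite inE negb_or => /andP[zy zs]; apply: derivable_pole => //.
  exact: (derivable_off_singularities F_analytic).
split => //.
have ys : y \notin s.
  by apply/negP => /mapP[j _ yE]; have := y_left j; rewrite -yE ltNge ltW.
have us : uniq (y :: s) by rewrite /= ys (uniq_singularities y_inj).
have := rect_residue_theorem us A.
rewrite /residue_formula big_cons all_in ?inE ?eqxx// => ->.
have -> : residue g y = F y.
  apply: (@residue_simple_pole _ F y (Re y - a)); first by rewrite subr_gt0.
  move=> z zy; apply: derivable_right.
  by have := le_lt_trans (le_normc_Re _) zy; rewrite ReD ReN ltr_norml => /andP[]; lra.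
have -> : \sum_(p <- s | inside (- T) T (- T) T p) residue g p =
    \sum_(j < m) residue g (y_ j).
  rewrite big_seq_cond (eq_bigl (fun p => p \in s)) -?big_seq ?big_map ?big_enum//.
  by move=> p; case ps : (p \in s) => //=; apply: all_in; rewrite inE ps orbT.
have E : rect_integral g (- B) a (- B) B = two_pi_i R * \sum_(j < m) residue g (y_ j).
  apply: (rect_residues y_inj F_analytic y_left (lexx _)) => z za dF.
  apply: derivable_pole => //; apply/eqP => zy; move: za; rewrite zy leNgt.
  by rewrite ay.
by rewrite /principal_part E opprK !mulKf ?two_pi_i_neq0.
Qed.

(** A bounded entire function is constant; here the difference of [F] and its
    principal parts. *)
Lemma regular_part_constant (M M0 : R) y1 y2 :
  (forall z, M0 <= normc z -> normc (F z) <= M) ->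
  a < Re y1 -> a < Re y2 ->
  F y1 - principal_part y1 = F y2 - principal_part y2.
Proof.
move=> FM ay1 ay2.
pose T0 := Num.max (Num.max B M0) (Num.max (2 * normc y1 + 1) (2 * normc y2 + 1)).
have nn := @normc_ge0 R.
have key T : T0 <= T -> normc (F y1 - principal_part y1 - (F y2 - principal_part y2))
    <= normc (two_pi_i R)^-1 * (64 * M * normc (y1 - y2)) / T.
  rewrite !ge_max => /andP[/andP[BT M0T] /andP[yT1 yT2]].
  have T0' : 0 < T := lt_le_trans (bound_y_gt0 a y_) BT.
  have y1T : normc y1 < T by have := nn y1; lra.
  have y2T : normc y2 < T by have := nn y2; lra.
  have [A1 ->] := regular_part ay1 BT y1T.
  have [A2 ->] := regular_part ay2 BT y2T.
  have TT : - T <= T by rewrite ge0_cp// ltW.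
  have [c1 c2 c3 c4] := continuous_boundary_sides TT TT
    (fun z zb => admissible_continuous A1 zb.1 zb.2).
  have [d1 d2 d3 d4] := continuous_boundary_sides TT TT
    (fun z zb => admissible_continuous A2 zb.1 zb.2).
  rewrite -mulrBr -(rect_integralB (conj c1 d1) (conj c2 d2) (conj c3 d3) (conj c4 d4)).
  rewrite normcM -mulrA; apply: (ler_wpM2l (nn _)).
  (* g z is F z (y1 - y2) / ((z - y1) (z - y2)), of order T^-2 on a boundary
     of length 8 T *)
  pose g z := F z / (z - y1) - F z / (z - y2).
  have gc z : cbox ((- T) +i* (- T)) (T +i* T) z /\ ~~ inside (- T) T (- T) T z ->
      {for z, continuous g}.
    move=> [zb zi]; have h1 := admissible_continuous A1 zb zi.
    have h2 := admissible_continuous A2 zb zi.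
    exact: (@cvgB C C _ _ _ (fun z => F z / (z - y1)) (fun z => F z / (z - y2)) _ _ h1 h2).
  have M0' : 0 <= M.
    by apply: le_trans (FM T%:C _); rewrite ?normcR ?gtr0_norm.
  have gM z : cbox ((- T) +i* (- T)) (T +i* T) z /\ ~~ inside (- T) T (- T) T z ->
      normc (g z) <= M * normc (y1 - y2) * (4 / T ^+ 2).
    move=> [zb zi].
    have zT : T <= normc z.
      rewrite leNgt; apply: contra zi => zT.
      have := le_lt_trans (le_normc_Re _) zT.
      have := le_lt_trans (le_normc_Im _) zT.
      by rewrite !ltr_norml /inside => -> ->.
    have far v : 2 * normc v + 1 <= T -> T / 2 <= normc (z - v).
      move=> vT; have := normcD (z - v) v; rewrite subrK => zv.
      by lra.
    have f1 := far _ yT1; have f2 := far _ yT2.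
    have T2 : 0 < T / 2 by rewrite divr_gt0.
    have n1 : z - y1 != 0 by rewrite -normc_gt0 (lt_le_trans T2).
    have n2 : z - y2 != 0 by rewrite -normc_gt0 (lt_le_trans T2).
    have -> : g z = F z * (y1 - y2) / ((z - y1) * (z - y2)).
      by rewrite /g; field; rewrite n1 n2.
    rewrite !normcM normcV normcM; apply: ler_pM.
    - by rewrite mulr_ge0.
    - by rewrite invr_ge0 mulr_ge0.
    - by rewrite ler_wpM2r//; apply: FM; exact: le_trans zT.
    - have -> : 4 / T ^+ 2 = (T / 2 * (T / 2))^-1.
        by field; rewrite gt_eqF.
      rewrite lef_pV2 ?posrE ?mulr_gt0//; first by rewrite ler_pM// ltW.
      + exact: lt_le_trans f1.
      + exact: lt_le_trans f2.
  have := normc_rect_integral TT TT gc gM.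
  move=> /le_trans; apply; rewrite le_eqVlt; apply/orP; left; apply/eqP.
  by field; rewrite gt_eqF.
apply/eqP; rewrite -subr_eq0; apply/eqP/Normc.eq0_normc/eqP.
rewrite eq_le nn andbT; apply/ler_addgt0Pr => e e0; rewrite add0r.
set K := normc (two_pi_i R)^-1 * (64 * M * normc (y1 - y2)) in key.
pose T := Num.max (Num.max T0 1) (K / e).
have T1 : 0 < T by rewrite /T !lt_max ltr01 orbT.
have TT0 : T0 <= T by rewrite le_max le_max lexx.
have TKe : K / e <= T by rewrite le_max lexx orbT.
by rewrite (le_trans (key T TT0))// ler_pdivrMr// mulrC -ler_pdivrMr.
Qed.

Section Continuation.
Variables (n : nat) (f : R -> C).
Hypothesis n0 : (0 < n)%N.
Hypothesis Fc : Ln_continuation n f F.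
Hypothesis conv : cintegrable `]0, +oo[ (laplace_integrand n f a%:C).

(** The half plane on which [F] is known to be the transform may be far to the
    right; the identity theorem brings the equality up to the line [Re y = a]. *)
Lemma continuation_transform y : a < Re y ->
  F y = cintegral `]0, +oo[ (laplace_integrand n f y).
Proof.
have [c Fc'] := Fc; pose G v := cintegral `]0, +oo[ (laplace_integrand n f v).
move=> ay; pose H v := F v - G v.
have dH v : a < Re v -> derivable H v (1 : C).
  move=> av; have dF := derivable_right (ltW av).
  exact: (@derivableB C C C F G v 1 dF (derivable_laplace conv av)).
have H0 v : c < Re v -> H v = 0.
  move=> /Fc'[_ FE]; rewrite /H FE /Ln_transform Ln_integrand_root//.
  by rewrite subrr.
by have := identity_halfplane dH H0 ay => /eqP; rewrite subr_eq0 => /eqP.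
Qed.

(** On the left [F] is small at infinity; on the right it is a transform, and
    the modulus of its integrand is largest at [a]. *)
Lemma bounded_at_infinity :
  vanishes_at_infinity_on [set y : C | Re y <= a] F ->
  exists M M0 : R, forall z, M0 <= normc z -> normc (F z) <= M.
Proof.
move=> Fv; have [M0 M00 HM] := F_small Fv ltr01.
pose A := 2 * \int[@lebesgue_measure R]_(x in `]0, +oo[) normc (laplace_integrand n f a%:C x).
exists (Num.max 1 A), M0 => z zM.
have [za|az] := leP (Re z) a; first by rewrite le_max HM.
by rewrite le_max continuation_transform// (laplace_bounded conv (ltW az)) orbT.
Qed.

End Continuation.
End Singularities.
End PrincipalPart.

(** * Differentiation under a rectangle integral *)

Section ParameterRect.
Variable R : realType.
Local Notation C := R[i].
Implicit Types (y z u h : C) (g : C -> C).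
Local Opaque line_integral.

Lemma rect_integralZ g (x1 x2 y1 y2 : R) (c : C) :
  continuous_seg_on g (x1 +i* y1) (x2 +i* y1) ->
  continuous_seg_on g (x2 +i* y1) (x2 +i* y2) ->
  continuous_seg_on g (x2 +i* y2) (x1 +i* y2) ->
  continuous_seg_on g (x1 +i* y2) (x1 +i* y1) ->
  rect_integral (fun z => c * g z) x1 x2 y1 y2 = c * rect_integral g x1 x2 y1 y2.
Proof.
move=> g1 g2 g3 g4; rewrite /rect_integral.
by rewrite (line_integralZ c g1) (line_integralZ c g2) (line_integralZ c g3)
  (line_integralZ c g4) !mulrDr.
Qed.

Lemma continuous_exp_factor y u : continuous (fun z : C => cexp ((z - y) * u)).
Proof.
move=> z; apply: derivable_continuousc.
have Dl : is_derive z (1 : C) (fun v : C => (v - y) * u) u.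
  apply/cderiveP => e e0; exists 1 => // h _.
  have -> : (z + h - y) * u - (z - y) * u - u * h = 0 by ring.
  by rewrite normc0 mulr_ge0 ?normc_ge0// ltW.
by have [De _] := is_derive_compc Dl (is_derive_cexp _).
Qed.

Lemma continuous_sub y : continuous (fun z : C => z - y).
Proof. by move=> z; exact: (derivable_continuousc (@derivable_subr R y z)). Qed.

Section Boundary.
Variables (x1 x2 y1 y2 : R).
Hypotheses (x12 : x1 <= x2) (y12 : y1 <= y2).
Let boundary z := cbox (x1 +i* y1) (x2 +i* y2) z /\ ~~ inside x1 x2 y1 y2 z.
Let continuous_on g := forall z, boundary z -> {for z, continuous g}.

Let continuous_onM g (h : C -> C) : continuous_on g -> continuous_on h ->
  continuous_on (fun z => g z * h z).
Proof. by move=> gc hc z zb; exact: (@cvgM C C _ _ g h _ _ (gc z zb) (hc z zb)). Qed.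

(** As a function of [u = x ^+ n] this is a primitive, up to a factor, of the integrand of
    the transform of the sum of residues when [g z = F z / (z - y)]. *)
Definition exp_rect g y u := rect_integral (fun z => g z * cexp ((z - y) * u)) x1 x2 y1 y2.

(** On the boundary [z - y] is bounded, so the second-order remainder of the
    exponential is uniformly of order [normc h ^+ 2]. *)
Lemma is_derive_exp_rect g y u : continuous_on g ->
  is_derive u (1 : C) (exp_rect g y) (exp_rect (fun z => g z * (z - y)) y u).
Proof.
move=> gc; have gyc : continuous_on (fun z => g z * (z - y)).
  exact: (continuous_onM gc (fun z _ => @continuous_sub y z)).
have ec v : continuous_on (fun z => cexp ((z - y) * v)).
  exact: (fun z _ => @continuous_exp_factor y v z).
have [M M0 gM] := boundary_bounded x12 y12 (continuous_onM gc (ec u)).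
have [L L0 yL] := boundary_bounded x12 y12 (fun z (_ : boundary z) => @continuous_sub y z).
pose K := 4 * (M * (4 * (L ^+ 2 * expR L))) * (x2 - x1 + (y2 - y1)).
have K0 : 0 <= K.
  rewrite !mulr_ge0 ?exprn_ge0 ?expR_ge0//.
  by rewrite addr_ge0// subr_ge0.
apply/cderiveP => e e0; exists (Num.min 1 (e / (K + 1))).
  by rewrite lt_min ltr01 divr_gt0// ltr_wpDl.
move=> h; rewrite lt_min => /andP[h1 hK].
have c0 := continuous_onM gc (ec (u + h)).
have c1 := continuous_onM gc (ec u).
have c2 := continuous_onM gyc (ec u).
have c3 : continuous_on (fun z => h * (g z * (z - y) * cexp ((z - y) * u))).
  have hc : continuous_on (fun=> h) := fun z _ => @cst_continuous C C h z.
  exact: (continuous_onM hc c2).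
have c4 : continuous_on (fun z => g z * cexp ((z - y) * (u + h)) - g z * cexp ((z - y) * u)).
  move=> z zb; exact: (@cvgB C C _ _ _ (fun z => g z * cexp ((z - y) * (u + h)))
    (fun z => g z * cexp ((z - y) * u)) _ _ (c0 z zb) (c1 z zb)).
have c5 : continuous_on (fun z => (g z * cexp ((z - y) * (u + h)) - g z * cexp ((z - y) * u))
    - h * (g z * (z - y) * cexp ((z - y) * u))).
  move=> z zb; exact: (@cvgB C C _ _ _
    (fun z => g z * cexp ((z - y) * (u + h)) - g z * cexp ((z - y) * u))
    (fun z => h * (g z * (z - y) * cexp ((z - y) * u))) _ _ (c4 z zb) (c3 z zb)).
have [s01 s02 s03 s04] := continuous_boundary_sides x12 y12 c0.
have [s11 s12 s13 s14] := continuous_boundary_sides x12 y12 c1.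
have [s21 s22 s23 s24] := continuous_boundary_sides x12 y12 c2.
have [s31 s32 s33 s34] := continuous_boundary_sides x12 y12 c3.
have [s41 s42 s43 s44] := continuous_boundary_sides x12 y12 c4.
rewrite [_ * h]mulrC -(rect_integralZ h s21 s22 s23 s24).
rewrite -(rect_integralB (conj s01 s11) (conj s02 s12) (conj s03 s13) (conj s04 s14)).
rewrite -(rect_integralB (conj s41 s31) (conj s42 s32) (conj s43 s33) (conj s44 s34)).
have bnd z : boundary z -> normc ((g z * cexp ((z - y) * (u + h)) - g z * cexp ((z - y) * u))
    - h * (g z * (z - y) * cexp ((z - y) * u))) <=
    M * (4 * (L ^+ 2 * expR L)) * normc h ^+ 2.
  move=> zb; have -> : (g z * cexp ((z - y) * (u + h)) - g z * cexp ((z - y) * u))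
    - h * (g z * (z - y) * cexp ((z - y) * u)) =
    g z * cexp ((z - y) * u) * (cexp ((z - y) * h) - 1 - (z - y) * h).
    rewrite mulrDr cexpD.
    have E (p q r s t : C) : p * (q * r) - p * q - s * (p * t * q) =
      p * q * (r - 1 - t * s) by ring.
    exact: E.
  rewrite (normcM (g z * _)) -mulrA; apply: ler_pM; rewrite ?normc_ge0//; first exact: gM.
  apply: (le_trans (normc_cexpB1B _)).
  rewrite (normcM (z - y)) exprMn.
  have E1 (p q r : R) : 4 * (p * q * r) = 4 * q * (p * r) by ring.
  have E2 (p q r : R) : 4 * (p * q) * r = 4 * r * (p * q) by ring.
  rewrite E1 E2.
  have zL := yL z zb; have h0 := normc_ge0 h; have z0 := normc_ge0 (z - y).
  rewrite ler_wpM2l ?mulr_ge0 ?exprn_ge0//; apply: ler_pM; rewrite ?exprn_ge0 ?expR_ge0//.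
    by rewrite lerXn2r ?nnegrE.
  by rewrite ler_expR -[L]mulr1; apply: ler_pM => //; exact: ltW.
apply: (le_trans (normc_rect_integral x12 y12 c5 bnd)).
have gen (p q r s : R) : 4 * (p * q * r ^+ 2) * s = 4 * (p * q) * s * r * r by ring.
rewrite gen -/K ler_wpM2r ?normc_ge0//.
have : (K + 1) * normc h <= e by rewrite mulrC -ler_pdivlMr ?ltr_wpDl// ltW.
by apply: le_trans; rewrite ler_wpM2r ?normc_ge0// lerDl.
Qed.

Lemma normc_exp_rect g y (a : R) : continuous_on g -> x2 <= a ->
  exists2 K : R, 0 <= K & forall v : R, 0 <= v ->
    normc (exp_rect g y v%:C) <= K * expR (- (v * (Re y - a))).
Proof.
move=> gc xa; have [M M0 gM] := boundary_bounded x12 y12 gc.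
exists (4 * M * (x2 - x1 + (y2 - y1))).
  by rewrite !mulr_ge0// addr_ge0// subr_ge0.
move=> v v0.
have cc : continuous_on (fun z => g z * cexp ((z - y) * v%:C)).
  exact: (continuous_onM gc (fun z _ => @continuous_exp_factor y v%:C z)).
have bnd z : boundary z -> normc (g z * cexp ((z - y) * v%:C)) <=
    M * expR (- (v * (Re y - a))).
  move=> zb; rewrite (normcM (g z)); apply: ler_pM; rewrite ?normc_ge0//; first exact: gM.
  rewrite normc_cexp ler_expR [(z - y) * _]mulrC ReMr ReD ReN -mulrN ler_wpM2l//.
  by have [/andP[/= /andP[_ zx] _] _] := zb; lra.
apply: (le_trans (normc_rect_integral x12 y12 cc bnd)).
have gen (p q r : R) : 4 * (p * q) * r = 4 * p * r * q by ring.
by rewrite gen.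
Qed.

End Boundary.
End ParameterRect.

(** * Integrals over the half-line *)

Section HalfLine.
Variable R : realType.
Local Notation C := R[i].
Local Notation mu := (@lebesgue_measure R).

Lemma Rintegral_dominated (D : set (measurableTypeR R)) (f_ : nat -> R -> R)
    (f k : R -> R) : measurable D ->
  (forall N, measurable_fun D (f_ N)) -> measurable_fun D f ->
  (forall x, D x -> f_ N x @[N --> \oo] --> f x) ->
  mu.-integrable D (EFin \o k) ->
  (forall N x, D x -> `|f_ N x| <= k x) ->
  \int[mu]_(x in D) f_ N x @[N --> \oo] --> \int[mu]_(x in D) f x.
Proof.
move=> mD mf_ mf f_f ki fk.
have [||||fi _ H] := @dominated_convergence _ _ _ mu D mD (fun N x => (f_ N x)%:E)
  (EFin \o f) (EFin \o k) _ _ _ ki _.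
- by move=> N; exact/measurable_EFinP.
- exact/measurable_EFinP.
- by apply/aeW => x Dx; apply: cvg_EFin; [exact: nearW|exact: f_f].
- by apply/aeW => x N Dx /=; rewrite lee_fin; exact: fk.
by apply: fine_cvg; rewrite fineK//; exact: integrable_fin_num.
Qed.

(** Dominated convergence along the segments from 0 to [N]. *)
Lemma Rintegral_halfline_FTC (u du k : R -> R) (l : R) :
  continuous du -> (forall t, is_derive t (1 : R) u (du t)) ->
  mu.-integrable `]0, +oo[ (EFin \o k) -> (forall t, 0 < t -> `|du t| <= k t) ->
  u N%:R @[N --> \oo] --> l ->
  \int[mu]_(x in `]0, +oo[) du x = l - u 0.
Proof.
move=> duc uE ki duk ul.
pose f_ (N : nat) (x : R) := if x <= N%:R then du x else 0.
have mdu : measurable_fun setT du by exact: continuous_measurable_fun.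
have mf_ N : measurable_fun setT (f_ N).
  by apply: measurable_fun_ifT => //; exact: measurable_fun_ler.
have mS (h : R -> R) (D : set (measurableTypeR R)) :
    measurable_fun setT h -> measurable D -> measurable_fun D h.
  by move=> mh mD; exact: measurable_funS mh.
have mD : measurable (`]0, +oo[%classic : set (measurableTypeR R)) by exact: measurable_itv.
have H : \int[mu]_(x in `]0, +oo[) f_ N x @[N --> \oo] --> \int[mu]_(x in `]0, +oo[) du x.
  apply: (@Rintegral_dominated _ f_ du k mD) => //.
  - by move=> N; exact: mS.
  - exact: mS.
  - move=> x _; apply: cvg_near_cst; near=> N; rewrite /f_ ifT//.
    by near: N; exact: nbhs_infty_ger.
  - move=> N x; rewrite /= in_itv/= andbT => x0; rewrite /f_; case: ifPn => _; first exact: duk.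
    by rewrite normr0 (le_trans _ (duk _ x0)).
have E N : \int[mu]_(x in `]0, +oo[) f_ N x = u N%:R - u 0.
  have <- : \int[mu]_(x in `[0, N%:R]) du x = u N%:R - u 0.
    by apply: Rintegral_FTC => // t _; exact: duc.
  rewrite -Rintegral_itv_obnd_cbnd; last first.
    apply: integrableS (continuous_in_integrable (fun x _ => duc x)) => //.
    by apply: subset_itvr; rewrite bnd_simp.
  rewrite Rintegral_mkcond [RHS]Rintegral_mkcond; apply: eq_Rintegral => x _.
  rewrite /patch !mem_setE !in_itv/= andbT /f_.
  by case: (0 < x) => //=; case: (x <= N%:R).
have : u N%:R - u 0 @[N --> \oo] --> l - u 0 by apply: cvgB => //; exact: cvg_cst.
move/cvg_lim => <-//; apply/esym/cvg_lim => //.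
by under eq_cvg do rewrite -E.
Unshelve. all: by end_near. Qed.

Lemma cintegral_halfline_FTC (p dp : R -> C) (k : R -> R) (l : C) :
  continuous dp -> (forall t, path_derive p t (dp t)) ->
  mu.-integrable `]0, +oo[ (EFin \o k) -> (forall t, 0 < t -> normc (dp t) <= k t) ->
  p N%:R @[N --> \oo] --> l ->
  cintegrable `]0, +oo[ dp /\ cintegral `]0, +oo[ dp = l - p 0.
Proof.
move=> dpc pE ki dpk pl.
have mD : measurable (`]0, +oo[%classic : set (measurableTypeR R)) by exact: measurable_itv.
have [cr ci] : continuous (fun t => Re (dp t)) /\ continuous (fun t => Im (dp t)).
  split=> t; (apply: continuous_comp; first exact: dpc).
    exact: continuous_Re.
  exact: continuous_Im.
have [plr pli] : Re (p N%:R) @[N --> \oo] --> Re l /\ Im (p N%:R) @[N --> \oo] --> Im l.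
  by split; (apply: cvg_comp; first exact: pl); [exact: continuous_Re|exact: continuous_Im].
split.
  have [mr mi] := measurable_fun_continuousc mD dpc.
  apply: (cintegrable_le mD mr mi ki) => x; rewrite /= in_itv/= andbT; exact: dpk.
apply: eq_ReIm; rewrite ?ReD ?ImD ?ReN ?ImN /=.
- apply: (@Rintegral_halfline_FTC (fun t => Re (p t)) _ k _ cr _ ki _ plr) => t.
    by have [] := pE t.
  by move=> /dpk; apply: le_trans; exact: le_normc_Re.
- apply: (@Rintegral_halfline_FTC (fun t => Im (p t)) _ k _ ci _ ki _ pli) => t.
    by have [] := pE t.
  by move=> /dpk; apply: le_trans; exact: le_normc_Im.
Qed.

Lemma is_derive_pow n (t : R) :
  is_derive t (1 : R) (fun x : R => x ^+ n) (n%:R * t ^+ n.-1).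
Proof.
have := @is_deriveX _ _ (id : R -> R) n t 1 1 (is_derive_id _ _).
by rewrite exprfctE /GRing.scale /= mulr1.
Qed.

Lemma expR_pow_small n (d e : R) : (0 < n)%N -> 0 < d -> 0 < e ->
  \forall x \near +oo, expR (- (x ^+ n * d)) <= e.
Proof.
move=> n0 d0 e0; near=> x.
have x1 : 1 <= x by near: x; apply: nbhs_pinfty_ge; rewrite num_real.
have xe : (d * e)^-1 <= x by near: x; apply: nbhs_pinfty_ge; rewrite num_real.
have xn : x <= x ^+ n by rewrite -[leLHS]expr1 ler_weXn2l.
have xn0 : 0 < x ^+ n by rewrite exprn_gt0// (lt_le_trans _ x1).
have := mul_expRN_le (x ^+ n) d0; rewrite mulrC -ler_pdivlMr// => /le_trans; apply.
rewrite ler_pdivrMr// mulrC -ler_pdivrMr// (le_trans _ xn)// (le_trans _ xe)//.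
Unshelve. all: by end_near. Qed.

Lemma integrable_pow_expR n (d : R) : (0 < n)%N -> 0 < d ->
  mu.-integrable `]0, +oo[ (EFin \o (fun x : R => x ^+ n.-1 * expR (- (x ^+ n * d)))).
Proof.
move=> n0 d0; pose f (x : R) := x ^+ n.-1 * expR (- (x ^+ n * d)).
pose u (x : R) := - (n%:R * d)^-1 * expR (- (x ^+ n * d)).
have nd : n%:R * d != 0 by rewrite mulf_neq0 ?gt_eqF ?ltr0n.
have uE t : is_derive t (1 : R) u (f t).
  have D1 : is_derive t (1 : R) (fun x : R => - (x ^+ n * d)) (- (n%:R * t ^+ n.-1 * d)).
    have D := is_deriveN (is_deriveM (is_derive_pow n t) (is_derive_cst d t 1)).
    by apply: (is_derive_eq D); rewrite /GRing.scale /= mulr0 add0r mulrC.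
  have D2 := @is_derive1_comp R (@expR R) (fun x : R => - (x ^+ n * d)) t _ _ (is_derive_expR _) D1.
  have D3 := is_deriveZ (- (n%:R * d)^-1) D2.
  apply: (is_derive_eq D3); rewrite /GRing.scale /= /f.
  have gen (N p q r : R) : N * q != 0 ->
    - (N * q)^-1 * (r * - (N * p * q)) = p * r.
    by move=> /[dup] Nq; rewrite mulf_eq0 negb_or => /andP[N0 q0]; field; rewrite N0 q0.
  exact: gen.
have fc : continuous f.
  move=> x; apply: cvgM; first exact: exprn_continuous.
  apply: continuous_comp; last exact: continuous_expR.
  apply: cvgN; apply: cvgM; last exact: cvg_cst.
  exact: exprn_continuous.
have uc : continuous u.
  move=> x; apply: differentiable_continuous.
  by apply/derivable1_diffP; case: (uE x).
have f0 x : 0 <= x -> 0 <= f x by move=> x0; rewrite mulr_ge0 ?exprn_ge0 ?expR_ge0.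
have mf (D : set (measurableTypeR R)) : measurable D -> measurable_fun D f.
  by move=> mD; apply: measurable_funS (continuous_measurable_fun fc).
suff : mu.-integrable `[0, +oo[ (EFin \o f).
  by apply: integrableS => //; apply: subset_itvr; rewrite bnd_simp.
apply/integrableP; split; first by apply/measurable_EFinP; exact: mf.
have -> : (\int[mu]_(x in `[0%R, +oo[) `|(EFin \o f) x| = \int[mu]_(x in `[0%R, +oo[) (f x)%:E)%E.
  by apply: eq_integral => x; rewrite inE /= in_itv/= andbT => /f0 fx0; rewrite ger0_norm.
rewrite (@ge0_continuous_FTC2y R f u 0 0) ?ltry//.
- by apply: continuous_subspaceT => x; exact: fc.
- apply/cvgrPdist_le => e e0.
  have e1 : 0 < e * (n%:R * d) by rewrite !mulr_gt0// ltr0n.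
  near=> x; rewrite sub0r normrN /u normrM normrN normfV (ger0_norm (expR_ge0 _)).
  rewrite (gtr0_norm (x := _ * d)) ?mulr_gt0 ?ltr0n// mulrC ler_pdivrMr ?mulr_gt0 ?ltr0n//.
  by near: x; exact: expR_pow_small.
- by apply: cvg_at_right_filter; exact: uc.
- by move=> x _; rewrite derive1E; case: (uE x).
Unshelve. all: by end_near. Qed.
End HalfLine.

(** * The transform of the sum of residues *)

Section TransformOfResidues.
Variable R : realType.
Local Notation C := R[i].
Local Notation mu := (@lebesgue_measure R).
Implicit Types (y z w : C).

Lemma exp_rect0 (x1 x2 y1 y2 : R) (g : C -> C) y :
  exp_rect x1 x2 y1 y2 g y 0 = rect_integral g x1 x2 y1 y2.
Proof.
rewrite /exp_rect; suff -> : (fun z => g z * cexp ((z - y) * 0)) = g by [].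
by apply/funext => z; rewrite (mulr0 (z - y)) cexp0 (mulr1 (g z)).
Qed.

Local Opaque line_integral rect_integral cintegral exp_rect.

(** The difference has modulus at most 0 on the boundary. *)
Lemma eq_rect_integral (g h : C -> C) (x1 x2 y1 y2 : R) :
  let boundary z := cbox (x1 +i* y1) (x2 +i* y2) z /\ ~~ inside x1 x2 y1 y2 z in
  x1 <= x2 -> y1 <= y2 ->
  (forall z, boundary z -> {for z, continuous g}) ->
  (forall z, boundary z -> {for z, continuous h}) ->
  (forall z, boundary z -> g z = h z) ->
  rect_integral g x1 x2 y1 y2 = rect_integral h x1 x2 y1 y2.
Proof.
move=> boundary x12 y12 gc hc gh.
have [g1 g2 g3 g4] := continuous_boundary_sides x12 y12 gc.
have [h1 h2 h3 h4] := continuous_boundary_sides x12 y12 hc.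
have dc z : boundary z -> {for z, continuous (fun v => g v - h v)}.
  by move=> zb; exact: (@cvgB C C _ _ _ g h _ _ (gc z zb) (hc z zb)).
have d0 z : boundary z -> normc (g z - h z) <= 0.
  by move=> zb; rewrite gh// subrr normc0.
have := normc_rect_integral x12 y12 dc d0; rewrite mulr0 mul0r.
rewrite (rect_integralB (conj g1 h1) (conj g2 h2) (conj g3 h3) (conj g4 h4)) => H.
apply/eqP; rewrite -subr_eq0; apply/eqP/Normc.eq0_normc/eqP.
by rewrite eq_le H; exact: normc_ge0.
Qed.

Section Singularities.
Variables (F : C -> C) (a : R) (m : nat) (y_ : 'I_m -> C) (n : nat).
Hypothesis n0 : (0 < n)%N.
Hypothesis F_analytic :
  forall y, (forall j, y <> y_ j) -> derivable F y (1 : C).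
Hypothesis y_left : forall j, Re (y_ j) < a.
Let B := bound_y a y_.
Let boundary z := cbox ((- B) +i* (- B)) (a +i* B) z /\ ~~ inside (- B) a (- B) B z.

(** The sum of the residues, as an integral over a rectangle that does not depend on
    [x]. *)
Definition inverse_transform (x : R) : C :=
  (two_pi_i R)^-1 * rect_integral (inversion_integrand n F x) (- B) a (- B) B.

Let aB : - B <= a.
Proof.
by have := bound_y_gt_a a y_; rewrite ltr_norml => /andP[/ltW].
Qed.

Let BB : - B <= B.
Proof. by rewrite ge0_cp// ltW// bound_y_gt0. Qed.

Let continuous_boundary (g : C -> C) :
  (forall z, Re z <= a -> derivable F z (1 : C) -> derivable g z (1 : C)) ->
  forall z, boundary z -> {for z, continuous g}.
Proof.
move=> gF z [zb zi].
by have A := admissible_box F_analytic y_left (lexx B) gF; exact: (admissible_continuous A zb zi).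
Qed.

(** The integrand of the transform is the derivative of
    [t |-> (2 pi i)^-1 E (t ^+ n)], where [E u] is the integral of
    [F z / (z - y) * cexp ((z - y) * u)].  Since [Re z <= a < Re y] on the rectangle, this
    decays exponentially, and its value at 0 is minus the principal part. *)
Lemma laplace_inverse_transform y : a < Re y ->
  cintegrable `]0, +oo[ (laplace_integrand n inverse_transform y) /\
  cintegral `]0, +oo[ (laplace_integrand n inverse_transform y) =
  principal_part F a y_ y.
Proof.
move=> ay; pose g z := F z / (z - y).
have zy z : Re z <= a -> z != y by move=> za; apply/eqP => zy; move: za; rewrite zy leNgt ay.
have gc : forall z, boundary z -> {for z, continuous g}.
  by apply: continuous_boundary => z za dF; apply: derivable_pole => //; exact: zy.
have gyc z : boundary z -> {for z, continuous (fun z => g z * (z - y))}.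
  move=> zb; exact: (@cvgM C C _ _ g (fun z => z - y) _ _ (gc z zb) (@continuous_sub R y z)).
pose E (u : C) := exp_rect (- B) a (- B) B g y u.
pose E' (u : C) := exp_rect (- B) a (- B) B (fun z => g z * (z - y)) y u.
have E'P u : is_derive u (1 : C) E (E' u) by exact: (is_derive_exp_rect aB BB y u gc).
have E'c u : {for u, continuous E'}.
  exact: (is_derive_continuousc (is_derive_exp_rect aB BB y u gyc)).
have [K K0 EK] := normc_exp_rect aB BB y gc (lexx a).
have [K' K'0 E'K] := normc_exp_rect aB BB y gyc (lexx a).
have pw (t : R) : path_derive (fun x : R => (x ^+ n)%:C) t (n%:R * t ^+ n.-1)%:C.
  by split => /=; [exact: is_derive_pow|exact: is_derive_cst].
pose p (t : R) := (two_pi_i R)^-1 * E (t ^+ n)%:C.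
have dpE (t : R) : laplace_integrand n inverse_transform y t =
    (two_pi_i R)^-1 * (E' (t ^+ n)%:C * (n%:R * t ^+ n.-1)%:C).
  pose v : C := (t ^+ n)%:C; pose I := inversion_integrand n F t.
  have nC : (n%:R : C) != 0.
    have -> : (n%:R : C) = (n%:R : R)%:C by rewrite rmorph_nat.
    by rewrite -normc_gt0 normcR normr_gt0 pnatr_eq0 -lt0n.
  have Ic : forall z, boundary z -> {for z, continuous I}.
    by apply: continuous_boundary => z _; exact: derivable_inversion_integrand.
  pose k := cexp (- (v * y)) / n%:R.
  have E'E : E' v = k * rect_integral I (- B) a (- B) B.
    have [s1 s2 s3 s4] := continuous_boundary_sides aB BB Ic.
    rewrite -(rect_integralZ k s1 s2 s3 s4); apply: (eq_rect_integral aB BB).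
    - move=> z zb; exact: (@cvgM C C _ _ (fun z => g z * (z - y)) (fun z => cexp ((z - y) * v)) _ _
        (gyc z zb) (@continuous_exp_factor R y v z)).
    - move=> z zb; exact: (@cvgM C C _ _ (fun=> k) I _ _ (@cst_continuous C C k z) (Ic z zb)).
    - move=> z [/andP[/= /andP[_ za] _] _]; have zy0 : z - y != 0 by rewrite subr_eq0 zy.
      rewrite /g (divfK zy0) /k /I /inversion_integrand -/v.
      have -> : (z - y) * v = - (v * y) + z * v by ring.
      rewrite cexpD.
      have gen (N f q s : C) : N != 0 -> f * (s * q) = s / N * (N * f * q).
        by move=> N0; field.
      exact: gen.
  rewrite /laplace_integrand /inverse_transform -/v -/I E'E /k rmorphM rmorph_nat.
  have gen (N x b q s : C) : N != 0 -> x * b * (q * s) = q * (b / N * s * (N * x)).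
    by move=> N0; field.
  exact: gen.
have d0 : 0 < Re y - a by rewrite subr_gt0.
pose c := normc (two_pi_i R)^-1 * (K' * n%:R).
have := @cintegral_halfline_FTC R p (laplace_integrand n inverse_transform y)
  (fun t => c * (t ^+ n.-1 * expR (- (t ^+ n * (Re y - a))))) 0.
have -> : 0 - p 0 = principal_part F a y_ y.
  by rewrite /p expr0n gtn_eqF// sub0r /E exp_rect0.
apply.
- move=> t; have -> : laplace_integrand n inverse_transform y =
    (fun t : R => (two_pi_i R)^-1 * (E' (t ^+ n)%:C * (n%:R * t ^+ n.-1)%:C)).
    exact/funext.
  apply: (@cvgM C); first exact: cvg_cst.
  apply: (@cvgM C).
    apply: (@continuous_comp _ _ _ (fun t : R => (t ^+ n)%:C) E'); last exact: E'c.
    exact: (path_derive_continuous (pw t)).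
  apply: (@continuous_comp _ _ _ (fun t : R => n%:R * t ^+ n.-1) (fun x : R => x%:C)); last exact: continuous_RtoC.
  by apply: cvgM; [exact: cvg_cst|exact: exprn_continuous].
- move=> t; rewrite dpE.
  have Dl u : is_derive u (1 : C) (fun u : C => (two_pi_i R)^-1 * E u) ((two_pi_i R)^-1 * E' u).
    apply/cderiveP => e e0; have c1 : 0 < normc (two_pi_i R)^-1.
      by rewrite normc_gt0 invr_eq0 two_pi_i_neq0.
    have [r r0 Hr] := (cderiveP _ _ _).1 (E'P u) _ (divr_gt0 e0 c1).
    exists r => // h hr; rewrite -mulrBr -mulrA -mulrBr (normcM (two_pi_i R)^-1).
    by rewrite mulrC -ler_pdivlMr// mulrAC; exact: Hr.
  by rewrite mulrA; exact: (path_derive_comp (pw t) (Dl _)).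
- have := @integrableZl _ _ _ mu _ (measurable_itv _) c _ (integrable_pow_expR n0 d0).
  by apply: eq_integrable => //; exact: measurable_itv.
- move=> t t0; rewrite dpE (normcM (two_pi_i R)^-1) /c -mulrA ler_wpM2l ?normc_ge0//.
  rewrite (normcM (E' _)) normcR ger0_norm ?mulr_ge0 ?exprn_ge0 ?(ltW t0)//.
  have gen (k q r s : R) : k * q * (r * s) = k * s * (q * r) by ring.
  rewrite gen ler_wpM2r ?mulr_ge0 ?exprn_ge0 ?(ltW t0)//.
  by apply: E'K; rewrite exprn_ge0// ltW.
- apply/cvgcP => e e0.
  pose c' := normc (two_pi_i R)^-1 * K.
  have c'0 : 0 <= c' by rewrite mulr_ge0 ?normc_ge0.
  have e1 : 0 < e / (c' + 1) by rewrite divr_gt0// ltr_wpDl.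
  have /(cvgr_idn (R := R)) : \forall x \near +oo, expR (- (x ^+ n * (Re y - a))) <= e / (c' + 1).
    exact: expR_pow_small.
  rewrite nbhs_simpl => H; near=> N.
  have HN : expR (- (N%:R ^+ n * (Re y - a))) <= e / (c' + 1) by near: N.

  rewrite sub0r normcN /p (normcM (two_pi_i R)^-1).
  have HE := EK (N%:R ^+ n) (exprn_ge0 _ (ler0n _ _)).
  have := ler_wpM2l (normc_ge0 (two_pi_i R)^-1) HE => /le_lt_trans; apply.
  rewrite mulrA -/c'; apply: (le_lt_trans (ler_wpM2l c'0 HN)).
  by rewrite mulrA ltr_pdivrMr ?ltr_wpDl// mulrC ltr_pM2l// ltrDl.
Unshelve. all: by end_near. Qed.

End Singularities.
End TransformOfResidues.

(** * Functions whose exponential moments agree *)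

Section Moments.
Variable R : realType.
Local Notation mu := (@lebesgue_measure R).
Local Notation D := (`]0, +oo[%classic : set (measurableTypeR R)).

Lemma cvg_of_le_inv (f : nat -> R) (l K : R) :
  (forall N, (0 < N)%N -> `|l - f N| <= K / N%:R) -> f N @[N --> \oo] --> l.
Proof.
move=> fK; apply/cvgrPdist_le => e e0; near=> N.
have N0 : (0 < N)%N by near: N; exact: nbhs_infty_gt.
apply: le_trans (fK N N0) _; rewrite ler_pdivrMr ?ltr0n// mulrC -ler_pdivrMr//.
by near: N; exact: nbhs_infty_ger.
Unshelve. all: by end_near. Qed.

Lemma bernoulli_ineq (q : R) (M : nat) : 0 <= q <= 1 -> 1 - M%:R * q <= (1 - q) ^+ M.
Proof.
move=> /andP[q0 q1]; elim: M => [|M IH]; first by rewrite mul0r subr0 expr0.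
rewrite exprSr -natr1; have := ler_wpM2r (_ : 0 <= 1 - q) IH; rewrite subr_ge0 => /(_ q1).
apply: le_trans; have : 0 <= M%:R * q * q by rewrite !mulr_ge0.
by nra.
Qed.

(** An exponent for which [(1 - expR (- N v)) ^+ M] separates [v <= s] from [v > s];
    the factor [N] decides the case [v = s]. *)
Definition steepness (s : R) (N : nat) : nat := (Num.truncn (N%:R * expR (N%:R * s))).+1.

Lemma steepness_itv (s : R) N :
  N%:R * expR (N%:R * s) <= (steepness s N)%:R <= N%:R * expR (N%:R * s) + 1.
Proof.
have := @truncn_itv _ (N%:R * expR (N%:R * s)) (mulr_ge0 (ler0n _ _) (expR_ge0 _)).
by move=> /andP[h1 h2]; rewrite (ltW h2)/= /steepness -natr1 lerD2r.
Qed.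

(** With [M] between [N e^(N s)] and [N e^(N s) + 1] the powers are at most
    [exp (- N)] if [v <= s], and by Bernoulli's inequality at least
    [1 - 2 N e^(N (s - v))] if [v > s]. *)
Lemma cvg_steep (s v : R) : 0 <= s -> 0 <= v ->
  (1 - expR (- v) ^+ N) ^+ steepness s N @[N --> \oo] --> ((s < v)%R%:R : R).
Proof.
move=> s0 v0.
have q01 N : 0 <= expR (- v) ^+ N <= 1.
  by rewrite exprn_ge0 ?expR_ge0//= exprn_ile1 ?expR_ge0// -expR0 ler_expR oppr_le0.
have qE N : expR (- v) ^+ N = expR (- (N%:R * v)) by rewrite -expRM_natl mulrN.
have [sv|vs] := ltP s v; last first.
  apply: (@cvg_of_le_inv _ _ 1) => N N0; rewrite sub0r normrN.
  have /andP[q0 q1] := q01 N; have /andP[M1 _] := steepness_itv s N.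
  set q := expR (- v) ^+ N in q0 q1 *; set M := steepness s N in M1 *.
  rewrite ger0_norm ?exprn_ge0 ?subr_ge0//.
  have le1 : 1 - q <= expR (- q) by exact: expR_ge1Dx.
  apply: (@le_trans _ _ (expR (- q) ^+ M)).
    by rewrite lerXn2r ?nnegrE ?subr_ge0 ?expR_ge0.
  rewrite -expRM_natl; apply: (@le_trans _ _ (expR (- (N%:R * 1)))).
    rewrite ler_expR mulr1 mulrN lerN2 mulrC.
    have Nq : N%:R * expR (N%:R * s) * q <= M%:R * q by rewrite ler_wpM2r.
    rewrite [q * _]mulrC (le_trans _ Nq)// -mulrA -{1}[N%:R]mulr1 ler_wpM2l//.
    by rewrite /q qE -expRD -expR0 ler_expR -mulrBr mulr_ge0// subr_ge0.
  have N0' : 0 < N%:R :> R by rewrite ltr0n.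
  rewrite ler_pdivlMr// mulrC; apply: le_trans (mul_expRN_le N%:R ltr01) _.
  by rewrite invr1.
pose d := v - s; have d0 : 0 < d by rewrite subr_gt0.
apply: (@cvg_of_le_inv _ _ (8 / d ^+ 2)) => N N0.
have /andP[q0 q1] := q01 N; have /andP[_ M2] := steepness_itv s N.
have N0' : 0 < N%:R :> R by rewrite ltr0n.
set M := steepness s N in M2 *.
have pow1 : (1 - expR (- v) ^+ N) ^+ M <= 1 by rewrite exprn_ile1 ?subr_ge0// gerBl.
rewrite ger0_norm ?subr_ge0//; have := bernoulli_ineq M (q01 N).
set P := (_ - _) ^+ M; set q := expR (- v) ^+ N in q0 q1 P *.
move=> B; apply: (@le_trans _ _ (M%:R * q)); first by move: B; rewrite [true%:R]/(1 : R) !lerBlDr addrC.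
apply: (@le_trans _ _ ((N%:R * expR (N%:R * s) + 1) * q)); first by rewrite ler_wpM2r.
have N1 : 1 <= N%:R :> R by rewrite ler1n.
apply: (@le_trans _ _ (2 * N%:R * expR (- (N%:R * d)))).
  rewrite mulrDl mul1r -mulrA.
  have E1 : expR (N%:R * s) * q = expR (- (N%:R * d)).
    by rewrite /q qE -expRD /d; congr expR; ring.
  have qE1 : q <= expR (- (N%:R * d)).
    by rewrite /q qE ler_expR lerN2 ler_wpM2l// /d gerBl.
  rewrite E1; apply: le_trans (_ : _ <= N%:R * expR (- (N%:R * d)) + N%:R * expR (- (N%:R * d))) _.
    by rewrite lerD2l (le_trans qE1)// ler_peMl ?expR_ge0.
  have gen (p r : R) : p * r + p * r = 2 * p * r by ring.
  by rewrite gen.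
(* the square of r e^(-r) <= 1 at r = N d / 2 *)
pose r := N%:R * d / 2.
have r0 : 0 <= r by rewrite /r divr_ge0// mulr_ge0// ltW.
have rE : r ^+ 2 * expR (- (N%:R * d)) <= 1.
  have h := mul_expRN_le r ltr01; rewrite mulr1 invr1 in h.
  have -> : - (N%:R * d) = - r + - r by rewrite /r; lra.
  by rewrite expRD expr2 mulrACA mulr_ile1 ?mulr_ge0 ?expR_ge0 ?(ltW d0).
rewrite ler_pdivlMr// ler_pdivlMr ?exprn_gt0//.
have -> : 2 * N%:R * expR (- (N%:R * d)) * N%:R * d ^+ 2 = 8 * (r ^+ 2 * expR (- (N%:R * d))).
  by rewrite /r; field.
by rewrite -[leRHS]mulr1 ler_wpM2l.
Qed.

Section Vanishing.
Variables (n : nat) (h : R -> R).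
Hypothesis n0 : (0 < n)%N.
Hypothesis hi : mu.-integrable D (EFin \o h).

Let mD : measurable D. Proof. exact: measurable_itv. Qed.

Let u (x : R) : R := expR (- x ^+ n).

Let u01 x : D x -> 0 <= u x <= 1.
Proof.
rewrite /= in_itv/= andbT => x0; rewrite expR_ge0/= -expR0 ler_expR oppr_le0.
by rewrite exprn_ge0// ltW.
Qed.

Let weight (k N M : nat) x := u x ^+ k * (1 - u x ^+ N) ^+ M.

Let weight01 k N M x : D x -> 0 <= weight k N M x <= 1.
Proof.
move=> /u01/andP[u0 u1]; have uN : 0 <= u x ^+ N <= 1 by rewrite exprn_ge0//= exprn_ile1.
have /andP[uN0 uN1] := uN.
rewrite mulr_ge0 ?exprn_ge0 ?subr_ge0//= mulr_ile1 ?exprn_ge0 ?exprn_ile1 ?subr_ge0//.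
by rewrite gerBl.
Qed.

Let uc : continuous u.
Proof.
move=> x; apply: continuous_comp; last exact: continuous_expR.
by apply: cvgN; exact: exprn_continuous.
Qed.

Let weight_continuous k N M : continuous (weight k N M).
Proof.
have pc (g : R -> R) j : continuous g -> continuous (fun x => g x ^+ j).
  move=> gc x; apply: (@continuous_comp _ _ _ g (fun y => y ^+ j)); first exact: gc.
  exact: exprn_continuous.
move=> x; apply: (@cvgM R R _ _ (fun x => u x ^+ k)); first exact: (pc u k uc).
by apply: (pc (fun x => 1 - u x ^+ N)) => z; apply: cvgB; [exact: cvg_cst|exact: (pc u N uc)].
Qed.

Let mweight k N M : measurable_fun D (fun x => weight k N M x * h x).
Proof.
apply: measurable_funM.
  by apply: measurable_funS (continuous_measurable_fun (@weight_continuous k N M)).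
by case/integrableP: hi => /measurable_EFinP.
Qed.

Let weight_le k N M x : D x -> `|weight k N M x * h x| <= `|h x|.
Proof.
by move=> /(weight01 k N M)/andP[w0 w1]; rewrite normrM ger0_norm// ler_piMl.
Qed.

Let iweight k N M : mu.-integrable D (EFin \o (fun x => weight k N M x * h x)).
Proof.
apply: (le_integrable mD _ _ hi); first by apply/measurable_EFinP; exact: mweight.
by move=> x Dx /=; rewrite lee_fin weight_le.
Qed.

Variable c : R.
Hypothesis moments : forall k : nat,
  \int[mu]_(x in D) (expR (- x ^+ n) ^+ k * h x) = c.

(** The weight with exponent [M.+2] is a difference of two weights with exponent
    [M.+1], and the weight with exponent 1 a difference of two exponentials, whose
    moments are equal. *)
Lemma weighted_moment_eq0 k N M : \int[mu]_(x in D) (weight k N M.+1 x * h x) = 0.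
Proof.
have w0 j : \int[mu]_(x in D) (weight j N 0 x * h x) = c.
  by rewrite -(moments j); apply: eq_Rintegral => x _; rewrite /weight expr0 mulr1.
have step j L : \int[mu]_(x in D) (weight j N L.+1 x * h x) =
    \int[mu]_(x in D) (weight j N L x * h x) - \int[mu]_(x in D) (weight (j + N) N L x * h x).
  rewrite -RintegralB//; apply: eq_Rintegral => x _.
  by rewrite /weight exprD exprS; ring.
elim: M k => [|M IH] k; rewrite step ?w0 ?subrr//.
by rewrite !IH subrr.
Qed.

Let mtail (t : R) : measurable_fun D (fun x : R => (t < x)%R%:R * h x).
Proof.
apply: measurable_funM; last by case/integrableP: hi => /measurable_EFinP.
apply: (eq_measurable_fun (\1_(`]t, +oo[) : R -> R)).
  by move=> x _; rewrite indicE mem_setE in_itv/= andbT.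
exact: measurable_indic.
Qed.

(** The weights with exponent [steepness (t ^+ n) N] tend boundedly to the indicator
    function of the half-line. *)
Lemma tail_integral_eq0 (t : R) : 0 <= t ->
  \int[mu]_(x in D) ((t < x)%R%:R * h x) = 0.
Proof.
move=> t0; have t0n : 0 <= t ^+ n by rewrite exprn_ge0.
pose f_ N x := weight 0 N (steepness (t ^+ n) N) x * h x.
have H : \int[mu]_(x in D) f_ N x @[N --> \oo] --> \int[mu]_(x in D) ((t < x)%R%:R * h x).
  apply: (@Rintegral_dominated _ _ f_ _ (fun x => `|h x|) mD).
  - by move=> N; exact: mweight.
  - exact: mtail.
  - move=> x; rewrite /= in_itv/= andbT => x0; apply: cvgM; last exact: cvg_cst.
    have -> : (t < x) = (t ^+ n < x ^+ n) by rewrite ltr_pXn2r ?nnegrE// ltW.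
    have := cvg_steep t0n (exprn_ge0 n (ltW x0)).
    by under [X in _ -> X]eq_cvg do rewrite /weight expr0 mul1r.
  - exact: (integrable_norm hi).
  - by move=> N x Dx; exact: weight_le.
rewrite -(cvg_lim _ H)//; apply: cvg_lim => //.
apply: cvg_near_cst; apply: nearW => N; exact: weighted_moment_eq0.
Qed.

(** The primitive of [h] vanishes identically, and almost everywhere its
    derivative is [h]. *)
Lemma ae_eq0_of_moments : {ae mu, forall x, 0 < x -> h x = 0}.
Proof.
have fi : mu.-integrable setT (EFin \o (h \_ D)).
  have := (@integrable_mkcond _ (measurableTypeR R) R mu D (EFin \o h) mD).1 hi.
  by apply: eq_integrable => // x _; rewrite /patch /=; case: ifP.
have FE y : \int[mu]_(x in `]-oo, y]) (h \_ D) x = 0.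
  have -> : \int[mu]_(x in `]-oo, y]) (h \_ D) x = \int[mu]_(x in D) (h x - (y < x)%R%:R * h x).
    rewrite Rintegral_mkcond [RHS]Rintegral_mkcond; apply: eq_Rintegral => x _.
    rewrite /patch !mem_setE !in_itv/= andbT leNgt.
    by case: (y < x); case: (0 < x) => //=; rewrite ?mul1r ?mul0r ?subrr ?subr0.
  have [y0|y0] := ltP y 0.
    have -> : \int[mu]_(x in D) (h x - (y < x)%R%:R * h x) = \int[mu]_(x in D) (fun=> 0 : R) x.
      apply: eq_Rintegral => x; rewrite inE /= in_itv/= andbT => x0.
      by rewrite (lt_trans y0 x0) mul1r subrr.
    by rewrite Rintegral_cst// mul0r.
  have t0 : \int[mu]_(x in D) h x = 0.
    rewrite -[RHS](tail_integral_eq0 (lexx 0)); apply: eq_Rintegral => x.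
    by rewrite inE /= in_itv/= andbT => ->; rewrite mul1r.
  rewrite RintegralB//; last first.
    apply: (le_integrable mD _ _ hi); first by apply/measurable_EFinP; exact: mtail.
    by move=> x _ /=; rewrite lee_fin; case: (y < x); rewrite ?mul1r ?mul0r ?normr0.
  by rewrite t0 (tail_integral_eq0 y0) subrr.
have := @FTC1Ny R (h \_ D) _ (integrable_locally mD hi).
have -> : (fun x : R => \int[mu]_(t in `]-oo, x]) (h \_ D) t) = cst 0 by exact/funext.
move=> H; have fiy y : mu.-integrable `]-oo, y] (EFin \o (h \_ D)).
  by apply: integrableS fi.
have := H fiy.
apply: (@filterS _ _ (ae_filter_ringOfSetsType mu)) => x [_ dx] x0.
by move: dx; rewrite derive1_cst /patch mem_setE in_itv/= andbT x0.
Qed.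

End Vanishing.
End Moments.

(** * Inversion almost everywhere *)

Section Uniqueness.
Variable R : realType.
Local Notation C := R[i].
Local Notation mu := (@lebesgue_measure R).
Local Notation D := (`]0, +oo[%classic : set (measurableTypeR R)).
Implicit Types (y z w : C).

(** Passing from [b] to [b + k] multiplies the integrand by [expR (- x ^+ n) ^+ k], so
    the hypothesis says that all these moments of the difference agree. *)
Lemma ae_eq_of_transforms n (f g : R -> C) (b : R) (c : C) : (0 < n)%N ->
  cintegrable D (laplace_integrand n f b%:C) ->
  cintegrable D (laplace_integrand n g b%:C) ->
  (forall k : nat, cintegral D (laplace_integrand n f (b + k%:R)%:C) -
    cintegral D (laplace_integrand n g (b + k%:R)%:C) = c) ->
  {ae mu, forall x, 0 < x -> f x = g x}.
Proof.
move=> n0 fi gi fg; have mD : measurable D by exact: measurable_itv.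
pose h x := laplace_integrand n f b%:C x - laplace_integrand n g b%:C x.
have hi : cintegrable D h by exact: cintegrableB.
have hk (k : nat) x : laplace_integrand n f (b + k%:R)%:C x - laplace_integrand n g (b + k%:R)%:C x =
    (expR (- x ^+ n) ^+ k)%:C * h x.
  rewrite (laplace_integrand_shift n f b (b + k%:R)%:C) (laplace_integrand_shift n g b (b + k%:R)%:C).
  rewrite -mulrBr -/(h x); congr (_ * _).
  have -> : - ((x ^+ n)%:C * ((b + k%:R)%:C - b%:C)) = (k%:R * - x ^+ n)%:C.
    by rewrite -rmorphB /= addrAC subrr add0r -rmorphM -rmorphN; congr _%:C; ring.
  by rewrite -expRM_natl /cexp /= cos0 sin0 (_ : 1 +i* 0 = 1 :> C)// mulr1.
have bk (k : nat) : b <= Re ((b + k%:R)%:C : C) by rewrite /= lerDl.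
have mom (k : nat) : cintegral D (fun x => (expR (- x ^+ n) ^+ k)%:C * h x) = c.
  rewrite -(fg k) -cintegralB//; [|exact: cintegrable_laplace fi _ (bk k)|exact: cintegrable_laplace gi _ (bk k)].
  by apply: eq_cintegral => x _; rewrite hk.
have hr : {ae mu, forall x, 0 < x -> Re (h x) = 0}.
  apply: (@ae_eq0_of_moments _ n _ n0 hi.1 (Re c)) => k.
  by rewrite -(mom k); apply: eq_Rintegral => x _; rewrite ReMr.
have him : {ae mu, forall x, 0 < x -> Im (h x) = 0}.
  apply: (@ae_eq0_of_moments _ n _ n0 hi.2 (Im c)) => k.
  by rewrite -(mom k); apply: eq_Rintegral => x _; rewrite ImMr.
apply: (@filterS2 _ _ (ae_filter_ringOfSetsType mu)) hr him => x hr him x0.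
have : h x = 0 by apply: eq_ReIm; rewrite ?hr ?him.
move=> /eqP; rewrite /h /laplace_integrand -mulrBr mulf_eq0 => /orP[|]; last first.
  by rewrite subr_eq0 => /eqP.
rewrite mulf_eq0 (negbTE (cexp_neq0 _)) orbF => /eqP xn.
have := congr1 (@complex.Re R) xn; rewrite /= => /eqP.
by rewrite expf_eq0 gt_eqF// andbF.
Qed.

Section Inversion.
Variables (F : C -> C) (a : R) (m : nat) (y_ : 'I_m -> C) (n : nat) (f : R -> C).
Hypothesis n0 : (0 < n)%N.
Hypothesis y_inj : injective y_.
Hypothesis F_analytic :
  forall y, (forall j, y <> y_ j) -> derivable F y (1 : C).
Hypothesis y_left : forall j, Re (y_ j) < a.
Hypothesis F_vanish : vanishes_at_infinity_on [set y : C | Re y <= a] F.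

Lemma inverse_transformE x : 0 < x ->
  inverse_transform F a y_ n x =
  (two_pi_i R)^-1 * vline_integral a (inversion_integrand n F x).
Proof.
move=> x0; rewrite (vline_integral_residues y_inj F_analytic y_left F_vanish n0 x0).
congr (_ * _); apply: (rect_residues y_inj F_analytic y_left (lexx _)) => z _.
exact: derivable_inversion_integrand.
Qed.

Lemma ae_eq_inverse_transform : Ln_continuation n f F ->
  cintegrable D (laplace_integrand n f a%:C) ->
  {ae mu, forall x, 0 < x -> f x = inverse_transform F a y_ n x}.
Proof.
move=> Fc conv; have [M [M0 FM]] := bounded_at_infinity F_analytic y_left n0 Fc conv F_vanish.
have ab : a < a + 1 by rewrite ltrDl.
have ak (k : nat) : a < Re ((a + 1 + k%:R)%:C : C) by rewrite /= (lt_le_trans ab)// lerDl.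
pose c := F (a + 1)%:C - principal_part F a y_ (a + 1)%:C.
apply: (ae_eq_of_transforms (b := a + 1) (c := c) n0).
- exact: (@cintegrable_laplace _ _ _ _ conv (a + 1)%:C (ltW ab)).
- by have [] := @laplace_inverse_transform _ F a m y_ n n0 F_analytic y_left (a + 1)%:C ab.
- move=> k; have [_ ->] := laplace_inverse_transform n0 F_analytic y_left (ak k).
  rewrite -(continuation_transform F_analytic y_left n0 Fc conv (ak k)).
  exact: (regular_part_constant y_inj F_analytic y_left FM (ak k) (y2 := (a + 1)%:C) ab).
Qed.

End Inversion.
End Uniqueness.

Theorem theorem3 (R : realType) (r n : nat) (hn : n = (2 ^ r)%N)
    (f : R -> R[i]) (F : R[i] -> R[i]) (a : R)
    (m : nat) (y_ : 'I_m -> R[i])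
    (hF : Ln_continuation n f F)
    (y_inj : injective y_)
    (F_analytic : forall y : R[i], (forall j, y <> y_ j) -> derivable F y (1 : R[i]))
    (y_left : forall j, complex.Re (y_ j) < a)
    (F_branch0 : ~ branch_point F 0)
    (F_vanish : vanishes_at_infinity_on [set y : R[i] | complex.Re y <= a] F) :
  (forall x : R, 0 < x ->
     cvg (segment_integral a (inversion_integrand n F x) T @[T --> +oo]) /\
     (two_pi_i R)^-1 * vline_integral a (inversion_integrand n F x) =
       \sum_(j < m) residue (inversion_integrand n F x) (y_ j)) /\
  (Ln_convergent_on_line n f a ->
     {ae @lebesgue_measure R, forall x : R, 0 < x ->
        f x = (two_pi_i R)^-1 *
              vline_integral a (inversion_integrand n F x)}).
Proof.
have n0 : (0 < n)%N by rewrite hn expn_gt0.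
split => [x x0|line_conv].
  have C := @cvg_segment_integral R F a m y_ y_inj F_analytic y_left F_vanish n x n0 x0.
  split; first by apply/cvg_ex; exists (two_pi_i R * \sum_(j < m) residue (inversion_integrand n F x) (y_ j)).
  rewrite (vline_integral_residues y_inj F_analytic y_left F_vanish n0 x0).
  by rewrite mulKf ?two_pi_i_neq0.
have conv : cintegrable `]0, +oo[ (laplace_integrand n f a%:C).
  by rewrite -Ln_integrand_root//; apply: line_conv.
have := ae_eq_inverse_transform n0 y_inj F_analytic y_left F_vanish hF conv.
apply: (@filterS _ _ (ae_filter_ringOfSetsType _)) => x fx x0.
by rewrite (fx x0) (inverse_transformE n0 y_inj F_analytic y_left F_vanish).
Qed.
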